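(* Let $d\ge2$, $1\le n_1\le n_2$, $\varepsilon\in(0,1]$, $p\in[1,2]$, and $\alpha,\beta\in(0,1)$ with $\alpha+\beta\le1/2$. Consider two-sample testing of $H_0:\mathbf p_X=\mathbf p_Y$ versus $H_1:\|\mathbf p_X-\mathbf p_Y\|_p\ge\rho$ where $X_i\sim\mathrm{Multinom}(\mathbf p_X)$, $Y_{i'}\sim\mathrm{Multinom}(\mathbf p_Y)$ on $[d]$. There exist absolute constants $c,C,C_0,C_0'>0$ (not depending on $n_1,n_2,d,\varepsilon,p,\alpha,\beta$) such that: (i) if $n_1\ge C_0\log\{1/(\alpha\beta)\}$, then $$c\Big(\frac{d^{1/p-1/4}}{(n_1\varepsilon^2)^{1/2}}\wedge\frac{1}{d^{1-1/p}\{\log d\}^{1/2}}\Big)\le\rho^*_{\mathrm{NI}}(n_1,n_2,\varepsilon,L_p,\alpha,\beta)\le C\frac{d^{1/p-1/4}}{(n_1\varepsilon^2)^{1/2}}[\log\{1/(\alpha\beta)\}]^2;$$ (ii) if $n_1\varepsilon^2\ge C_0'\log\{1/(\alpha\beta)\}$, then $$c\Big(\frac{d^{1/p-1/2}}{(n_1\varepsilon^2)^{1/2}}\wedge\big(d^{1/p-1}\mathbb 1\{p\notin\{1,2\}\}+\mathbb 1\{p\in\{1,2\}\}\big)\Big)\le\rho^*_{\mathrm{I}}(n_1,n_2,\varepsilon,L_p,\alpha,\beta)\le C\frac{d^{1/p-1/2}}{(n_1\varepsilon^2)^{1/2}}\big(\{\log(1/\beta)\}^2+[\log\{1/(\alp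ha\beta)\}]^{1/2}\big).$$
   Context: Here $\mathcal P$ is the set of all distributions on $[d]=\{1,\dots,d\}$, identified with probability vectors, and the metric is $D(P_X,P_Y)=\|\mathbf p_X-\mathbf p_Y\|_p=(\sum_j|p_{X,j}-p_{Y,j}|^p)^{1/p}$. Two-sample LDP minimax radius: $X_1,\dots,X_{n_1}$ i.i.d. $P_X$, $Y_1,\dots,Y_{n_2}$ i.i.d. $P_Y$. A (two-sample sequentially interactive) mechanism $Q$ outputs $Z_1,\dots,Z_{n_1},W_1,\dots,W_{n_2}$, where for $i\le n_1$, $Z_i\sim Q_{X,i}(\cdot\mid X_i,Z_{1:i-1},W_{1:i-1})$, $W_i\sim Q_{Y,i}(\cdot\mid Y_i,Z_{1:i-1},W_{1:i-1})$, and for $n_1<j\le n_2$, $W_j\sim Q_{Y,j}(\cdot\mid Y_j,Z_{1:n_1},W_{1:j-1})$. $Q$ is $\varepsilon$-LDP if each conditional distribution satisfies $Q(S\mid x,\text{past})\le e^{\varepsilon}Q(S\mid x',\text{past})$ for all measurable $S$, raw values $x,x'$ and past outputs; it is non-interactive if each depends only on its own raw datum. A test $\phi$ (possibly randomized, $\{0,1\}$-valued function of the outputs) has level $\alpha$ if $\sup_{P}\mathbb P_{P,P,Q}(\phi=1)\le\alpha$. Risk $\mathcal R(\rho)=\alpha+\inf_{Q\in\mathcal Q_\varepsilon}\inf_{\phi\text{ level }\alpha}\sup_{D(P_X,P_Y)\ge\rho}\mathbb P_{P_X,P_Y,Q}(\phi=0)$ and $\rho^*(n_1,n_2,\varepsilon,D,\alpha,\beta)=\inf\{\rho>0:\mathcal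 R(\rho)\le\alpha+\beta\}$; $\rho^*_{\mathrm{NI}}$, $\rho^*_{\mathrm I}$ use for $\mathcal Q_\varepsilon$ all non-interactive, resp. sequentially interactive, $\varepsilon$-LDP mechanisms. *)

(* Defs.v *)
From HB Require Import structures.
From mathcomp Require Import all_boot all_order all_algebra.
From mathcomp Require Import all_classical all_reals all_analysis.
From mathcomp Require Import measurable_realfun.

Set Implicit Arguments.
Unset Strict Implicit.
Unset Printing Implicit Defensive.

Import Order.TTheory GRing.Theory Num.Theory.
Local Open Scope classical_set_scope.
Local Open Scope ring_scope.


Definition pmf (R : realType) (d : nat) (q : 'I_d -> R) : Prop :=
  (forall i, 0 <= q i) /\ \sum_(i < d) q i = 1.

Definition Lp_dist (R : realType) (d : nat) (p : R) (a b : 'I_d -> R) : R :=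
  (\sum_(i < d) `|a i - b i| `^ p) `^ p^-1.

(* A channel family: step index (= number of previous outputs of this sample),
   raw datum, past Z-outputs, past W-outputs  |->  probability on outputs T *)
Definition chan (R : realType) (d : nat) (dT : measure_display) (T : measurableType dT) :=
  nat -> 'I_d -> seq T -> seq T -> probability T R.

Local Open Scope ereal_scope.

(* phase 2: W_{j+1}, j >= n1, given (Z_{1:n1}, W_{1:j}); k remaining steps *)
Fixpoint phase2 (R : realType) (d : nat) (dT : measure_display) (T : measurableType dT)
  (QY : chan R d T) (pY : 'I_d -> R) (phi : seq T -> seq T -> R)
  (k : nat) (z w : seq T) : \bar R :=
  match k with
  | 0 => (phi z w)%:E
  | k'.+1 => \sum_(y < d) (pY y)%:E *
      \int[QY (size w) y z w]_t phase2 QY pY phi k' z (rcons w t)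
  end.

(* phase 1: rounds i < n1, Z_{i+1} and W_{i+1} both given (Z_{1:i}, W_{1:i}) *)
Fixpoint phase1 (R : realType) (d : nat) (dT : measure_display) (T : measurableType dT)
  (QX QY : chan R d T) (pX pY : 'I_d -> R) (phi : seq T -> seq T -> R)
  (m : nat) (k : nat) (z w : seq T) : \bar R :=
  match k with
  | 0 => phase2 QY pY phi m z w
  | k'.+1 => \sum_(x < d) (pX x)%:E *
      \int[QX (size z) x z w]_s
        (\sum_(y < d) (pY y)%:E *
           \int[QY (size w) y z w]_t
              phase1 QX QY pX pY phi m k' (rcons z s) (rcons w t))
  end.

Definition rej_prob (R : realType) (d n1 n2 : nat) (dT : measure_display) (T : measurableType dT)
  (QX QY : chan R d T) (pX pY : 'I_d -> R) (phi : seq T -> seq T -> R) : \bar R :=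
  phase1 QX QY pX pY phi (n2 - n1) n1 [::] [::].

Definition LDP_mech (R : realType) (d n1 n2 : nat) (eps : R) (dT : measure_display)
  (T : measurableType dT) (QX QY : chan R d T) : Prop :=
  [/\ (forall (i : nat) x, (i < n1)%N -> forall S : set T, measurable S ->
        measurable_fun [set: i.-tuple T * i.-tuple T]
          (fun h => QX i x (val h.1) (val h.2) S : \bar R)),
      (forall (j : nat) y, (j < n2)%N -> forall S : set T, measurable S ->
        measurable_fun [set: (minn j n1).-tuple T * j.-tuple T]
          (fun h => QY j y (val h.1) (val h.2) S : \bar R)),
      (forall i x x' z w (S : set T), measurable S ->
        QX i x z w S <= (expR eps)%:E * QX i x' z w S) &
      (forall j y y' z w (S : set T), measurable S ->
        QY j y z w S <= (expR eps)%:E * QY j y' z w S)].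

Definition non_interactive (R : realType) (d : nat) (dT : measure_display) (T : measurableType dT)
  (QX QY : chan R d T) : Prop :=
  (forall i x z w z' w', QX i x z w = QX i x z' w') /\
  (forall j y z w z' w', QY j y z w = QY j y z' w').

(* randomized test: phi = probability of rejecting (phi = 1) given the outputs *)
Definition rand_test (R : realType) (n1 n2 : nat) (dT : measure_display) (T : measurableType dT)
  (phi : seq T -> seq T -> R) : Prop :=
  measurable_fun [set: n1.-tuple T * n2.-tuple T] (fun h => phi (val h.1) (val h.2) : R)
  /\ (forall z w, (0 <= phi z w <= 1)%R).

Definition level (R : realType) (d n1 n2 : nat) (alpha : R) (dT : measure_display)
  (T : measurableType dT) (QX QY : chan R d T) (phi : seq T -> seq T -> R) : Prop :=
  forall P : 'I_d -> R, pmf P -> rej_prob n1 n2 QX QY P P phi <= alpha%:E.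

Definition typeII (R : realType) (d n1 n2 : nat) (p rho : R) (dT : measure_display)
  (T : measurableType dT) (QX QY : chan R d T) (phi : seq T -> seq T -> R) : \bar R :=
  ereal_sup [set r | exists pX pY : 'I_d -> R, [/\ pmf pX, pmf pY,
     (rho <= Lp_dist p pX pY)%R & r = 1 - rej_prob n1 n2 QX QY pX pY phi]].

Definition risk (R : realType) (ni : bool) (d n1 n2 : nat) (eps p alpha rho : R) : \bar R :=
  alpha%:E + ereal_inf [set r | exists (dT : measure_display) (T : measurableType dT)
     (QX QY : chan R d T) (phi : seq T -> seq T -> R),
     [/\ LDP_mech n1 n2 eps QX QY, (ni -> non_interactive QX QY),
         rand_test n1 n2 phi, level n1 n2 alpha QX QY phi &
         r = typeII n1 n2 p rho QX QY phi]].

Definition rho_star (R : realType) (ni : bool) (d n1 n2 : nat) (eps p alpha beta : R) : \bar R :=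
  ereal_inf [set r | exists rho : R, [/\ (0 < rho)%R,
     risk ni d n1 n2 eps p alpha rho <= (alpha + beta)%:E & r = rho%:E]].

Definition rho_NI (R : realType) := @rho_star R true.
Definition rho_I (R : realType) := @rho_star R false.

(* Main.v *)
(**
  Lower bounds.  P_Y is the uniform law p0, and P_X is p0 or its perturbation by delta times
  random paired signs, so that only the first n1 outputs carry information.  Whatever the past,
  the i-th output law has densities r_x with respect to its p0-mixture and |r_x - 1| <= 32 eps.
  For an interactive mechanism, the Donsker-Varadhan inequality and the chain rule bound the
  average relative entropy of the null to the alternatives by O(n1 eps^2 delta^2 d), because the
  signs are orthogonal on average; when p is 1 or 2 a two-point law replaces p0 once delta
  would leave the simplex.  For a non-interactive mechanism the perturbation may depend on the
  mechanism: with K the sum of the covariance kernels of the densities and xi the paired signs,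
  z = (1 + K/kap)^-1 xi damps the directions in which the mechanism is informative, and for
  kap of order n1 eps^2 the chi-square integral, at most avg exp (delta^2 z.K z'), is
  exp (O(delta^4 kap^2 d)).

  Upper bounds.  Both users answer a sign vector t with law proportional to 1 + a t(x), where
  a = eps/3.  Without interaction, the inner product of the summed differences of answers over
  two halves of a batch estimates a multiple of |pX - pY|_2^2 and is centred under the null.
  With interaction, the first answer h of a batch is independent of the data and serves as a
  public seed; the others report only h(x), and the mean of h(X) - h(Y) is typically of size
  |pX - pY|_2.  In both cases a batch rejects with probability at most 2^-17 under the null and
  at least 3/20 under the alternative, and a vote over about log (1/(alpha beta)) batches,
  controlled by the Chernoff method, reaches the levels alpha and beta.
*)

From HB Require Import structures.
From mathcomp Require Import all_boot all_order all_algebra.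
From mathcomp Require Import Rstruct.
From mathcomp Require Import all_classical all_reals all_analysis.
From mathcomp Require Import measurable_realfun ring lra zify.
Require Import Defs.

Set Implicit Arguments.
Unset Strict Implicit.
Unset Printing Implicit Defensive.
Import Order.TTheory GRing.Theory Num.Theory.
Local Open Scope classical_set_scope.
Local Open Scope ring_scope.

(** The two lower bounds differ because of what the past may do. In an interactive protocol the
    information of a round depends on the transcript, so the divergence must add up under
    conditioning and allow an average over the alternatives round by round. The entropy of the null
    relative to an alternative does both, because the null law of the transcript is common to all
    alternatives; its price is quadratic in [delta]. Without interaction the second moment of the
    mixture factors into numbers free of the transcript, and comparing two independent alternatives
    puts a centred Rademacher sum in the exponent, so the price is quartic in [delta]: this is the
    origin of the factor d^(1/4) between the rates. The entries of the total kernel are O(n1 eps^2),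
    so its norm may be d times larger while its trace is only O(n1 eps^2 d). Hence the quadratic
    form of a random sign vector is typically small, and the resolvent can cap the few bad
    directions at [kap] and still keep a constant fraction of the L1 norm. *)

Section bounded_measurable.
Context (R : realType) (dT : measure_display) (T : measurableType dT).
Implicit Types (f g : T -> R) (P : probability T R).

(** On this class integration against any probability is linear and monotone with no further
    integrability condition; the functionals of a transcript used below stay in it. *)
Definition bdm f := measurable_fun [set: T] f /\ exists M, forall t, `|f t| <= M.

Lemma bdm_cst (c : R) : bdm (fun=> c).
Proof. by split; [exact: measurable_cst|exists `|c|]. Qed.

Lemma bdmD f g : bdm f -> bdm g -> bdm (fun t => f t + g t).
Proof.
move=> [mf [M fM]] [mg [N gN]]; split; first exact: measurable_funD.
exists (M + N) => t; rewrite (le_trans (ler_normD _ _))//.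
by rewrite lerD.
Qed.

Lemma bdmM f g : bdm f -> bdm g -> bdm (fun t => f t * g t).
Proof.
move=> [mf [M fM]] [mg [N gN]]; split; first exact: measurable_funM.
by exists (M * N) => t; rewrite normrM ler_pM.
Qed.

Lemma bdmZ (c : R) f : bdm f -> bdm (fun t => c * f t).
Proof. exact/bdmM/bdm_cst. Qed.

Lemma bdmN f : bdm f -> bdm (fun t => - f t).
Proof.
move=> bf; rewrite (_ : (fun t => _) = fun t => -1 * f t).
  exact: bdmZ.
by apply/funext => t; rewrite mulN1r.
Qed.

Lemma bdmB f g : bdm f -> bdm g -> bdm (fun t => f t - g t).
Proof. by move=> bf bg; apply: bdmD => //; exact: bdmN. Qed.

Lemma bdm_sum (I : Type) (s : seq I) (F : I -> T -> R) :
  (forall i, bdm (F i)) -> bdm (fun t => \sum_(i <- s) F i t).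
Proof.
move=> bF; elim: s => [|i s IHs].
  rewrite (_ : (fun t => _) = fun=> 0); first exact: bdm_cst.
  by apply/funext => t; rewrite big_nil.
rewrite (_ : (fun t => _) = fun t => F i t + \sum_(i <- s) F i t).
  exact: bdmD.
by apply/funext => t; rewrite big_cons.
Qed.

Lemma bdm_ln f (m : R) : 0 < m -> (forall t, m <= f t) -> bdm f ->
  bdm (fun t => ln (f t)).
Proof.
move=> m0 mf [mef [M fM]]; split; first exact: (measurableT_comp (@measurable_ln R) mef).
exists (`|ln m| + `|ln M|) => t.
have ft0 : 0 < f t by rewrite (lt_le_trans m0).
have fM' : f t <= M by rewrite (le_trans (ler_norm _)).
have M0 : 0 < M by rewrite (lt_le_trans ft0).
have l1 : ln m <= ln (f t) by rewrite ler_ln ?posrE.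
have l2 : ln (f t) <= ln M by rewrite ler_ln ?posrE.
rewrite ler_norml; apply/andP; split.
  by rewrite (le_trans _ l1)// lerNl (le_trans (ler_norm _))// normrN lerDl.
by rewrite (le_trans l2)// (le_trans (ler_norm _))// lerDr.
Qed.

Lemma bdm_integrable P f : bdm f -> P.-integrable [set: T] (EFin \o f).
Proof.
move=> [mf [M fM]]; apply: (measurable_bounded_integrable (A := setT)) => //.
- by rewrite (le_lt_trans (probability_le1 P measurableT))// ltry.
- exists M; split; first exact: num_real.
  by move=> x Mx t _ /=; rewrite (le_trans (fM t))// ltW.
Qed.
Arguments bdm_integrable : clear implicits.

Lemma ExpD P f g : bdm f -> bdm g ->
  \int[P]_t (f t + g t) = \int[P]_t f t + \int[P]_t g t.
Proof. by move=> bf bg; rewrite RintegralD//; exact: bdm_integrable. Qed.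

Lemma ExpZ P (c : R) f : bdm f -> \int[P]_t (c * f t) = c * \int[P]_t f t.
Proof. by move=> bf; rewrite RintegralZl//; exact: bdm_integrable. Qed.

Lemma Exp_cst P (c : R) : \int[P]_t c = c.
Proof. by have := Rintegral_cst P measurableT c; rewrite [X in fine X](_ : _ = 1%E) ?mulr1//; exact: probability_setT. Qed.

Lemma le_Exp P f g : bdm f -> bdm g -> (forall t, f t <= g t) ->
  \int[P]_t f t <= \int[P]_t g t.
Proof. by move=> bf bg fg; apply: le_Rintegral => //; exact: bdm_integrable. Qed.

Lemma Exp_sum P (I : Type) (s : seq I) (F : I -> T -> R) :
  (forall i, bdm (F i)) ->
  \int[P]_t (\sum_(i <- s) F i t) = \sum_(i <- s) \int[P]_t F i t.
Proof.
move=> bF; elim: s => [|i s IHs].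
  by under eq_Rintegral do rewrite big_nil; rewrite Exp_cst big_nil.
under eq_Rintegral do rewrite big_cons.
by rewrite ExpD ?IHs ?big_cons//; exact: bdm_sum.
Qed.

Lemma Exp_EFin P f : bdm f -> (\int[P]_t (f t)%:E)%E = (\int[P]_t f t)%:E.
Proof.
move=> bf; rewrite /Rintegral fineK//.
exact/integrable_fin_num/bdm_integrable.
Qed.

End bounded_measurable.

(** * One-round expectations over a private answer *)

Section step.
Context (R : realType) (d : nat) (dT : measure_display) (T : measurableType dT).
Implicit Types (Q : 'I_d -> probability T R) (p : 'I_d -> R) (f g : T -> R).

Definition step Q p f : R := \sum_(x < d) p x * \int[Q x]_t f t.

Lemma stepD Q p f g : bdm f -> bdm g ->
  step Q p (fun t => f t + g t) = step Q p f + step Q p g.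
Proof.
move=> bf bg; rewrite /step -big_split/=; apply: eq_bigr => x _.
by rewrite ExpD// mulrDr.
Qed.

Lemma stepZ Q p (c : R) f : bdm f -> step Q p (fun t => c * f t) = c * step Q p f.
Proof.
move=> bf; rewrite /step big_distrr/=; apply: eq_bigr => x _.
by rewrite ExpZ// mulrCA.
Qed.

Lemma step_sum Q p (I : Type) (s : seq I) (F : I -> T -> R) :
  (forall i, bdm (F i)) ->
  step Q p (fun t => \sum_(i <- s) F i t) = \sum_(i <- s) step Q p (F i).
Proof.
move=> bF; rewrite /step exchange_big/=; apply: eq_bigr => x _.
by rewrite Exp_sum// big_distrr.
Qed.

Lemma step_cst Q p (c : R) : pmf p -> step Q p (fun=> c) = c.
Proof.
move=> [_ p1]; rewrite /step; under eq_bigr do rewrite Exp_cst.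
by rewrite -big_distrl/= p1 mul1r.
Qed.

Lemma le_step Q p f g : pmf p -> bdm f -> bdm g -> (forall t, f t <= g t) ->
  step Q p f <= step Q p g.
Proof.
move=> [p0 _] bf bg fg; apply: ler_sum => x _.
by rewrite ler_wpM2l// le_Exp.
Qed.

Lemma step_bounds Q p f (m M : R) : pmf p -> bdm f -> (forall t, m <= f t <= M) ->
  m <= step Q p f <= M.
Proof.
move=> pp bf fM; apply/andP; split.
  rewrite -(step_cst Q m pp) le_step//; first exact: bdm_cst.
  by move=> t; case/andP: (fM t).
rewrite -(step_cst Q M pp) le_step//; first exact: bdm_cst.
by move=> t; case/andP: (fM t).
Qed.

Lemma step_EFin Q p f : bdm f ->
  (\sum_(x < d) (p x)%:E * \int[Q x]_t (f t)%:E)%E = (step Q p f)%:E.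
Proof.
move=> bf; rewrite /step -sumEFin; apply: eq_bigr => x _.
by rewrite Exp_EFin// EFinM.
Qed.

Lemma eq_step Q p f g : f =1 g -> step Q p f = step Q p g.
Proof. by move=> /funext ->. Qed.

End step.

Section kernel_step.
Context (R : realType) (dX : measure_display) (X : measurableType dX).
Context (dT : measure_display) (T : measurableType dT).

(** A mechanism is only known to be measurable set by set, which is what makes [k] a kernel; packing
    it as a finite kernel gives the measurability of partial integrals. That result is for
    nonnegative integrands, whence the condition 0 <= [m] on lower bounds below. *)
Lemma measurable_fun_Rintegral_kernel (k : X -> probability T R) (F : X * T -> R) :
  (forall S, measurable S -> measurable_fun [set: X] (fun x => k x S)) ->
  (forall z, 0 <= F z) -> measurable_fun [set: X * T] F ->
  measurable_fun [set: X] (fun x => \int[k x]_t F (x, t)).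
Proof.
move=> mk F0 mF.
pose kk := fun x => (k x : {measure set T -> \bar R}).
pose K0 := isKernel.Build _ _ X T R kk mk.
pose K1 : R.-ker X ~> T := HB.pack kk K0.
(* The uniform bound must be strict, hence 2 and not 1. *)
have ub : measure_fam_uub kk.
  exists 2 => x; rewrite (le_lt_trans (probability_le1 (k x) measurableT))//.
  by rewrite lte_fin ltr1n.
pose K2 := Kernel_isFinite.Build _ _ X T R K1 ub.
pose K3 : R.-fker X ~> T := HB.pack (K1 : X -> {measure set T -> \bar R}) K0 K2.
have mint : measurable_fun [set: X] (fun x => \int[kk x]_t (F (x, t))%:E)%E.
  apply: (@measurable_fun_integral_finite_kernel _ _ _ _ _ (fun z => (F z)%:E) K3).
  - by move=> z; rewrite lee_fin.
  - exact/measurable_EFinP.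
exact: (measurableT_comp (fine_measurable measurableT) mint).
Qed.

End kernel_step.

(** * Protocols as iterated expectations *)

Section history.
Context (R : realType) (d : nat) (dT : measure_display) (T : measurableType dT).
Implicit Types (F : seq T -> seq T -> R) (p : 'I_d -> R).

Lemma measurable_rcons_tuple (dX : measure_display) (X : measurableType dX) n
    (f : X -> n.-tuple T) (g : X -> T) :
  measurable_fun [set: X] f -> measurable_fun [set: X] g ->
  measurable_fun [set: X] (fun x => [tuple of rcons (f x) (g x)]).
Proof.
move=> mf mg; apply/measurable_fun_tnthP => /= i.
have [ltin|leni] := ltnP i n.
  rewrite (_ : _ \o _ = fun x => tnth (f x) (Ordinal ltin)).
    exact: (measurableT_comp (measurable_tnth (Ordinal ltin)) mf).
  apply/funext => x /=.
  by rewrite !(tnth_nth (g x))/= nth_rcons size_tuple ltin.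
rewrite (_ : _ \o _ = g) //; apply/funext => x /=.
rewrite (tnth_nth (g x))/= nth_rcons size_tuple ltnNge leni/=.
by case: ifP.
Qed.

Lemma measurable_step (dX : measure_display) (X : measurableType dX)
    (k : X -> 'I_d -> probability T R) p (F : X * T -> R) :
  (forall y S, measurable S -> measurable_fun [set: X] (fun x => k x y S)) ->
  (forall z, 0 <= F z) -> measurable_fun [set: X * T] F ->
  measurable_fun [set: X] (fun x => step (k x) p (fun t => F (x, t))).
Proof.
move=> mk F0 mF; apply: measurable_sum => y.
apply: measurable_funM; first exact: measurable_cst.
by apply: (@measurable_fun_Rintegral_kernel _ _ _ _ _ (k ^~ y)) => // S; exact: mk.
Qed.

(** A test is a function on sequences of all lengths, while the sigma-algebra lives on tuples:
    measurability and bounds are asked for at one pair of lengths. The bounds are explicit because a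
    lower bound 1 is what later makes logarithms harmless. *)
Definition hbdm i j (m M : R) F :=
  measurable_fun [set: i.-tuple T * j.-tuple T] (fun h => F (val h.1) (val h.2)) /\
  forall (z : i.-tuple T) (w : j.-tuple T), m <= F z w <= M.

Definition hker i j (Q : 'I_d -> seq T -> seq T -> probability T R) :=
  forall y (S : set T), measurable S ->
    measurable_fun [set: i.-tuple T * j.-tuple T]
      (fun h => Q y (val h.1) (val h.2) S).

Lemma bdm_of_bounds (f : T -> R) (m M : R) : measurable_fun [set: T] f ->
  (forall t, m <= f t <= M) -> bdm f.
Proof.
move=> mf fM; split => //; exists (`|m| + `|M|) => t.
case/andP: (fM t) => h1 h2.
have := ler_norm M; have := ler_norm (- m); have := normr_ge0 M.
have := normr_ge0 m; rewrite normrN => *.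
by rewrite ler_norml; apply/andP; split; lra.
Qed.

Lemma hbdm_bdm2 i j m M F (z : i.-tuple T) (w : j.-tuple T) :
  hbdm i j.+1 m M F -> bdm (fun t => F z (rcons w t)).
Proof.
move=> [mF bF]; apply: (@bdm_of_bounds _ m M) => [|t].
  apply: (measurableT_comp mF (g := fun t => (z, [tuple of rcons w t]))).
  apply/measurable_fun_pair; first exact: measurable_cst.
  by apply: measurable_rcons_tuple.
exact: (bF z [tuple of rcons w t]).
Qed.

Lemma hbdm_step2 i j m M F Q p : pmf p -> 0 <= m -> hker i j Q ->
  hbdm i j.+1 m M F ->
  hbdm i j m M (fun z w => step (fun y => Q y z w) p (fun t => F z (rcons w t))).
Proof.
move=> pp m0 kQ hF; split => [|z w]; last first.
  apply: step_bounds => // [|t]; first exact: (hbdm_bdm2 z w hF).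
  exact: (hF.2 z [tuple of rcons w t]).
pose X := (i.-tuple T * j.-tuple T)%type.
pose G (u : X * T) : R := F u.1.1 (rcons u.1.2 u.2).
apply: (@measurable_step _ X (fun h y => Q y (val h.1) (val h.2)) p G) => //.
- by move=> [[z w] t]; have /andP[+ _] := hF.2 z [tuple of rcons w t]; exact: le_trans.
- apply: (measurableT_comp hF.1
    (g := fun u : X * T => (u.1.1, [tuple of rcons u.1.2 u.2]))).
  apply/measurable_fun_pair; first exact: measurableT_comp.
  by apply: measurable_rcons_tuple => //; exact: measurableT_comp.
Qed.

Lemma hbdm_bdm1 i j m M F (z : i.-tuple T) (w : j.-tuple T) s :
  hbdm i.+1 j.+1 m M F -> bdm (fun t => F (rcons z s) (rcons w t)).
Proof.
move=> [mF bF]; apply: (@bdm_of_bounds _ m M) => [|t].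
  apply: (measurableT_comp mF
    (g := fun t => ([tuple of rcons z s], [tuple of rcons w t]))).
  apply/measurable_fun_pair; first exact: measurable_cst.
  by apply: measurable_rcons_tuple.
exact: (bF [tuple of rcons z s] [tuple of rcons w t]).
Qed.

Lemma hbdm_bdm1_step i j m M F (z : i.-tuple T) (w : j.-tuple T)
    (Q : 'I_d -> probability T R) p :
  pmf p -> 0 <= m -> hbdm i.+1 j.+1 m M F ->
  bdm (fun s => step Q p (fun t => F (rcons z s) (rcons w t))).
Proof.
move=> pp m0 hF; apply: (@bdm_of_bounds _ m M) => [|s]; last first.
  apply: step_bounds => // [|t]; first exact: hbdm_bdm1 hF.
  exact: (hF.2 [tuple of rcons z s] [tuple of rcons w t]).
apply: (@measurable_step _ T (fun _ => Q) p
  (fun u : T * T => F (rcons z u.1) (rcons w u.2))).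
- by move=> y S mS; exact: measurable_cst.
- move=> [s t].
  have /andP[+ _] := hF.2 [tuple of rcons z s] [tuple of rcons w t].
  exact: le_trans.
- apply: (measurableT_comp hF.1
    (g := fun u : T * T => ([tuple of rcons z u.1], [tuple of rcons w u.2]))).
  by apply/measurable_fun_pair; apply: measurable_rcons_tuple.
Qed.

Lemma hbdm_step1 i j m M F QX QY pX pY : pmf pX -> pmf pY -> 0 <= m ->
  hker i j QX -> hker i j QY -> hbdm i.+1 j.+1 m M F ->
  hbdm i j m M (fun z w => step (fun x => QX x z w) pX
    (fun s => step (fun y => QY y z w) pY (fun t => F (rcons z s) (rcons w t)))).
Proof.
move=> ppX ppY m0 kX kY hF.
have b1 (z : i.-tuple T) (w : j.-tuple T) s :
    m <= step (fun y => QY y z w) pY (fun t => F (rcons z s) (rcons w t)) <= M.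
  apply: step_bounds => // [|t]; first exact: hbdm_bdm1 hF.
  exact: (hF.2 [tuple of rcons z s] [tuple of rcons w t]).
split => [|z w]; last first.
  by apply: step_bounds => //; exact: hbdm_bdm1_step hF.
pose X := (i.-tuple T * j.-tuple T)%type.
pose G (u : X * T * T) : R := F (rcons u.1.1.1 u.1.2) (rcons u.1.1.2 u.2).
pose G' (u : X * T) : R :=
  step (fun y => QY y u.1.1 u.1.2) pY (fun t => G (u, t)).
apply: (@measurable_step _ X (fun h y => QX y (val h.1) (val h.2)) pX G') => //.
  by move=> [[z w] s]; have /andP[+ _] := b1 z w s; exact: le_trans.
apply: (@measurable_step _ (X * T)%type
  (fun h y => QY y (val h.1.1) (val h.1.2)) pY G) => //.
- move=> y S mS.
  exact: (measurableT_comp (kY y S mS) (@measurable_fst _ _ X T)).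
- move=> [[[z w] s] t].
  have /andP[+ _] := hF.2 [tuple of rcons z s] [tuple of rcons w t].
  exact: le_trans.
- apply: (measurableT_comp hF.1 (g := fun u : X * T * T =>
    ([tuple of rcons u.1.1.1 u.1.2], [tuple of rcons u.1.1.2 u.2]))).
  by apply/measurable_fun_pair; apply: measurable_rcons_tuple => //;
    repeat apply: measurableT_comp => //.
Qed.

End history.

Section real_protocol.
Context (R : realType) (d : nat) (dT : measure_display) (T : measurableType dT).
Implicit Types (QX QY : chan R d T) (pX pY : 'I_d -> R) (phi : seq T -> seq T -> R).

(** Real-valued twins of [phase2] and [phase1]. Boundedness makes every iterated integral finite,
    and [phase1E] identifies the two. *)
Fixpoint rphase2 QY pY phi (k : nat) (z w : seq T) : R :=
  match k with
  | 0 => phi z w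
  | k'.+1 => step (fun y => QY (size w) y z w) pY
      (fun t => rphase2 QY pY phi k' z (rcons w t))
  end.

Fixpoint rphase1 QX QY pX pY phi (m k : nat) (z w : seq T) : R :=
  match k with
  | 0 => rphase2 QY pY phi m z w
  | k'.+1 => step (fun x => QX (size z) x z w) pX
      (fun s => step (fun y => QY (size w) y z w) pY
        (fun t => rphase1 QX QY pX pY phi m k' (rcons z s) (rcons w t)))
  end.

Definition mech_measurable (n1 n2 : nat) QX QY :=
  (forall i, (i < n1)%N -> hker i i (QX i)) /\
  (forall j, (j < n2)%N -> hker (minn j n1) j (QY j)).

Lemma LDP_mech_measurable n1 n2 (eps : R) QX QY :
  LDP_mech n1 n2 eps QX QY -> mech_measurable n1 n2 QX QY.
Proof. by move=> [mX mY _ _]; split => i ltin x S mS; [exact: mX|exact: mY]. Qed.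

Section bounds.
Context (n1 n2 : nat) (QX QY : chan R d T) (pX pY : 'I_d -> R).
Context (phi : seq T -> seq T -> R) (m M : R).
Hypothesis mQ : mech_measurable n1 n2 QX QY.
Hypothesis (ppX : pmf pX) (ppY : pmf pY) (m0 : 0 <= m).
Hypothesis hphi : hbdm n1 n2 m M phi.

(** [LDP_mech] states measurability of the Y channel with min(j, n1) past Z outputs; this minimum is
    the round itself in the joint phase and n1 afterwards. *)
Lemma hker1 i : (i < n1)%N -> (n1 <= n2)%N -> hker i i (QY i).
Proof.
move=> ltin len; have := mQ.2 i (leq_trans ltin len).
by rewrite (minn_idPl (ltnW ltin)).
Qed.

Lemma hker2 j : (n1 <= j < n2)%N -> hker n1 j (QY j).
Proof. by case/andP => lenj ltjn; have := mQ.2 j ltjn; rewrite (minn_idPr lenj). Qed.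

Lemma hbdm_ext i j (F G : seq T -> seq T -> R) : hbdm i j m M F ->
  (forall (z : i.-tuple T) (w : j.-tuple T), F z w = G z w) -> hbdm i j m M G.
Proof.
move=> hF FG; rewrite (_ : hbdm i j m M G = hbdm i j m M F)//.
rewrite /hbdm; congr (measurable_fun _ _ /\ _).
  by apply/funext => h; rewrite FG.
by apply/propext; split => h z w; have := h z w; rewrite FG.
Qed.

Lemma hbdm_rphase2 k j : (n1 <= j)%N -> (j + k)%N = n2 ->
  hbdm n1 j m M (rphase2 QY pY phi k).
Proof.
elim: k j => [|k IHk] j lenj; first by rewrite addn0 => ->.
move=> jkn; have ltjn : (n1 <= j < n2)%N by lia.
apply: (hbdm_ext (hbdm_step2 ppY m0 (hker2 ltjn) (IHk j.+1 _ _))); [lia|lia|].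
by move=> z w /=; rewrite size_tuple.
Qed.

Lemma hbdm_rphase1 k i : (n1 <= n2)%N -> (i + k)%N = n1 ->
  hbdm i i m M (rphase1 QX QY pX pY phi (n2 - n1) k).
Proof.
move=> len; elim: k i => [|k IHk] i.
  rewrite addn0 => ->; apply: hbdm_rphase2 => //; lia.
move=> ikn; have ltin : (i < n1)%N by lia.
apply: (hbdm_ext (hbdm_step1 ppX ppY m0 (mQ.1 i ltin) (hker1 ltin len) (IHk i.+1 _))).
  lia.
by move=> z w /=; rewrite !size_tuple.
Qed.

Lemma phase2E k j (z : n1.-tuple T) (w : j.-tuple T) :
  (n1 <= j)%N -> (j + k)%N = n2 ->
  phase2 QY pY phi k z w = (rphase2 QY pY phi k z w)%:E.
Proof.
elim: k j w => [//|k IHk] j w lenj jkn /=.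
rewrite -step_EFin; last first.
  apply: (@hbdm_bdm2 _ _ _ _ _ m M _ z w); apply: hbdm_rphase2; lia.
apply: eq_bigr => y _; congr (_ * _)%E; apply: eq_integral => t _.
by apply: (IHk j.+1 [tuple of rcons w t]); lia.
Qed.

Lemma phase1E k i (z w : i.-tuple T) :
  (n1 <= n2)%N -> (i + k)%N = n1 ->
  phase1 QX QY pX pY phi (n2 - n1) k z w =
  (rphase1 QX QY pX pY phi (n2 - n1) k z w)%:E.
Proof.
move=> len; elim: k i z w => [|k IHk] i z w /=.
  by rewrite addn0 => i1; subst i; apply: phase2E => //; lia.
move=> ikn; have hb : hbdm i.+1 i.+1 m M (rphase1 QX QY pX pY phi (n2 - n1) k).
  by apply: hbdm_rphase1; lia.
rewrite -step_EFin; last exact: (hbdm_bdm1_step z w _ _ _ hb).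
apply: eq_bigr => x _; congr (_ * _)%E; apply: eq_integral => s _.
rewrite -step_EFin; last exact: (hbdm_bdm1 z w s hb).
apply: eq_bigr => y _; congr (_ * _)%E; apply: eq_integral => t _.
by apply: (IHk i.+1 [tuple of rcons z s] [tuple of rcons w t]); lia.
Qed.

End bounds.
End real_protocol.

(** * Bounded densities of private channels *)

Section density.
Context (R : realType) (dT : measure_display) (T : measurableType dT).

(** The inequalities on sets bind the Radon-Nikodym derivative only almost everywhere. Clipping it
    to [c, C] gives a version bounded at every point, so that all later estimates can be pointwise
    in the output. *)
Lemma exists_bounded_density (mu nu : probability T R) (c C : R) :
  0 < c -> c <= C ->
  (forall S, measurable S -> (nu S <= C%:E * mu S)%E) ->
  (forall S, measurable S -> (c%:E * mu S <= nu S)%E) ->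
  exists q : T -> R, [/\ measurable_fun [set: T] q, (forall t, c <= q t <= C) &
    forall f, bdm f -> \int[nu]_t f t = \int[mu]_t (q t * f t)].
Proof.
move=> c0 cC nuC cnu.
have numu : (nu : set T -> \bar R) `<< mu.
  apply/null_content_dominatesP => A mA muA0; apply/eqP.
  by rewrite -measure_le0 (le_trans (nuC A mA))// [X in (_ * X)%E]muA0 mule0.
pose f0 := Radon_Nikodym_SigmaFinite.f nu mu.
have f0_ge0 t : (0 <= f0 t)%E by exact: Radon_Nikodym_SigmaFinite.f_ge0.
have f0fin t : f0 t \is a fin_num by exact: Radon_Nikodym_SigmaFinite.f_fin_num.
have if0 : mu.-integrable [set: T] f0 by exact: Radon_Nikodym_SigmaFinite.f_integrable.
have mf0 : measurable_fun [set: T] f0 by exact: (measurable_int _ if0).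
have f0E A : measurable A -> nu A = (\int[mu]_(t in A) f0 t)%E.
  exact: Radon_Nikodym_SigmaFinite.f_integral.
pose r0 t := fine (f0 t).
have r0E t : f0 t = (r0 t)%:E by rewrite /r0 fineK.
have mr0 : measurable_fun [set: T] r0.
  exact: (measurableT_comp (fine_measurable measurableT) mf0).
pose q t := Num.max c (Num.min C (r0 t)).
have mq : measurable_fun [set: T] q.
  by apply: measurable_maxr => //; exact: measurable_minr.
have qb t : c <= q t <= C.
  by rewrite /q le_max lexx/= ge_max cC/= ge_min lexx.
have bq : bdm q by exact: (bdm_of_bounds mq qb).
have mC : measurable [set t | (C%:E < f0 t)%E].
  by rewrite -[X in measurable X]setTI; exact: emeasurable_fun_o_infty.
have mc : measurable [set t | (f0 t < c%:E)%E].
  by rewrite -[X in measurable X]setTI; exact: emeasurable_fun_infty_o.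
(* On any part E of this set, nu E <= C mu E <= (integral of [f0] over E) = nu E, so [f0] equals C
   almost everywhere there, against [f0] > C: the set is null. The lower side is symmetric. *)
have aeC : ae_eq mu [set t | (C%:E < f0 t)%E] f0 (cst C%:E).
  apply: integral_ae_eq => //; first exact: integrableS if0.
  move=> E EA mE; apply/eqP; rewrite eq_le; apply/andP; split.
    by rewrite -f0E// integral_cst// nuC.
  apply: ge0_le_integral => //.
  - by move=> t _ /=; rewrite lee_fin (le_trans _ cC)// ltW.
  - exact: measurable_funTS.
  - by move=> t /EA/= /ltW.
have aec : ae_eq mu [set t | (f0 t < c%:E)%E] f0 (cst c%:E).
  apply: integral_ae_eq => //; first exact: integrableS if0.
  move=> E EA mE; apply/eqP; rewrite eq_le; apply/andP; split; last first.
    by rewrite -f0E// integral_cst// cnu.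
  apply: ge0_le_integral => //.
  - exact: measurable_funTS.
  - by move=> t /EA/= /ltW.
have aeq : ae_eq mu [set: T] f0 (EFin \o q).
  apply: filterS2 aeC aec => t /= hC hc _.
  rewrite /q; case: (leP c (r0 t)) => [cr|rc]; last first.
    have : (f0 t < c%:E)%E by rewrite r0E lte_fin.
    by move=> h; move: (h); rewrite (hc h) ltxx.
  case: (leP (r0 t) C) => [rC|Cr]; last first.
    have : (C%:E < f0 t)%E by rewrite r0E lte_fin.
    by move=> h; move: (h); rewrite (hC h) ltxx.
  by rewrite r0E; congr EFin; apply/esym/max_idPr.
exists q; split => //.
(* The change of variables is for nonnegative integrands. A bounded [f] is reached by adding its
   bound [M] and removing it again, since [q] has total mass 1. *)
have pos f : bdm f -> (forall t, 0 <= f t) ->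
    \int[nu]_t f t = \int[mu]_t (q t * f t).
  move=> bf f_ge0; rewrite /Rintegral.
  rewrite -(@Radon_Nikodym_SigmaFinite.change_of_variables _ _ _ nu mu numu
    (fun t => (f t)%:E))//; last exact/measurable_EFinP/bf.1.
  congr fine; apply: ae_eq_integral => //.
  - by apply: emeasurable_funM => //; exact/measurable_EFinP/bf.1.
  - by apply/measurable_EFinP/measurable_funM => //; exact: bf.1.
  - apply: filterS aeq => t /= h _.
    by rewrite -/f0 (h I) EFinM muleC.
move=> f bf; have [mf [M fM]] := bf.
have bf' : bdm (fun t => f t + M) by exact/bdmD/bdm_cst.
have h : \int[nu]_t (f t + M) = \int[mu]_t (q t * (f t + M)).
  by apply: pos => // t; have := fM t; rewrite ler_norml => /andP[? _]; lra.
have e1 : \int[nu]_t (f t + M) = \int[nu]_t f t + M.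
  by rewrite ExpD ?Exp_cst//; exact: bdm_cst.
have e2 : \int[mu]_t (q t * (f t + M)) = \int[mu]_t (q t * f t) + M * \int[mu]_t q t.
  under eq_Rintegral do rewrite mulrDr [q _ * M]mulrC.
  by rewrite ExpD ?ExpZ//; [exact: bdmM|exact: bdmZ].
have q1 : \int[mu]_t q t = 1.
  have := pos (fun=> 1) (bdm_cst _ _) (fun=> ler01).
  by rewrite Exp_cst; under eq_Rintegral do rewrite mulr1.
by move: h; rewrite e1 e2 q1 mulr1 => /addIr.
Qed.

End density.

Section exp_bounds.
Context (R : realType).

(** From exp (-1/2) >= 1/2, inverted and raised to the fourth power. *)
Lemma expR2_le16 : expR 2 <= 16 :> R.
Proof.
have h : 2^-1 <= expR (- 2^-1) :> R by apply: le_trans (expR_ge1Dx _); lra.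
have -> : (2 : R) = 4%:R * 2^-1 by lra.
rewrite expRM_natl -[expR _]invrK -expRN.
rewrite (_ : 16 = 2 ^+ 4); last by ring.
rewrite lerXn2r ?nnegrE ?invr_ge0 ?expR_ge0//.
by rewrite -[leRHS]invrK lef_pV2 ?posrE ?expR_gt0 ?invr_gt0.
Qed.

(** The constant is 2 * 16: multiplying 1 - 2 eps <= exp (- 2 eps) by exp (2 eps) gives exp (2 eps)
    - 1 <= 2 eps exp (2 eps). *)
Lemma expR2B1_le (eps : R) : 0 < eps <= 1 -> expR (2 * eps) - 1 <= 32 * eps.
Proof.
move=> /andP[e0 e1].
have h1 : 1 - 2 * eps <= expR (- (2 * eps)) by apply: le_trans (expR_ge1Dx _); lra.
have h2 : expR (2 * eps) <= 16.
  by apply: le_trans expR2_le16; rewrite ler_expR; lra.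
have h3 := expRxMexpNx_1 (2 * eps); have h4 := expR_gt0 (2 * eps).
nra.
Qed.

End exp_bounds.

Section LDP_density.
Context (R : realType) (d : nat) (dT : measure_display) (T : measurableType dT).

(** Privacy makes all rows comparable to the row of [ord0], which serves as dominating measure;
    dividing by [qbar] turns the null mixture into the reference. Both [q x] and [qbar] lie between
    exp (- eps) and exp eps, so their ratio is within exp (2 eps) - 1 of 1. *)
Lemma exists_LDP_density (Q : 'I_d -> probability T R) (eps : R) (p0 : 'I_d -> R) :
  0 < eps <= 1 -> pmf p0 ->
  (forall x x' (S : set T), measurable S -> (Q x S <= (expR eps)%:E * Q x' S)%E) ->
  exists r : 'I_d -> T -> R, [/\ forall x, bdm (r x) /\ forall t, 0 <= r x t,
    forall t, \sum_(x < d) p0 x * r x t = 1,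
    forall x t, `|r x t - 1| <= 32 * eps &
    forall p f, bdm f ->
      step Q p f = step Q p0 (fun t => (\sum_(x < d) p x * r x t) * f t)].
Proof.
move=> e01 [p0_ge0 p0_sum] ldp; have /andP[e0 e1] := e01.
case: d Q p0 p0_ge0 p0_sum ldp => [|d'] Q p0 p0_ge0 p0_sum ldp.
  by move: p0_sum => /eqP; rewrite big_ord0 eq_sym oner_eq0.
pose c := expR (- eps); pose C := expR eps.
have c0 : 0 < c by exact: expR_gt0.
have cC : c <= C by rewrite ler_expR; lra.
have [q qP] : exists q : 'I_d'.+1 -> T -> R, forall x,
    [/\ measurable_fun [set: T] (q x), (forall t, c <= q x t <= C) &
    forall f, bdm f -> \int[Q x]_t f t = \int[Q ord0]_t (q x t * f t)].
  suff /choice[q qP] : forall x : 'I_d'.+1, exists q : T -> R,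
      [/\ measurable_fun [set: T] q, (forall t, c <= q t <= C) &
    forall f, bdm f -> \int[Q x]_t f t = \int[Q ord0]_t (q t * f t)] by exists q.
  move=> x.
  apply: exists_bounded_density => // S mS; first exact: ldp.
  rewrite -[leRHS]mul1e -(mulVr (x := expR eps)); last by rewrite unitfE gt_eqF ?expR_gt0.
  rewrite EFinM -muleA /c expRN; apply: lee_wpmul2l; last exact: ldp.
  by rewrite lee_fin invr_ge0 expR_ge0.
have bq x : bdm (q x) by have [mq qb _] := qP x; exact: (bdm_of_bounds mq qb).
pose qbar t := \sum_(x < d'.+1) p0 x * q x t.
have bqbar : bdm qbar by apply: bdm_sum => x; exact: bdmZ.
have qbarb t : c <= qbar t <= C.
  rewrite -[c]mul1r -[C]mul1r -p0_sum !mulr_suml /qbar.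
  by apply/andP; split; apply: ler_sum => x _; rewrite ler_wpM2l//;
     have [_ /(_ t) /andP[] ] := qP x.
have qbar0 t : 0 < qbar t by have /andP[+ _] := qbarb t; exact: lt_le_trans.
have bqV : bdm (fun t => (qbar t)^-1).
  apply: (@bdm_of_bounds _ _ _ _ C^-1 c^-1) => [|t].
    rewrite (_ : (fun t => _) = (fun t => expR (- ln (qbar t)))); last first.
      by apply/funext => t; rewrite expRN lnK// posrE.
    apply: (measurableT_comp (@measurable_expR R)).
    exact: (bdmN (bdm_ln c0 (fun t => (andP (qbarb t)).1) bqbar)).1.
  have /andP[h1 h2] := qbarb t.
  by rewrite !lef_pV2 ?posrE ?h1 ?h2// expR_gt0.
exists (fun x t => q x t * (qbar t)^-1); split.
- move=> x; split=> [|t]; first exact: bdmM.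
  by have [_ /(_ t) /andP[h _] _] := qP x; rewrite divr_ge0 ?(ltW (qbar0 t))// (le_trans (ltW c0)).
- move=> t; under eq_bigr do rewrite mulrA.
  by rewrite -mulr_suml -/(qbar t) divff// gt_eqF.
- move=> x t.
  have [_ /(_ t) /andP[h1 h2] _] := qP x; have /andP[h3 h4] := qbarb t.
  have Cc : C / c - 1 <= 32 * eps.
    rewrite /C /c expRN invrK -expRD (_ : eps + eps = 2 * eps); last by ring.
    exact: expR2B1_le.
  have qV0 : 0 < (qbar t)^-1 by rewrite invr_gt0.
  have qVc : (qbar t)^-1 <= c^-1 by rewrite lef_pV2 ?posrE.
  rewrite (_ : q x t / qbar t - 1 = (q x t - qbar t) / qbar t); last first.
    by rewrite mulrBl divff// gt_eqF.
  rewrite normrM [X in _ * X]gtr0_norm//.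
  have hn : `|q x t - qbar t| <= C - c by rewrite ler_norml; apply/andP; split; lra.
  apply: le_trans Cc; rewrite -(divff (x := c)) ?gt_eqF// -mulrBl.
  by apply: ler_pM => //; exact: ltW.
move=> p f bf.
have stepE g pp : bdm g ->
    step Q pp g = \int[Q ord0]_t ((\sum_(x < d'.+1) pp x * q x t) * g t).
  move=> bg.
  have -> : (fun t => (\sum_(x < d'.+1) pp x * q x t) * g t) =
      (fun t => \sum_(x < d'.+1) pp x * (q x t * g t)).
    by apply/funext => t; rewrite mulr_suml; apply: eq_bigr => x _; rewrite mulrA.
  rewrite Exp_sum; last by move=> x; apply/bdmZ/bdmM.
  apply: eq_bigr => x _; have [_ _ ->//] := qP x.
  by rewrite ExpZ//; exact: bdmM.
rewrite !stepE//; last first.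
  by apply: bdmM => //; apply: bdm_sum => x; apply/bdmZ/bdmM.
apply: eq_Rintegral => t _; rewrite mulrA; congr (_ * _).
rewrite -/(qbar t) mulr_sumr; apply: eq_bigr => x _.
by rewrite mulrCA [qbar t * _]mulrCA divff ?mulr1// gt_eqF.
Qed.

End LDP_density.

(** * Relative entropy of an interactive protocol *)

Section average.
Context (R : realType) (V : finType).
Implicit Types F G : V -> R.

Definition avg F : R := #|V|%:R^-1 * \sum_(v : V) F v.

Lemma avgD F G : avg (fun v => F v + G v) = avg F + avg G.
Proof. by rewrite /avg big_split mulrDr. Qed.

Lemma avgZ (c : R) F : avg (fun v => c * F v) = c * avg F.
Proof. by rewrite /avg -mulr_sumr mulrCA. Qed.

Lemma avg_sum (I : Type) (s : seq I) (F : I -> V -> R) :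
  avg (fun v => \sum_(i <- s) F i v) = \sum_(i <- s) avg (F i).
Proof. by rewrite /avg exchange_big mulr_sumr. Qed.

Lemma avg_cst (c : R) : (0 < #|V|)%N -> avg (fun=> c) = c.
Proof.
move=> V0; rewrite /avg sumr_const -[c *+ _]mulr_natl mulrA mulVf ?mul1r//.
by rewrite pnatr_eq0 -lt0n.
Qed.

Lemma le_avg F G : (forall v, F v <= G v) -> avg F <= avg G.
Proof.
by move=> FG; rewrite ler_wpM2l ?invr_ge0 ?ler0n//; apply: ler_sum => v _.
Qed.

Lemma eq_avg F G : F =1 G -> avg F = avg G.
Proof. by move=> /funext ->. Qed.

End average.

Section entropy_step.
Context (R : realType) (d : nat) (dT : measure_display) (T : measurableType dT).

(** Apply ln y <= y - 1 at y = 1 / (1 + s). *)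
Lemma ln1D_ge (s : R) : - 2^-1 <= s -> s - 2 * s ^+ 2 <= ln (1 + s).
Proof.
move=> hs; have s0 : 0 < 1 + s by lra.
have h := @le_ln1Dx R ((1 + s)^-1 - 1).
have h1 : -1 < (1 + s)^-1 - 1 by have : 0 < (1 + s)^-1 by [rewrite invr_gt0]; lra.
move: (h h1); rewrite (addrC 1 (_ - 1)) subrK lnV ?posrE// => h2.
apply: (@le_trans _ _ (1 - (1 + s)^-1)); last by lra.
have -> : 1 - (1 + s)^-1 = s / (1 + s) by field; rewrite gt_eqF.
rewrite ler_pdivlMr//; nra.
Qed.

Lemma ln_le_tangent (x C : R) : 0 < x -> 0 < C -> ln x <= ln C + x / C - 1.
Proof.
move=> x0 C0; have xC : 0 < x / C by rewrite divr_gt0.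
have := @le_ln1Dx R (x / C - 1); rewrite (addrC 1 (_ - 1)) subrK ln_div ?posrE// => h.
have : -1 < x / C - 1 by lra.
by move/h; lra.
Qed.

Lemma bdmX2 (f : T -> R) : bdm f -> bdm (fun t => f t ^+ 2).
Proof. exact: (fun bf => bdmM bf bf). Qed.

(** Jensen's inequality, by integrating the tangent of [ln] at the mean [C]. *)
Lemma step_ln_le (Q : 'I_d -> probability T R) p (g : T -> R) (m : R) :
  pmf p -> 0 < m -> bdm g -> (forall t, m <= g t) ->
  step Q p (fun t => ln (g t)) <= ln (step Q p g).
Proof.
move=> pp m0 bg mg; set C := step Q p g.
have C0 : 0 < C.
  apply: (lt_le_trans m0); rewrite -(step_cst Q m pp) le_step//; exact: bdm_cst.
have bu : bdm (fun t => ln C - 1 + C^-1 * g t) by apply: bdmD; [exact: bdm_cst|exact: bdmZ].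
apply: (@le_trans _ _ (step Q p (fun t => ln C - 1 + C^-1 * g t))).
  apply: le_step => //; first exact: bdm_ln mg bg.
  move=> t; have := @ln_le_tangent (g t) C (lt_le_trans m0 (mg t)) C0.
  by rewrite mulrC; lra.
rewrite stepD ?stepZ ?step_cst//; [|exact: bdm_cst|exact: bdmZ].
by rewrite -/C mulVf ?gt_eqF//; lra.
Qed.

Context (V : finType) (p0 : 'I_d -> R) (u : V -> 'I_d -> R) (eps kap : R).
Hypothesis (e01 : 0 < eps <= 1) (pp0 : pmf p0).
Hypothesis pu : forall v, pmf (fun x => p0 x + u v x).

Lemma pmf_sum_diff v : \sum_(x < d) u v x = 0.
Proof.
have := (pu v).2; rewrite big_split/= pp0.2 => h.
by move: h; rewrite -[X in _ = X]addr0 => /addrI.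
Qed.

Hypothesis u_small : forall v (a : 'I_d -> R), (forall x, `|a x| <= 32 * eps) ->
  `|\sum_(x < d) u v x * a x| <= 2^-1.
Hypothesis u_avg : forall a : 'I_d -> R, (forall x, `|a x| <= 32 * eps) ->
  avg (fun v => (\sum_(x < d) u v x * a x) ^+ 2) <= kap.

(** Donsker-Varadhan for one answer. With 1 + s the density of the alternative, ln g = ln ((1 + s)
    g) - ln (1 + s) is at most a tangent of [ln], minus s, plus 2 s^2. Under the null s has mean 0,
    so only its second moment remains; averaged over [v] at each output separately, it is what
    [u_avg] bounds. *)
Lemma avg_step_ln_le (Q : 'I_d -> probability T R) (g : V -> T -> R) (m : R) :
  (forall x x' (S : set T), measurable S -> (Q x S <= (expR eps)%:E * Q x' S)%E) ->
  0 < m -> (forall v, bdm (g v)) -> (forall v t, m <= g v t) ->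
  avg (fun v => step Q p0 (fun t => ln (g v t))) <=
  2 * kap + avg (fun v => ln (step Q (fun x => p0 x + u v x) (g v))).
Proof.
move=> ldp m0 bg mg.
have [r [br r1 rb rE]] := exists_LDP_density e01 pp0 ldp.
pose s v t := \sum_(x < d) u v x * r x t.
have bs v : bdm (s v) by apply: bdm_sum => x; apply: bdmZ; exact: (br x).1.
have sE v t : s v t = \sum_(x < d) u v x * (r x t - 1).
  under eq_bigr do rewrite mulrBr mulr1.
  by rewrite sumrB pmf_sum_diff subr0.
have s12 v t : `|s v t| <= 2^-1 by rewrite sE; exact: u_small.
have uE v f : bdm f ->
    step Q (fun x => p0 x + u v x) f = step Q p0 (fun t => (1 + s v t) * f t).
  move=> bf; rewrite rE//; apply: eq_step => t; congr (_ * _).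
  rewrite -(r1 t) /s -big_split/=; apply: eq_bigr => x _; by rewrite mulrDl.
have s0 v : step Q p0 (s v) = 0.
  have := @uE v (fun=> 1) (bdm_cst _ _); rewrite step_cst//.
  rewrite (@eq_step _ _ _ _ _ _ _ (fun t => 1 + s v t)); last by move=> t; rewrite mulr1.
  rewrite stepD//; last exact: bdm_cst.
  by rewrite step_cst//; lra.
have main v : step Q p0 (fun t => ln (g v t)) <=
    2 * step Q p0 (fun t => s v t ^+ 2) + ln (step Q (fun x => p0 x + u v x) (g v)).
  set C := step Q (fun x => p0 x + u v x) (g v).
  have C0 : 0 < C.
    apply: (lt_le_trans m0); rewrite -(step_cst Q m (pu v)) le_step//.
    exact: bdm_cst.
  have [c cE] : {c | c = ln C - 1} by exists (ln C - 1).
  pose h t := (c + 2 * s v t ^+ 2) + ((-1) * s v t + C^-1 * ((1 + s v t) * g v t)).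
  have b1 : bdm (fun t => c + 2 * s v t ^+ 2).
    by apply: bdmD; [exact: bdm_cst|apply/bdmZ/bdmX2].
  have b2 : bdm (fun t => C^-1 * ((1 + s v t) * g v t)).
    by apply/bdmZ/bdmM => //; apply: bdmD => //; exact: bdm_cst.
  have b3 : bdm (fun t => (-1) * s v t) by exact: bdmZ.
  have b4 : bdm (fun t => (-1) * s v t + C^-1 * ((1 + s v t) * g v t)) by exact: bdmD.
  apply: (@le_trans _ _ (step Q p0 h)).
    apply: le_step => //; [exact: (bdm_ln m0 (mg v) (bg v))|exact: bdmD|].
    move=> t; have g0 := lt_le_trans m0 (mg v t).
    have := s12 v t; rewrite ler_norml => /andP[l1 l2].
    have s1 : 0 < 1 + s v t by lra.
    have := @ln_le_tangent ((1 + s v t) * g v t) C (mulr_gt0 s1 g0) C0.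
    rewrite lnM ?posrE// [_ / C]mulrC /h cE.
    have := ln1D_ge l1; lra.
  have -> : step Q p0 h = (c + 2 * step Q p0 (fun t => s v t ^+ 2)) +
      ((-1) * step Q p0 (s v) + C^-1 * step Q p0 (fun t => (1 + s v t) * g v t)).
    have b5 : bdm (fun t => s v t ^+ 2) by exact: bdmX2.
    have b6 : bdm (fun t => (1 + s v t) * g v t).
      by apply: bdmM => //; apply: bdmD => //; exact: bdm_cst.
    rewrite /h (stepD _ _ b1 b4) (stepD _ _ (bdm_cst _ c) (bdmZ _ b5)).
    by rewrite (stepD _ _ b3 b2) !stepZ// step_cst.
  by rewrite -uE// -/C s0 mulVf ?gt_eqF// cE; lra.
apply: le_trans (le_avg main) _.
rewrite avgD avgZ lerD2r ler_pM2l//.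
have -> : avg (fun v => step Q p0 (fun t => s v t ^+ 2)) =
    step Q p0 (fun t => avg (fun v => s v t ^+ 2)).
  rewrite /avg stepZ; last by apply: bdm_sum => v; exact: bdmX2.
  by rewrite step_sum// => v; exact: bdmX2.
rewrite -(step_cst Q kap pp0); apply: le_step => //; last 2 first.
- exact: bdm_cst.
- move=> t; rewrite (eq_avg (G := fun v => (\sum_(x < d) u v x * (r x t - 1)) ^+ 2)).
    by apply: u_avg.
  by move=> v; rewrite sE.
by apply/bdmZ/bdm_sum => v; exact: bdmX2.
Qed.

End entropy_step.

Section interactive_induction.
Context (R : realType) (d : nat) (dT : measure_display) (T : measurableType dT).
Context (n1 n2 : nat) (QX QY : chan R d T) (eps : R).
Hypothesis (e01 : 0 < eps <= 1) (len : (n1 <= n2)%N).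
Hypothesis mech : LDP_mech n1 n2 eps QX QY.
Context (V : finType) (p0 : 'I_d -> R) (u : V -> 'I_d -> R) (kap : R).
Hypothesis (V0 : (0 < #|V|)%N) (pp0 : pmf p0).
Hypothesis pu : forall v, pmf (fun x => p0 x + u v x).
Hypothesis u_small : forall v (a : 'I_d -> R), (forall x, `|a x| <= 32 * eps) ->
  `|\sum_(x < d) u v x * a x| <= 2^-1.
Hypothesis u_avg : forall a : 'I_d -> R, (forall x, `|a x| <= 32 * eps) ->
  avg (fun v => (\sum_(x < d) u v x * a x) ^+ 2) <= kap.
Context (g : seq T -> seq T -> R) (M : R).
Hypothesis hg : hbdm n1 n2 1 M g.

Let lg z w := ln (g z w).

(** The reason why [g] is taken at least 1: its logarithm is nonnegative. *)
Lemma hbdm_ln : hbdm n1 n2 0 (ln M) lg.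
Proof.
split => [|z w].
  exact: (measurableT_comp (@measurable_ln R) hg.1).
have /andP[h1 h2] := hg.2 z w.
by rewrite /lg ln_ge0//= ler_ln// posrE (lt_le_trans ltr01)// (le_trans h1).
Qed.

Let mQ := LDP_mech_measurable mech.

(** After round n1 only Y answers, and their channels and data have the same law under the null and
    every alternative: Jensen suffices and no information is paid. *)
Lemma rphase2_ln_le k j (z : n1.-tuple T) (w : j.-tuple T) :
  (n1 <= j)%N -> (j + k)%N = n2 ->
  rphase2 QY p0 lg k z w <= ln (rphase2 QY p0 g k z w).
Proof.
elim: k j w => [//|k IHk] j w lenj jkn /=.
have h1 := hbdm_rphase2 mQ pp0 ler01 hg (k := k) (j := j.+1).
have h2 := hbdm_rphase2 mQ pp0 (lexx 0) hbdm_ln (k := k) (j := j.+1).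
have b1 := hbdm_bdm2 z w (h1 ltac:(lia) ltac:(lia)).
have b2 := hbdm_bdm2 z w (h2 ltac:(lia) ltac:(lia)).
have ge1 t : 1 <= rphase2 QY p0 g k z (rcons w t).
  by have [_ /(_ z [tuple of rcons w t]) /andP[]] := h1 ltac:(lia) ltac:(lia).
apply: le_trans (step_ln_le _ pp0 ltr01 b1 ge1).
apply: le_step => //; first exact: bdm_ln ltr01 ge1 b1.
by move=> t; apply: (IHk j.+1 [tuple of rcons w t]); lia.
Qed.

(** The chain rule as an induction on rounds: the Y half of a round is free by Jensen, the X half
    costs 2 [kap] whatever the past, and the average over [v] commutes with the null expectation. *)
Lemma rphase1_ln_le k i (z w : i.-tuple T) : (i + k)%N = n1 ->
  rphase1 QX QY p0 p0 lg (n2 - n1) k z w <=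
  2 * kap * k%:R +
  avg (fun v => ln (rphase1 QX QY (fun x => p0 x + u v x) p0 g (n2 - n1) k z w)).
Proof.
elim: k i z w => [|k IHk] i z w /=.
  rewrite addn0 => i1; subst i.
  by rewrite avg_cst// mulr0 add0r; apply: rphase2_ln_le; lia.
move=> ikn; have ikn' : (i.+1 + k)%N = n1 by lia.
pose G v := rphase1 QX QY (fun x => p0 x + u v x) p0 g (n2 - n1) k.
have hL := hbdm_rphase1 mQ pp0 pp0 (lexx 0) hbdm_ln len ikn'.
have hG v := hbdm_rphase1 mQ (pu v) pp0 ler01 hg len ikn'.
have G1 v s t : 1 <= G v (rcons z s) (rcons w t).
  by have [_ /(_ [tuple of rcons z s] [tuple of rcons w t]) /andP[]] := hG v.
have bG v s := hbdm_bdm1 z w s (hG v).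
have bS v := hbdm_bdm1_step z w (QY (size w) ^~ z ^~ w) pp0 ler01 (hG v).
set qx := fun x => QX (size z) x z w.
set qy := fun y => QY (size w) y z w.
pose S v s := step qy p0 (fun t => G v (rcons z s) (rcons w t)).
have S1 v s : 1 <= S v s.
  rewrite -(step_cst qy 1 pp0); apply: le_step => //; first exact: bdm_cst.
  exact: bG.
have bSv v : bdm (S v) by exact: bS.
have blS v : bdm (fun s => ln (S v s)) by exact: bdm_ln ltr01 (S1 v) (bSv v).
have blG v s : bdm (fun t => ln (G v (rcons z s) (rcons w t))).
  exact: bdm_ln ltr01 (G1 v s) (bG v s).
have b_avg (F : V -> T -> R) : (forall v, bdm (F v)) -> bdm (fun t => avg (F^~ t)).
  by move=> bF; apply/bdmZ/bdm_sum.
have step_avg (Q : 'I_d -> probability T R) p (F : V -> T -> R) : (forall v, bdm (F v)) ->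
    step Q p (fun t => avg (F ^~ t)) = avg (fun v => step Q p (F v)).
  by move=> bF; rewrite /avg stepZ ?step_sum//; exact: bdm_sum.
apply: (@le_trans _ _ (step qx p0 (fun s => 2 * kap * k%:R + avg (fun v => ln (S v s))))).
  apply: le_step => //.
  - exact: hbdm_bdm1_step hL.
  - by apply: bdmD; [exact: bdm_cst|exact: b_avg].
  move=> s.
  apply: (@le_trans _ _ (step qy p0 (fun t => 2 * kap * k%:R +
      avg (fun v => ln (G v (rcons z s) (rcons w t)))))).
    apply: le_step => //.
    - exact: hbdm_bdm1 hL.
    - by apply: bdmD; [exact: bdm_cst|apply: b_avg].
    by move=> t; exact: (IHk i.+1 [tuple of rcons z s] [tuple of rcons w t]).
  rewrite stepD; [|exact: bdm_cst|by apply: b_avg].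
  rewrite step_cst// lerD2l (step_avg _ _ (fun v t => ln (G v (rcons z s) (rcons w t))))//.
  by apply: le_avg => v; apply: (step_ln_le _ pp0 ltr01) => //; exact: bG.
rewrite stepD; [|exact: bdm_cst|exact: b_avg].
rewrite step_cst// step_avg//.
have [_ _ ldpX _] := mech.
have := avg_step_ln_le e01 pp0 pu u_small u_avg (Q := qx) (g := S) (m := 1)
  (fun x x' S => ldpX _ x x' z w S) ltr01 bSv S1.
rewrite -[k.+1]addn1 natrD; lra.
Qed.

End interactive_induction.

(** * Testing errors and the entropy bound for interactive protocols *)

Section protocol_linear.
Context (R : realType) (d : nat) (dT : measure_display) (T : measurableType dT).
Context (n1 n2 : nat) (QX QY : chan R d T) (pX pY : 'I_d -> R).
Context (F G : seq T -> seq T -> R) (m M m' M' a b c : R).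
Hypothesis (mQ : mech_measurable n1 n2 QX QY) (len : (n1 <= n2)%N).
Hypothesis (ppX : pmf pX) (ppY : pmf pY) (m0 : 0 <= m) (m0' : 0 <= m').
Hypothesis (hF : hbdm n1 n2 m M F) (hG : hbdm n1 n2 m' M' G).
Hypothesis FG : forall (z : n1.-tuple T) (w : n2.-tuple T), a * F z w + b * G z w <= c.

(** Stands in for linearity of the expectation over a protocol: a linear inequality valid at every
    complete transcript survives each averaging. The signs of [a] and [b] are free, so both upper
    and lower bounds follow. *)
Lemma rphase2_lin_le k j (z : n1.-tuple T) (w : j.-tuple T) :
  (n1 <= j)%N -> (j + k)%N = n2 ->
  a * rphase2 QY pY F k z w + b * rphase2 QY pY G k z w <= c.
Proof.
elim: k j w => [|k IHk] j w lenj.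
  by rewrite addn0 => jn; subst j => /=.
move=> jkn /=.
have h1 := hbdm_bdm2 z w (hbdm_rphase2 mQ ppY m0 hF (k := k) (j := j.+1) ltac:(lia) ltac:(lia)).
have h2 := hbdm_bdm2 z w (hbdm_rphase2 mQ ppY m0' hG (k := k) (j := j.+1) ltac:(lia) ltac:(lia)).
rewrite -!stepZ// -stepD; [|exact: bdmZ..].
rewrite -[leRHS](step_cst (fun y => QY (size w) y z w) c ppY) le_step//.
- by apply: bdmD; exact: bdmZ.
- exact: bdm_cst.
- by move=> t; apply: (IHk j.+1 [tuple of rcons w t]); lia.
Qed.

Lemma rphase1_lin_le k i (z w : i.-tuple T) : (i + k)%N = n1 ->
  a * rphase1 QX QY pX pY F (n2 - n1) k z w +
  b * rphase1 QX QY pX pY G (n2 - n1) k z w <= c.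
Proof.
elim: k i z w => [|k IHk] i z w.
  by rewrite addn0 => i1; subst i; apply: rphase2_lin_le => //; lia.
move=> ikn /=.
have ikn' : (i.+1 + k)%N = n1 by lia.
have h1 := hbdm_rphase1 mQ ppX ppY m0 hF len ikn'.
have h2 := hbdm_rphase1 mQ ppX ppY m0' hG len ikn'.
set qx := fun x => QX (size z) x z w.
set qy := fun y => QY (size w) y z w.
have s1 := hbdm_bdm1_step z w qy ppY m0 h1.
have s2 := hbdm_bdm1_step z w qy ppY m0' h2.
rewrite -!stepZ// -stepD; [|exact: bdmZ..].
rewrite -[leRHS](step_cst qx c ppX) le_step//.
- by apply: bdmD; exact: bdmZ.
- exact: bdm_cst.
move=> s.
have t1 := hbdm_bdm1 z w s h1.
have t2 := hbdm_bdm1 z w s h2.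
rewrite -!stepZ// -stepD; [|exact: bdmZ..].
rewrite -[leRHS](step_cst qy c ppY) le_step//.
- by apply: bdmD; exact: bdmZ.
- exact: bdm_cst.
by move=> t; exact: (IHk i.+1 [tuple of rcons z s] [tuple of rcons w t]).
Qed.

End protocol_linear.

Section interactive_test.
Context (R : realType) (d : nat) (dT : measure_display) (T : measurableType dT).
Context (n1 n2 : nat) (QX QY : chan R d T) (eps : R).
Hypothesis (e01 : 0 < eps <= 1) (len : (n1 <= n2)%N).
Hypothesis mech : LDP_mech n1 n2 eps QX QY.
Context (phi : seq T -> seq T -> R).
Hypothesis test : rand_test n1 n2 phi.

Definition rrej pX pY := rphase1 QX QY pX pY phi (n2 - n1) n1 [::] [::].

Let mQ := LDP_mech_measurable mech.

Lemma rand_test_hbdm : hbdm n1 n2 0 1 phi.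
Proof. by split=> [|z w]; [exact: test.1|exact: test.2]. Qed.

Lemma rej_probE pX pY : pmf pX -> pmf pY ->
  rej_prob n1 n2 QX QY pX pY phi = (rrej pX pY)%:E.
Proof.
move=> ppX ppY.
exact: (phase1E mQ ppX ppY (lexx 0) rand_test_hbdm (i := 0) [tuple] [tuple] len (add0n _)).
Qed.

Context (V : finType) (p0 : 'I_d -> R) (u : V -> 'I_d -> R) (kap : R).
Hypothesis (V0 : (0 < #|V|)%N) (pp0 : pmf p0).
Hypothesis pu : forall v, pmf (fun x => p0 x + u v x).
Hypothesis u_small : forall v (a : 'I_d -> R), (forall x, `|a x| <= 32 * eps) ->
  `|\sum_(x < d) u v x * a x| <= 2^-1.
Hypothesis u_avg : forall a : 'I_d -> R, (forall x, `|a x| <= 32 * eps) ->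
  avg (fun v => (\sum_(x < d) u v x * a x) ^+ 2) <= kap.
Context (alpha beta : R).
Hypothesis (ab : alpha + beta <= 1 / 2) (a0 : 0 < alpha) (b0 : 0 < beta).
Hypothesis lev : rrej p0 p0 <= alpha.
Hypothesis pow : forall v, 1 - rrej (fun x => p0 x + u v x) p0 <= beta + 100^-1.

(** Donsker-Varadhan with the function 1 - phi gives 1 - alpha <= 2 kap n1 + ln B, where B = 1 + (e
    - 1)(beta + 1/100). The tangent at sqrt e bounds ln B by 1/6 + 3/2 (beta + 1/100), and the worst
    case, alpha near 0 and beta near 1/2, still leaves 1/15 for 2 kap n1. *)
Lemma interactive_information_ge : 1 / 30 <= kap * n1%:R.
Proof.
pose g z w := expR (1 - phi z w).
have hphi := rand_test_hbdm.
have hg : hbdm n1 n2 1 (expR 1) g.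
  split => [|z w].
    apply: (measurableT_comp (@measurable_expR R)).
    by apply: measurable_funB => //; exact: hphi.1.
  have /andP[h1 h2] := hphi.2 z w.
  rewrite /g ler_expR; apply/andP; split; last by lra.
  by rewrite -[leLHS]expR0 ler_expR; lra.
have hlg := hbdm_ln hg.
have L1 : 1 - alpha <= rphase1 QX QY p0 p0 (fun z w => ln (g z w)) (n2 - n1) n1 [::] [::].
  have := rphase1_lin_le mQ len pp0 pp0 (lexx 0) (lexx 0) hlg hphi
    (a := -1) (b := -1) (c := -1) _ (i := 0) [tuple] [tuple] (add0n _).
  rewrite -/(rrej p0 p0) => /(_ _)/= h.
  have {}h : -1 * rphase1 QX QY p0 p0 (fun z w => ln (g z w)) (n2 - n1) n1 [::] [::] +
      -1 * rrej p0 p0 <= -1 by apply: h => z w; rewrite /g expRK; lra.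
  by move: lev h; lra.
have e1 : 1 <= expR 1 :> R by rewrite -[leLHS]expR0 ler_expR.
set s := expR 2^-1 : R.
have s0 : 0 < s by exact: expR_gt0.
have ess : expR 1 = s * s :> R by rewrite -expRD; congr expR; lra.
have s32 : 3 / 2 <= s by apply: le_trans (expR_ge1Dx _); lra.
have sV : 2^-1 <= s^-1 by rewrite -expRN; apply: le_trans (expR_ge1Dx _); lra.
have sV' : s * s^-1 = 1 by rewrite divff// gt_eqF.
have s2 : s <= 2 by nra.
have gB v : rphase1 QX QY (fun x => p0 x + u v x) p0 g (n2 - n1) n1 [::] [::] <=
    1 + (expR 1 - 1) * (beta + 100^-1).
  have := rphase1_lin_le mQ len (pu v) pp0 ler01 (lexx 0) hg hphi
    (a := 1) (b := expR 1 - 1) (c := expR 1) _ (i := 0) [tuple] [tuple] (add0n _).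
  rewrite -/(rrej _ p0) => /(_ _)/= h.
  have {}h : 1 * rphase1 QX QY (fun x => p0 x + u v x) p0 g (n2 - n1) n1 [::] [::] +
      (expR 1 - 1) * rrej (fun x => p0 x + u v x) p0 <= expR 1.
    apply: h => z w; have /andP[h1 h2] := hphi.2 z w.
    rewrite mul1r /g.
    have t01 : 0 <= 1 - phi z w by lra.
    have t02 : 1 - phi z w <= 1 by lra.
    (* On [0, 1] the exponential lies below its chord 1 + (e - 1) t, here at t = 1 - phi. *)
    have := @convex_expR R (Itv01 t01 t02) 1 0.
    rewrite !convRE/= expR0 mulr1 mulr0 addr0 => h3.
    by apply: le_trans (lerD h3 (lexx _)) _; rewrite /unstable.onem; lra.
  have := pow v; nra.
have gB1 v : 1 <= rphase1 QX QY (fun x => p0 x + u v x) p0 g (n2 - n1) n1 [::] [::].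
  by have [_ /(_ [tuple] [tuple]) /andP[]] :=
    hbdm_rphase1 mQ (pu v) pp0 ler01 hg len (i := 0) (add0n _).
have := rphase1_ln_le e01 len mech V0 pp0 pu u_small u_avg hg (i := 0) [tuple] [tuple] (add0n _).
move=> /(le_trans L1) hm.
set B := 1 + (expR 1 - 1) * (beta + 100^-1) in gB.
have B0 : 0 < B by rewrite /B ltr_pwDl// mulr_ge0//; move: b0; lra.
have lnB : ln B <= 2^-1 + B / s - 1.
  by have := ln_le_tangent B0 s0; rewrite expRK.
have avgB : avg (fun v => ln (rphase1 QX QY (fun x => p0 x + u v x) p0 g (n2 - n1) n1
    [::] [::])) <= ln B.
  rewrite -(avg_cst (ln B) V0); apply: le_avg => v.
  by rewrite ler_ln ?posrE// (lt_le_trans ltr01).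
have Bs : B / s = s^-1 + (s - s^-1) * (beta + 100^-1).
  by rewrite /B ess; field; rewrite gt_eqF.
have sV3 : s^-1 <= 2 / 3 by nra.
have h1 : (s - s^-1) * (beta + 100^-1) <= 3 / 2 * (beta + 100^-1).
  by apply: ler_wpM2r; move: b0; lra.
move: ab a0 b0 hm avgB lnB; rewrite Bs; lra.
Qed.

End interactive_test.

(** * Random signs and the adapted prior *)

Section signs.
Context (R : realType) (d : nat).
Definition signs := {ffun 'I_d -> bool}.
Implicit Types (h : signs) (c : 'I_d -> R) (x j : 'I_d).

Definition sg (b : bool) : R := if b then 1 else -1.

Lemma sgsq b : sg b * sg b = 1.
Proof. by case: b; rewrite /sg ?mulr1// mulrNN mulr1. Qed.

Lemma norm_sg b : `|sg b| = 1.
Proof. by case: b; rewrite /sg ?normrN normr1. Qed.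

Lemma sgN b : sg (~~ b) = - sg b.
Proof. by case: b; rewrite /sg ?opprK. Qed.

Definition flip j h : signs := [ffun x => if x == j then ~~ h x else h x].

Lemma flipK j : involutive (flip j).
Proof.
by move=> h; apply/ffunP => x; rewrite !ffunE; case: eqP => // _; rewrite negbK.
Qed.

Lemma card_signs : (0 < #|{: signs}|)%N.
Proof. by apply/card_gt0P; exists [ffun=> true]. Qed.

(** Flipping the j-th sign is a bijection that negates the summand, so the average equals its
    opposite. *)
Lemma avg_sg_mul j (G : signs -> R) : (forall h, G (flip j h) = G h) ->
  avg (fun h => sg (h j) * G h) = 0.
Proof.
move=> Gj; apply/eqP; rewrite -[_ == 0](mulrn_eq0 _ 2)/= mulr2n.
rewrite -{1}[avg _]mul1r /avg; apply/eqP.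
rewrite [X in _ * (_ * X)](reindex_inj (inv_inj (flipK j)))/=.
rewrite mul1r -mulrDr -big_split/= big1 ?mulr0// => h _.
by rewrite Gj ffunE eqxx sgN mulNr addNr.
Qed.

(** A Rademacher sum over a list of coordinates, so that moments can be computed by peeling off one
    sign at a time. *)
Definition rad (s : seq 'I_d) c h : R := \sum_(j <- s) c j * sg (h j).

Lemma rad_flip s c j h : j \notin s -> rad s c (flip j h) = rad s c h.
Proof.
move=> js; apply: eq_big_seq => i is_; rewrite ffunE.
by case: eqP => // ij; move: js; rewrite -ij is_.
Qed.

Lemma rad_cons j s c h : rad (j :: s) c h = c j * sg (h j) + rad s c h.
Proof. by rewrite /rad big_cons. Qed.

Lemma avg_rad2 s c c' : uniq s ->
  avg (fun h => rad s c h * rad s c' h) = \sum_(j <- s) c j * c' j.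
Proof.
elim: s => [_|j s IHs /= /andP[js us]].
  by under eq_avg do rewrite /rad big_nil mul0r; rewrite avg_cst ?card_signs// big_nil.
rewrite big_cons -IHs//.
rewrite (eq_avg (G := fun h => (c j * c' j + rad s c h * rad s c' h) +
  sg (h j) * (c j * rad s c' h + c' j * rad s c h))); last first.
  move=> h; rewrite !rad_cons; have := sgsq (h j); move: (sg (h j)) => t t2.
  transitivity (c j * c' j * (t * t) + rad s c h * rad s c' h +
    t * (c j * rad s c' h + c' j * rad s c h)); first by ring.
  by rewrite t2 mulr1.
rewrite avgD avg_sg_mul ?addr0; last by move=> h; rewrite !rad_flip.
by rewrite avgD avg_cst// card_signs.
Qed.

(** Khintchine's fourth moment bound: odd powers of the peeled sign vanish on average, and what is
    left, 3 S^2 + 6 c^2 S + c^4, is at most 3 (c^2 + S)^2. *)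
Lemma avg_rad4 s c : uniq s ->
  avg (fun h => rad s c h ^+ 4) <= 3 * (\sum_(j <- s) c j ^+ 2) ^+ 2.
Proof.
elim: s => [_|j s IHs /= /andP[js us]].
  under eq_avg do rewrite /rad big_nil expr0n/=.
  by rewrite avg_cst ?card_signs// big_nil expr0n/= mulr0.
rewrite big_cons.
rewrite (eq_avg (G := fun h => (rad s c h ^+ 4 + 6 * c j ^+ 2 * (rad s c h * rad s c h) + c j ^+ 4) +
  sg (h j) * (4 * c j * rad s c h ^+ 3 + 4 * c j ^+ 3 * rad s c h))); last first.
  move=> h; rewrite !rad_cons; have := sgsq (h j); move: (sg (h j)) (rad s c h) => t X t2.
  transitivity (X ^+ 4 + 6 * c j ^+ 2 * (X * X) * (t * t) + c j ^+ 4 * (t * t) * (t * t) +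
    t * (4 * c j * X ^+ 3 + 4 * c j ^+ 3 * X * (t * t))); first by ring.
  by rewrite t2 !mulr1.
rewrite avgD avg_sg_mul ?addr0; last by move=> h; rewrite !rad_flip.
rewrite !avgD avgZ avg_rad2// avg_cst ?card_signs//.
have := IHs us.
under [\sum_(_ <- _) c _ * c _]eq_bigr do rewrite -expr2.
have : 0 <= \sum_(i <- s) c i ^+ 2 by apply: sumr_ge0 => i _; exact: sqr_ge0.
move: (\sum_(i <- s) c i ^+ 2) (avg _) => S A S0 h.
have -> : c j ^+ 4 = (c j ^+ 2) ^+ 2 by ring.
by have := sqr_ge0 (c j); move: (c j ^+ 2) => C C0; nra.
Qed.

(** Cruder than the sharp exp (x^2 / 2). Beyond 1/2 one has x <= 2 x^2; below it, exp x <= 1 / (1 -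
    x) and exp (- x) <= 1 / (1 + x) are bounded by quadratics. *)
Lemma cosh_le (x : R) : (expR x + expR (- x)) / 2 <= expR (2 * x ^+ 2).
Proof.
wlog x0 : x / 0 <= x => [hw|].
  case: (leP 0 x) => [|/ltW x0]; first exact: hw.
  by have := hw (- x); rewrite opprK addrC sqrrN; apply; rewrite oppr_ge0.
have [x12|x12] := leP x 2^-1; last first.
  have h1 : expR (- x) <= expR x by rewrite ler_expR; lra.
  apply: (@le_trans _ _ (expR x)); first lra.
  by rewrite ler_expR; nra.
have h1 : 1 - x <= expR (- x) by apply: le_trans (expR_ge1Dx _); lra.
have h2 : 1 + x <= expR x by apply: le_trans (expR_ge1Dx _); lra.
have h3 := expRxMexpNx_1 x.
have h4 : 1 + 2 * x ^+ 2 <= expR (2 * x ^+ 2) by exact: expR_ge1Dx.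
apply: le_trans h4.
have e1 : expR x <= 1 + x + 2 * x ^+ 2 by nra.
have e2 : expR (- x) <= 1 - x + x ^+ 2 by nra.
by have := sqr_ge0 x; lra.
Qed.

(** The peeled sign contributes its cosh [C]; the sinh part [S] averages to 0. *)
Lemma avg_exp_rad s c : uniq s ->
  avg (fun h => expR (rad s c h)) <= expR (2 * \sum_(j <- s) c j ^+ 2).
Proof.
elim: s => [_|j s IHs /= /andP[js us]].
  under eq_avg do rewrite /rad big_nil expR0.
  by rewrite avg_cst ?card_signs// big_nil mulr0 expR0.
rewrite big_cons mulrDr expRD.
pose C := (expR (c j) + expR (- c j)) / 2.
pose S := (expR (c j) - expR (- c j)) / 2.
rewrite (eq_avg (G := fun h => C * expR (rad s c h) + sg (h j) * (S * expR (rad s c h)))); last first.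
  move=> h; rewrite rad_cons expRD.
  by case: (h j); rewrite /sg ?mulr1 ?mulrN1 /C /S; field.
rewrite avgD avg_sg_mul ?addr0; last by move=> h; rewrite !rad_flip.
rewrite avgZ; apply: ler_pM; [|rewrite /avg mulr_ge0 ?invr_ge0 ?ler0n//|exact: cosh_le|exact: IHs].
  by rewrite divr_ge0// addr_ge0// expR_ge0.
by apply: sumr_ge0 => h _; exact: expR_ge0.
Qed.

End signs.

(** * Zero-sum sign perturbations *)

Section pairing.
Context (R : realType) (d : nat).
Implicit Types (h : signs d) (x j : 'I_d) (a : 'I_d -> R).

(** The difference of the basis vectors 2j and 2j+1, or 0 if 2j+1 is out of range: for odd d the
    last coordinate stays unpaired. Opposite signs on a pair preserve the total mass of a perturbed
    law. *)
Definition pairing j x : R := if (x./2 == j :> nat) && (j.*2.+1 < d)%N then (-1) ^+ odd x else 0.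

Definition psign h x : R := \sum_(j < d) sg R (h j) * pairing j x.

Lemma pairing_sum j (F : 'I_d -> R) (lt2 : (j.*2.+1 < d)%N) :
  (forall x, x./2 != j :> nat -> F x = 0) ->
  \sum_x F x = F (Ordinal (ltnW lt2)) + F (Ordinal lt2).
Proof.
move=> F0; rewrite (bigD1 (Ordinal (ltnW lt2)))//=; congr (_ + _).
rewrite (bigD1 (Ordinal lt2))/=; last by rewrite -val_eqE/=; lia.
rewrite big1 ?addr0// => x /andP[]; rewrite -!val_eqE/= => h1 h2.
by apply: F0; apply/eqP; lia.
Qed.

Lemma pairingE j a : \sum_x pairing j x * a x =
  if ltnP j.*2.+1 d is LtnNotGeq lt2 then a (Ordinal (ltnW lt2)) - a (Ordinal lt2) else 0.
Proof.
case: ltnP => [lt2|ge2]; last first.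
  by apply: big1 => x _; rewrite /pairing (ltnNge _ d) ge2 andbF mul0r.
rewrite (pairing_sum lt2) => [|x xj]; last by rewrite /pairing (negbTE xj) mul0r.
rewrite /pairing/= lt2 !andbT.
have -> : j.*2./2 == j by lia.
have -> : uphalf j.*2 == j by lia.
by rewrite odd_double/= expr0 expr1 mul1r mulN1r.
Qed.

Lemma pairing_sum0 j : \sum_x pairing j x = 0.
Proof.
have := pairingE j (fun=> 1); under eq_bigr do rewrite mulr1.
by move=> ->; case: ltnP => // _; rewrite subrr.
Qed.

Lemma norm_pairing_le1 x : \sum_j `|pairing j x| <= 1.
Proof.
have ltx : (x./2 < d)%N by have := ltn_ord x; lia.
rewrite (bigD1 (Ordinal ltx))//= big1 ?addr0 => [|j].
  by rewrite /pairing; case: ifP => _; rewrite ?normr0// normrX normrN1 expr1n.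
by rewrite -val_eqE/= eq_sym => jx; rewrite /pairing (negbTE jx) normr0.
Qed.

Lemma norm_psign_le1 h x : `|psign h x| <= 1.
Proof.
apply: le_trans (norm_pairing_le1 x); apply: le_trans (ler_norm_sum _ _ _) _.
by apply: ler_sum => j _; rewrite normrM norm_sg mul1r.
Qed.

Lemma psign_sum0 h : \sum_x psign h x = 0.
Proof.
rewrite exchange_big/= big1// => j _.
by rewrite -mulr_sumr pairing_sum0 mulr0.
Qed.

(** Every linear form in the paired signs is a Rademacher sum, to which the moment bounds apply. *)
Lemma psign_dot h a : \sum_x psign h x * a x = rad (enum 'I_d) (fun j => \sum_x pairing j x * a x) h.
Proof.
rewrite /rad big_enum/=; under eq_bigr do rewrite mulr_suml.
rewrite exchange_big/=; apply: eq_bigr => j _; rewrite mulr_suml.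
by apply: eq_bigr => x _; rewrite -mulrA mulrC.
Qed.

(** (s - t)^2 <= 2 s^2 + 2 t^2 on each pair, and the pairs are disjoint. *)
Lemma pairing_sqr_le a :
  \sum_j (\sum_x pairing j x * a x) ^+ 2 <= 2 * \sum_x a x ^+ 2.
Proof.
have h j : (\sum_x pairing j x * a x) ^+ 2 <= \sum_x 2 * (`|pairing j x| * a x ^+ 2).
  rewrite pairingE; case: ltnP => [lt2|ge2]; last first.
    rewrite expr0n/= sumr_ge0// => x _.
    by rewrite mulr_ge0// mulr_ge0// ?normr_ge0 ?sqr_ge0.
  rewrite (pairing_sum lt2) => [|x xj]; last first.
    by rewrite /pairing (negbTE xj) normr0 mul0r mulr0.
  rewrite /pairing/= lt2 !andbT.
  have -> : j.*2./2 == j by lia.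
  have -> : uphalf j.*2 == j by lia.
  rewrite !normrX normrN1 !expr1n !mul1r.
  by have := sqr_ge0 (a (Ordinal (ltnW lt2)) + a (Ordinal lt2)); nra.
apply: (le_trans (ler_sum _ (fun j _ => h j))).
rewrite exchange_big/= mulr_sumr; apply: ler_sum => x _.
rewrite -mulr_sumr -mulr_suml ler_pM2l//.
by rewrite -[leRHS]mul1r ler_wpM2r ?sqr_ge0// norm_pairing_le1.
Qed.

(** At most the last coordinate is unpaired, and d - 1 >= d / 2. *)
Lemma psign_sqr_ge h : (2 <= d)%N -> d%:R / 2 <= \sum_x psign h x ^+ 2.
Proof.
move=> d2.
have hx x : ((x.+1 < d)%N)%:R <= psign h x ^+ 2.
  case: ltnP => xd; last by rewrite sqr_ge0.
  have ltx : (x./2 < d)%N by have := ltn_ord x; lia.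
  rewrite /psign (bigD1 (Ordinal ltx))//= big1 ?addr0 => [|j].
    rewrite /pairing/= eqxx/=; have -> : (x./2.*2.+1 < d)%N by lia.
    by rewrite exprMn -[sg _ _ ^+ 2]/(_ * _) sgsq mul1r -exprM muln2 -addnn exprD -expr2 sqrr_sign.
  rewrite -val_eqE/= eq_sym => jx; rewrite /pairing.
  by rewrite (negbTE jx) mulr0.
apply: le_trans (ler_sum _ (fun x _ => hx x)).
rewrite -natr_sum.
have -> : (\sum_(x < d) (x.+1 < d) = d.-1)%N.
  rewrite -(prednK (ltnW d2)) big_ord_recr/= ltnn addn0.
  rewrite (eq_bigr (fun=> 1%N)) => [|i _]; first by rewrite sum1_card card_ord.
  by rewrite ltnS ltn_ord.
have : 2 <= d%:R :> R by rewrite ler_nat.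
have -> : d%:R = d.-1%:R + 1 :> R by rewrite -{1}(prednK (ltnW d2)) -addn1 natrD.
lra.
Qed.

End pairing.

(** * Damping by the resolvent of the information kernel *)

Section resolvent.
Context (R : realType) (d : nat) (K : 'I_d -> 'I_d -> R) (kap : R).
Implicit Types a b : 'I_d -> R.
Hypothesis (Ksym : forall x y, K x y = K y x) (kap0 : 0 < kap).

Definition mulf (M : 'I_d -> 'I_d -> R) a x : R := \sum_y M x y * a y.
Definition dotf a b : R := \sum_x a x * b x.

Hypothesis Kpsd : forall a, 0 <= dotf a (mulf K a).

Lemma dotfC a b : dotf a b = dotf b a.
Proof. by apply: eq_bigr => x _; rewrite mulrC. Qed.

Lemma dotfZ a b (k : R) : dotf a (fun x => k * b x) = k * dotf a b.
Proof. by rewrite /dotf mulr_sumr; apply: eq_bigr => x _; rewrite mulrCA. Qed.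

Lemma dotf_ge0 a : 0 <= dotf a a.
Proof. by apply: sumr_ge0 => x _; rewrite -expr2 sqr_ge0. Qed.

Lemma dotf_mulf (M : 'I_d -> 'I_d -> R) a b : (forall x y, M x y = M y x) ->
  dotf a (mulf M b) = dotf (mulf M a) b.
Proof.
move=> Msym; rewrite /dotf /mulf; under eq_bigr do rewrite mulr_sumr.
rewrite exchange_big/=; apply: eq_bigr => y _; rewrite mulr_suml.
by apply: eq_bigr => x _; rewrite Msym mulrCA mulrA.
Qed.

Lemma exists_resolvent : exists U : 'I_d -> 'I_d -> R,
  (forall x y, U x y = U y x) /\
  forall a x, mulf U a x + kap^-1 * mulf K (mulf U a) x = a x.
Proof.
pose KM : 'M[R]_d := \matrix_(x, y) K x y.
pose A : 'M[R]_d := 1%:M + kap^-1 *: KM.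
have KMsym : KM^T = KM by apply/matrixP => x y; rewrite !mxE.
have Asym : A^T = A by rewrite /A linearD/= linearZ/= trmx1 KMsym.
(* If v (1 + K / kap) = 0, then |v|^2 + v.Kv / kap = 0 with both terms nonnegative, so v = 0. *)
have Aunit : A \in unitmx.
  rewrite -row_free_unit; apply: inj_row_free => v vA0.
  pose a x := v 0 x.
  have vK : dotf a (mulf K a) = (v *m KM *m v^T) 0 0.
    rewrite mxE dotfC; apply: eq_bigr => x _; rewrite !mxE; congr (_ * _).
    by apply: eq_bigr => y _; rewrite !mxE mulrC Ksym.
  have vv : dotf a a = (v *m v^T) 0 0 by rewrite mxE; apply: eq_bigr => x _; rewrite mxE.
  have : dotf a a + kap^-1 * dotf a (mulf K a) = 0.
    rewrite vK vv; move: (congr1 (fun w => (w *m v^T) 0 0) vA0).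
    by rewrite /A mulmxDr mulmx1 mulmxDl -scalemxAr -scalemxAl mul0mx !mxE.
  have k0 : 0 <= kap^-1 * dotf a (mulf K a) by rewrite mulr_ge0 ?Kpsd// invr_ge0 ltW.
  have := dotf_ge0 a => a0 e.
  have {}e : dotf a a = 0 by lra.
  apply/rowP => x; rewrite !mxE.
  have a2 y : true -> 0 <= a y * a y by move=> _; rewrite -expr2 sqr_ge0.
  have h := psumr_eq0P a2 e.
  by apply/eqP; rewrite -sqrf_eq0 expr2; apply/eqP; exact: h.
pose UM := invmx A.
have UMsym : UM^T = UM by rewrite /UM trmx_inv Asym.
exists (fun x y => UM x y); split => [x y|a x].
  by rewrite -[in LHS]UMsym mxE.
have := mulmxV Aunit; rewrite -/UM /A mulmxDl mul1mx -scalemxAl => /(congr1 (fun M => M *m \col_y a y)).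
rewrite mul1mx mulmxDl -scalemxAl -mulmxA => /matrixP /(_ x 0).
rewrite !mxE => <-; congr (_ + _ * _).
  by apply: eq_bigr => y _; rewrite mxE.
apply: eq_bigr => y _; rewrite !mxE; congr (_ * _).
by apply: eq_bigr => z _; rewrite mxE.
Qed.

Context (U : 'I_d -> 'I_d -> R).
Hypothesis Usym : forall x y, U x y = U y x.
Hypothesis UE : forall a x, mulf U a x + kap^-1 * mulf K (mulf U a) x = a x.

Lemma resolventE a : a = fun x => mulf U a x + kap^-1 * mulf K (mulf U a) x.
Proof. by apply/funext => x; rewrite UE. Qed.

(** Expand |a|^2 with a = Ua + KUa / kap and drop the cross term, nonnegative by [Kpsd]. Thus U and
    KU / kap are both contractions. *)
Lemma resolvent_sqr_ge a :
  dotf (mulf U a) (mulf U a) + kap^-1 ^+ 2 * dotf (mulf K (mulf U a)) (mulf K (mulf U a))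
    <= dotf a a.
Proof.
rewrite [in leRHS](resolventE a); set c := mulf U a; set b := mulf K c.
have -> : dotf (fun x => c x + kap^-1 * b x) (fun x => c x + kap^-1 * b x) =
    dotf c c + (2 * kap^-1) * dotf c b + kap^-1 ^+ 2 * dotf b b.
  by rewrite /dotf !mulr_sumr -!big_split; apply: eq_bigr => x _ /=; ring.
have h : 0 <= dotf c b by exact: Kpsd.
have : 0 <= kap^-1 * dotf c b by rewrite mulr_ge0// invr_ge0 ltW.
by lra.
Qed.

Lemma resolvent_sqr_le a : dotf (mulf U a) (mulf U a) <= dotf a a.
Proof.
apply: le_trans (resolvent_sqr_ge a); rewrite lerDl mulr_ge0 ?sqr_ge0//.
exact: dotf_ge0.
Qed.

(** The contraction applied to a basis vector bounds a column of U, and U is symmetric. *)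
Lemma resolvent_row_le x : \sum_y U x y ^+ 2 <= 1.
Proof.
have h := resolvent_sqr_le (fun y => (y == x)%:R).
have e1 : dotf (fun y => (y == x)%:R) (fun y => (y == x)%:R) = 1 :> R.
  rewrite /dotf (bigD1 x)//= big1 ?addr0 ?eqxx ?mulr1// => y /negbTE ->.
  by rewrite mulr0.
rewrite e1 in h; apply: le_trans h; rewrite le_eqVlt; apply/orP; left; apply/eqP.
apply: eq_bigr => y _; rewrite expr2 /mulf (bigD1 x)//= big1 ?addr0 ?eqxx ?mulr1 => [|z /negbTE ->].
  by rewrite Usym.
by rewrite mulr0.
Qed.

(** The scalar fact 1 / (1 + t) >= 1 - t, without diagonalisation: with e = Ua - a = - KUa / kap,
    the signs e.Ke >= 0 and e.KUa <= 0 give Ua.Ka <= a.Ka. *)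
Lemma resolvent_dot_ge a : dotf a a - kap^-1 * dotf a (mulf K a) <= dotf (mulf U a) a.
Proof.
set z := mulf U a; pose e x := z x - a x.
have eE x : e x = - (kap^-1 * mulf K z x) by rewrite /e -(UE a x) opprD addrA subrr sub0r.
have Ke x : mulf K e x = mulf K z x - mulf K a x.
  by rewrite /mulf -sumrB; apply: eq_bigr => y _; rewrite mulrBr.
have Kea : dotf e (mulf K e) = dotf e (mulf K z) - dotf e (mulf K a).
  by rewrite /dotf -sumrB; apply: eq_bigr => x _; rewrite Ke mulrBr.
have eKz : dotf e (mulf K z) = - (kap^-1 * dotf (mulf K z) (mulf K z)).
  rewrite /dotf mulr_sumr -sumrN; apply: eq_bigr => x _.
  by rewrite eE mulNr mulrA.
have h1 := Kpsd e.
have h2 : 0 <= kap^-1 * dotf (mulf K z) (mulf K z).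
  by rewrite mulr_ge0 ?dotf_ge0// invr_ge0 ltW.
have eKa : dotf e (mulf K a) = dotf z (mulf K a) - dotf a (mulf K a).
  by rewrite /dotf -sumrB; apply: eq_bigr => x _; rewrite /e mulrBl.
have h3 : dotf z (mulf K a) <= dotf a (mulf K a) by lra.
have h4 : dotf z a = dotf a a + dotf e a.
  by rewrite /dotf -big_split; apply: eq_bigr => x _ /=; rewrite /e -mulrDl addrC subrK.
have h5 : dotf e a = - (kap^-1 * dotf z (mulf K a)).
  rewrite (dotf_mulf _ _ Ksym) /dotf mulr_sumr -sumrN; apply: eq_bigr => x _.
  by rewrite eE mulNr mulrA.
have : kap^-1 * dotf z (mulf K a) <= kap^-1 * dotf a (mulf K a).
  by rewrite ler_pM2l// invr_gt0.
lra.
Qed.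

(** On eigenvalues, k / (1 + k / kap)^2 <= kap. Since KUa = kap (a - Ua), the vector UKUa is kap
    times the image of Ua under KU / kap, and two contractions remain. This is the gain of the
    damping: K alone may have norm d times the size of its entries. *)
Lemma resolvent_UKU_le a :
  dotf (mulf U (mulf K (mulf U a))) (mulf U (mulf K (mulf U a))) <= kap ^+ 2 * dotf a a.
Proof.
set w := mulf U a; set u := mulf U w.
have Kw x : mulf K w x = kap * (a x - w x).
  by rewrite -(UE a x) -/w addrAC subrr add0r mulrA divff ?mul1r// gt_eqF.
have UKw x : mulf U (mulf K w) x = kap * (kap^-1 * mulf K u x).
  rewrite (_ : kap^-1 * mulf K u x = w x - u x); last first.
    by rewrite -(UE w x) -/u addrAC subrr add0r.
  rewrite /w /u /mulf -sumrB mulr_sumr; apply: eq_bigr => y _.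
  by rewrite -/(mulf K w y) Kw -mulrBr mulrCA.
have -> : mulf U (mulf K w) = fun x => kap * (kap^-1 * mulf K u x).
  by apply/funext.
rewrite dotfZ dotfC dotfZ mulrA -expr2 ler_pM2l ?exprn_gt0//.
apply: le_trans (resolvent_sqr_le a); rewrite -/w.
apply: le_trans (resolvent_sqr_ge w); rewrite -/u.
by rewrite dotfZ dotfC dotfZ mulrA -expr2 lerDr dotf_ge0.
Qed.

Lemma resolvent_sum0 a : (forall y, \sum_x K x y = 0) -> \sum_x a x = 0 ->
  \sum_x mulf U a x = 0.
Proof.
move=> K0; set z := mulf U a; move=> a0.
have Kz : \sum_x mulf K z x = 0.
  by rewrite exchange_big/= big1// => y _; rewrite -mulr_suml K0 mul0r.
move: a0; under eq_bigr do rewrite -UE.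
by rewrite big_split/= -mulr_sumr Kz mulr0 addr0.
Qed.

End resolvent.

Section prior.
Context (R : realType) (d : nat) (K : 'I_d -> 'I_d -> R) (k0 kap : R).
Hypothesis (Ksym : forall x y, K x y = K y x) (kap0 : 0 < kap).
Hypothesis Kpsd : forall a, 0 <= dotf a (mulf K a).
Hypothesis Ksum0 : forall y, \sum_x K x y = 0.
Hypothesis Kbound : forall x y, `|K x y| <= k0.
Hypothesis kap_large : 40 ^+ 2 * k0 <= kap.
Hypothesis d2 : (2 <= d)%N.

(** Orthogonality of the signs keeps only entries of K within one pair; each x lies in at most one
    pair, whose difference of two entries is at most 2 [k0]. *)
Lemma avg_psign_quad_le :
  avg (fun h : signs d => dotf (psign R h) (mulf K (psign R h))) <= 2 * k0 * d%:R.
Proof.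
have psE h x : psign R h x = rad (enum 'I_d) (fun j => pairing R j x) h.
  by rewrite /psign /rad big_enum/=; apply: eq_bigr => j _; rewrite mulrC.
have KpsE h x : mulf K (psign R h) x =
    rad (enum 'I_d) (fun j => \sum_y pairing R j y * K x y) h.
  by rewrite -psign_dot; apply: eq_bigr => y _; rewrite mulrC.
rewrite avg_sum.
have -> : 2 * k0 * d%:R = \sum_(x < d) 2 * k0.
  by rewrite sumr_const card_ord mulr_natr.
apply: ler_sum => x _.
rewrite (eq_avg (G := fun h => rad (enum 'I_d) (fun j => pairing R j x) h *
  rad (enum 'I_d) (fun j => \sum_y pairing R j y * K x y) h)); last first.
  by move=> h; rewrite psE KpsE.
rewrite avg_rad2 ?enum_uniq// big_enum/=.
have k00 : 0 <= k0 by apply: le_trans (Kbound x x).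
apply: (@le_trans _ _ (\sum_j `|pairing R j x| * (2 * k0))).
  apply: ler_sum => j _; apply: le_trans (ler_norm _) _; rewrite normrM.
  apply: ler_wpM2l => //; rewrite pairingE.
  case: ltnP => [lt2|_]; last by rewrite normr0 mulr_ge0.
  by apply: le_trans (ler_normB _ _) _; rewrite mulr2n mulrDl mul1r lerD.
by rewrite -mulr_suml -[leRHS]mul1r ler_wpM2r ?norm_pairing_le1// mulr_ge0.
Qed.

(* The map [z] is the resolvent of [K / kap] applied to the paired signs [psign]. *)
Lemma exists_prior : exists (z : signs d -> 'I_d -> R) (good : pred (signs d)),
  [/\ forall h, \sum_x z h x = 0,
      avg (fun h => (~~ good h)%:R : R) <= 100^-1,
      forall h, good h -> d%:R / 4 <= \sum_x `|z h x| /\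
        forall x, `|z h x| <= Num.sqrt (160 * ln d%:R) &
      forall h' s, avg (fun h => expR (s * dotf (z h) (mulf K (z h')))) <=
        expR (4 * s ^+ 2 * kap ^+ 2 * d%:R)].
Proof.
have [U [Usym UE]] := exists_resolvent Ksym kap0 Kpsd.
have lnd0 : 0 < ln (d%:R : R) by rewrite ln_gt0// ltr1n.
(* Each [z h x] is sub-Gaussian, exp (s z) having average at most exp (4 s^2). Chernoff at s = t / 8
   gives exp (- t^2 / 16) = d^-10, which beats the union over d coordinates. *)
pose t : R := Num.sqrt (160 * ln d%:R).
have t2 : t ^+ 2 = 160 * ln d%:R by rewrite sqr_sqrtr// mulr_ge0// ltW.
pose z h := mulf U (psign R h).
pose q h := dotf (psign R h) (mulf K (psign R h)).
(* The first condition keeps the L1 norm of z at least d / 2 - d / 4; the second will keep the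
   perturbed law nonnegative. *)
pose good h := (q h <= kap * d%:R / 4) && [forall x, `|z h x| <= t].
have d0 : 0 < d%:R :> R by rewrite ltr0n; lia.
exists z, good; split.
- by move=> h; apply: (resolvent_sum0 UE Ksum0); exact: psign_sum0.
- have zE h x : z h x = rad (enum 'I_d) (fun j => \sum_y pairing R j y * U x y) h.
    by rewrite -psign_dot; apply: eq_bigr => y _; rewrite mulrC.
  have exp_z x s : avg (fun h => expR (s * z h x)) <= expR (4 * s ^+ 2).
    rewrite (eq_avg (G := fun h => expR (rad (enum 'I_d)
      (fun j => s * \sum_y pairing R j y * U x y) h))); last first.
      by move=> h; rewrite zE /rad mulr_sumr; congr expR; apply: eq_bigr => j _; rewrite mulrA.
    apply: le_trans (avg_exp_rad _ (enum_uniq _)) _.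
    rewrite ler_expR big_enum/=; under eq_bigr do rewrite exprMn.
    rewrite -mulr_sumr.
    have := pairing_sqr_le (U x).
    have := resolvent_row_le kap0 Kpsd Usym UE x.
    have := sqr_ge0 s; move: (\sum_i _) (\sum_i _) => a b; nra.
  (* A pointwise majorant of the indicator of a bad h: a Markov term for the quadratic form and two
     exponential terms per coordinate. *)
  have bad_le h : (~~ good h)%:R <= 4 / (kap * d%:R) * q h +
      \sum_x (expR (- (t ^+ 2 / 8)) * (expR (t / 8 * z h x) + expR ((- (t / 8)) * z h x))).
    have term0 x : 0 <= expR (- (t ^+ 2 / 8)) * (expR (t / 8 * z h x) + expR ((- (t / 8)) * z h x)).
      by rewrite mulr_ge0 ?addr_ge0 ?expR_ge0.
    have q0 : 0 <= 4 / (kap * d%:R) * q h.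
      by rewrite mulr_ge0 ?Kpsd// divr_ge0// mulr_ge0 ?ltW.
    rewrite /good negb_and -ltNge; case: (ltP (kap * d%:R / 4) (q h)) => /= [hq|_].
      apply: (@le_trans _ _ (4 / (kap * d%:R) * q h)); last by rewrite lerDl sumr_ge0.
      rewrite mulrAC ler_pdivlMr ?mulr_gt0//; lra.
    case: forallP => [_|/forallP]; first by rewrite addr_ge0// sumr_ge0.
    rewrite negb_forall => /existsP[x]; rewrite -ltNge => tz.
    apply: ler_wpDl => //.
    rewrite (bigD1 x)//=; apply: ler_wpDr; first by rewrite sumr_ge0.
    rewrite mulrDr -!expRD.
    have t0 : 0 <= t by exact: sqrtr_ge0.
    move: tz; rewrite lter_normr => /orP[tz|tz].
      apply: ler_wpDr; first exact: expR_ge0.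
      by rewrite -[leLHS]expR0 ler_expR; nra.
    apply: ler_wpDl; first exact: expR_ge0.
    by rewrite -[leLHS]expR0 ler_expR; nra.
  apply: le_trans (le_avg bad_le) _.
  rewrite avgD avgZ [X in _ + X]avg_sum.
  (* Markov leaves 8 k0 / kap, which the factor 40^2 of [kap_large] makes at most 1/200. *)
  have h1 : 4 / (kap * d%:R) * avg q <= 200^-1.
    rewrite mulrAC ler_pdivrMr ?mulr_gt0//.
    have := avg_psign_quad_le; rewrite -/q => h.
    have : 40 ^+ 2 * k0 * d%:R <= kap * d%:R by rewrite ler_pM2r.
    lra.
  have h2 : \sum_x avg (fun h => expR (- (t ^+ 2 / 8)) *
      (expR (t / 8 * z h x) + expR ((- (t / 8)) * z h x))) <= 256^-1.
    apply: (@le_trans _ _ (\sum_(x < d) 2 * (d%:R ^- 10))).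
      apply: ler_sum => x _; rewrite avgZ avgD.
      have e1 := exp_z x (t / 8); have e2 := exp_z x (- (t / 8)).
      rewrite sqrrN in e2.
      have -> : 2 * d%:R ^- 10 = expR (- (t ^+ 2 / 8)) * (expR (4 * (t / 8) ^+ 2) + expR (4 * (t / 8) ^+ 2)) :> R.
        rewrite (_ : forall a : R, a + a = 2 * a); last by move=> a; ring.
        rewrite [in RHS]mulrCA -expRD; congr (_ * _).
        rewrite expr_div_n t2 -exprVn.
        have -> : - (160 * ln d%:R / 8) + 4 * (160 * ln d%:R / 8 ^+ 2) = 10%:R * (- ln d%:R) :> R by field.
        by rewrite expRM_natl expRN lnK// posrE.
      by apply: ler_wpM2l; [exact: expR_ge0|exact: lerD].
    rewrite sumr_const card_ord -[_ *+ d]mulr_natr.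
    have -> : 2 * d%:R ^- 10 * d%:R = 2 * d%:R ^- 9 :> R by field; rewrite gt_eqF.
    have d9 : 2 ^+ 9 <= d%:R ^+ 9 :> R by rewrite lerXn2r ?nnegrE ?ler_nat.
    have dv : (d%:R ^+ 9)^-1 <= (2 ^+ 9)^-1 :> R by rewrite lef_pV2 ?posrE ?exprn_gt0.
    have e9 : 2 ^+ 9 = 512 :> R by ring.
    by move: dv; rewrite e9; lra.
  apply: (@le_trans _ _ (200^-1 + 256^-1)); last by lra.
  exact: lerD h1 h2.
- move=> h /andP[qh /forallP zh]; split => [|x]; last exact: zh.
  have := resolvent_dot_ge Ksym kap0 Kpsd UE (psign R h); rewrite -/(q h).
  have := psign_sqr_ge R h d2.
  have -> : \sum_x psign R h x ^+ 2 = dotf (psign R h) (psign R h) by [].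
  have : kap^-1 * q h <= d%:R / 4.
    by rewrite mulrC ler_pdivrMr// mulrC; lra.
  have : dotf (mulf U (psign R h)) (psign R h) <= \sum_x `|z h x|.
    apply: ler_sum => x _; apply: le_trans (ler_norm _) _; rewrite normrM.
    by rewrite -[leRHS]mulr1 ler_wpM2l// norm_psign_le1.
  lra.
(* By symmetry of U the bilinear form is the inner product of [psign R h] with [b]: for fixed h' a
   Rademacher sum in h. *)
- move=> h' s; pose b := mulf U (mulf K (z h')).
  rewrite (eq_avg (G := fun h => expR (rad (enum 'I_d)
    (fun j => s * \sum_x pairing R j x * b x) h))); last first.
    move=> h; congr expR; rewrite /z -(dotf_mulf _ _ Usym) -/(z h') -/b.
    rewrite /dotf psign_dot /rad mulr_sumr.
    by apply: eq_bigr => j _; rewrite mulrA.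
  apply: le_trans (avg_exp_rad _ (enum_uniq _)) _.
  rewrite ler_expR big_enum/=; under eq_bigr do rewrite exprMn.
  rewrite -mulr_sumr.
  have h1 := pairing_sqr_le b.
  have h2 := resolvent_UKU_le kap0 Kpsd UE (psign R h').
  rewrite -/(z h') -/b in h2.
  have h3 : dotf (psign R h') (psign R h') <= d%:R.
    rewrite -[leRHS]mulr1 mulr_natl -[in leRHS](card_ord d) -sumr_const.
    apply: ler_sum => x _; have := norm_psign_le1 R h' x.
    by rewrite ler_norml => /andP[*]; nra.
  have h4 : \sum_j (\sum_x pairing R j x * b x) ^+ 2 <= 2 * (kap ^+ 2 * d%:R).
    apply: (le_trans h1); rewrite ler_pM2l//; apply: (le_trans h2).
    by rewrite ler_wpM2l ?sqr_ge0.
  have := ler_wpM2l (sqr_ge0 s) h4; lra.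
Qed.

End prior.

(** * Chi-square bound for non-interactive protocols *)

Section NI_induction.
Context (R : realType) (d : nat) (dT : measure_display) (T : measurableType dT).
Context (n1 n2 : nat) (QX QY : chan R d T) (eps : R).
Hypothesis (len : (n1 <= n2)%N) (mech : LDP_mech n1 n2 eps QX QY).
Hypothesis NI : non_interactive QX QY.
Context (V : finType) (p0 : 'I_d -> R) (u : V -> 'I_d -> R).
Hypothesis (pp0 : pmf p0) (pu : forall v, pmf (fun x => p0 x + u v x)).
Context (r : nat -> 'I_d -> T -> R).
Let Q0 l x := QX l x [::] [::].
Hypothesis rP : forall l, [/\ forall x, bdm (r l x) /\ forall t, 0 <= r l x t,
    forall t, \sum_(x < d) p0 x * r l x t = 1,
    forall x t, `|r l x t - 1| <= 32 * eps &
    forall p f, bdm f ->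
      step (Q0 l) p f = step (Q0 l) p0 (fun t => (\sum_(x < d) p x * r l x t) * f t)].

Definition dens v l t : R := \sum_(x < d) (p0 x + u v x) * r l x t.
(** Correlation of the likelihood ratios of two alternatives at round [l]; its product over the
    rounds is one term of the chi-square integral. *)
Definition gram l v v' : R := step (Q0 l) p0 (fun t => dens v l t * dens v' l t).
Definition cov l x y : R :=
  step (Q0 l) p0 (fun t => (r l x t - 1) * (r l y t - 1)).

Lemma bdm_r l x : bdm (r l x).
Proof. by have [/(_ x)[]] := rP l. Qed.

Lemma bdm_r1 l x : bdm (fun t => r l x t - 1).
Proof. by apply: bdmB; [exact: bdm_r|exact: bdm_cst]. Qed.

Lemma bdm_dens v l : bdm (dens v l).
Proof. by apply: bdm_sum => x; apply/bdmZ/bdm_r. Qed.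

Lemma gram_ge0 l v v' : 0 <= gram l v v'.
Proof.
have dens0 v0 t : 0 <= dens v0 l t.
  apply: sumr_ge0 => x _; have [/(_ x)[_ r0] _ _ _] := rP l.
  by rewrite mulr_ge0// (pu v0).1.
rewrite -[leLHS](step_cst (Q0 l) 0 pp0); apply: le_step => //.
- exact: bdm_cst.
- by apply: bdmM; exact: bdm_dens.
- by move=> t; rewrite mulr_ge0.
Qed.

Lemma cov_sym l x y : cov l x y = cov l y x.
Proof. by apply: eq_step => t; rewrite mulrC. Qed.

Lemma cov_bilinear l a b : dotf a (mulf (cov l) b) =
  step (Q0 l) p0 (fun t => (\sum_x a x * (r l x t - 1)) * (\sum_x b x * (r l x t - 1))).
Proof.
have bx x y : bdm (fun t => (r l x t - 1) * (r l y t - 1)) by apply: bdmM; exact: bdm_r1.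
rewrite (@eq_step _ _ _ _ _ _ _ (fun t => \sum_x \sum_y
  a x * (b y * ((r l x t - 1) * (r l y t - 1))))); last first.
  move=> t; rewrite mulr_suml; apply: eq_bigr => x _.
  by rewrite mulr_sumr; apply: eq_bigr => y _; ring.
rewrite step_sum; last by move=> x; apply: bdm_sum => y; apply: bdmZ; exact: bdmZ.
apply: eq_bigr => x _; rewrite step_sum; last by move=> y; apply: bdmZ; exact: bdmZ.
rewrite mulr_sumr; apply: eq_bigr => y _.
rewrite (stepZ _ _ _ (bdmZ _ (bx x y))) (stepZ _ _ _ (bx x y)).
by rewrite -/(cov l x y) [b y * _]mulrC.
Qed.

Lemma cov_psd l a : 0 <= dotf a (mulf (cov l) a).
Proof.
rewrite cov_bilinear -[leLHS](step_cst (Q0 l) 0 pp0).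
have bs : bdm (fun t => \sum_x a x * (r l x t - 1)).
  by apply: bdm_sum => x; apply/bdmZ/bdm_r1.
apply: le_step => //; [exact: bdm_cst|exact: bdmM|].
by move=> t; rewrite -expr2 sqr_ge0.
Qed.

Lemma cov_bound l x y : `|cov l x y| <= (32 * eps) ^+ 2.
Proof.
have bx : bdm (fun t => (r l x t - 1) * (r l y t - 1)) by apply: bdmM; exact: bdm_r1.
have [_ _ rb _] := rP l.
rewrite ler_norml; apply: step_bounds => // t.
by rewrite -ler_norml normrM expr2 ler_pM.
Qed.

(** The p0-mixture of the densities is identically 1. For uniform [p0] the columns of the kernel
    then sum to 0, so the resolvent preserves zero-sum vectors. *)
Lemma cov_sum0 l y : \sum_x p0 x * cov l x y = 0.
Proof.
have bx x : bdm (fun t => (r l x t - 1) * (r l y t - 1)) by apply: bdmM; exact: bdm_r1.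
have [_ r1 _ _] := rP l.
under eq_bigr do rewrite -stepZ//.
rewrite -step_sum => [|x]; last exact: bdmZ.
rewrite (@eq_step _ _ _ _ _ _ _ (fun=> 0)) ?step_cst// => t.
rewrite (eq_bigr (fun x => (p0 x * r l x t - p0 x) * (r l y t - 1))); last first.
  by move=> x _; ring.
by rewrite -mulr_suml sumrB r1 pp0.2 subrr mul0r.
Qed.

Lemma gramE l v v' : gram l v v' = 1 + dotf (u v) (mulf (cov l) (u v')).
Proof.
have [_ r1 _ rE] := rP l.
have dE v0 t : dens v0 l t = 1 + \sum_x u v0 x * (r l x t - 1).
  under [in RHS]eq_bigr do rewrite mulrBr mulr1.
  rewrite sumrB (pmf_sum_diff pp0 pu) subr0 -(r1 t) -big_split/=.
  by apply: eq_bigr => x _; rewrite mulrDl.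
have bs v0 : bdm (fun t => \sum_x u v0 x * (r l x t - 1)).
  by apply: bdm_sum => x; apply/bdmZ/bdm_r1.
have s0 v0 : step (Q0 l) p0 (fun t => \sum_x u v0 x * (r l x t - 1)) = 0.
  have := rE (fun x => p0 x + u v0 x) (fun=> 1) (bdm_cst _ _).
  rewrite step_cst// (@eq_step _ _ _ _ _ _ _ (fun t => 1 + \sum_x u v0 x * (r l x t - 1))).
    by rewrite stepD ?step_cst//; [lra|exact: bdm_cst].
  by move=> t; rewrite mulr1 -dE.
rewrite /gram (@eq_step _ _ _ _ _ _ _ (fun t => 1 + ((\sum_x u v x * (r l x t - 1)) +
   ((\sum_x u v' x * (r l x t - 1)) +
   (\sum_x u v x * (r l x t - 1)) * (\sum_x u v' x * (r l x t - 1)))))); last first.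
  by move=> t; rewrite !dE; ring.
have b1 := bdmM (bs v) (bs v').
have b2 := bdmD (bs v') b1.
rewrite (stepD _ _ (bdm_cst _ _) (bdmD (bs v) b2)) step_cst//.
by rewrite (stepD _ _ (bs v) b2) (stepD _ _ (bs v') b1) !s0 !add0r cov_bilinear.
Qed.

Context (g : seq T -> seq T -> R) (M : R).
Hypothesis hg : hbdm n1 n2 0 M g.
Let g2 z w := g z w ^+ 2.
Let mQ := LDP_mech_measurable mech.

Lemma hbdm_sqr : hbdm n1 n2 0 (M ^+ 2) g2.
Proof.
split => [|z w]; last first.
  by have /andP[h1 h2] := hg.2 z w; rewrite sqr_ge0/= /g2 lerXn2r// nnegrE (le_trans h1).
by apply: measurable_funX; exact: hg.1.
Qed.

Lemma rphase2_sqr_ge k j (z : n1.-tuple T) (w : j.-tuple T) (c : R) :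
  (n1 <= j)%N -> (j + k)%N = n2 ->
  2 * c * rphase2 QY p0 g k z w <= rphase2 QY p0 g2 k z w + c ^+ 2.
Proof.
move=> lenj jkn.
have h (z' : n1.-tuple T) (w' : n2.-tuple T) : 2 * c * g z' w' + -1 * g2 z' w' <= c ^+ 2.
  by have := sqr_ge0 (g z' w' - c); rewrite /g2; nra.
have := rphase2_lin_le mQ len pp0 (lexx 0) (lexx 0) hg hbdm_sqr h z w lenj jkn.
lra.
Qed.

(** The chi-square argument with Cauchy-Schwarz replaced by 2 c g <= g^2 + c^2 at the leaves. The
    weights [c] are arbitrary because the induction multiplies them by the densities of the answer
    just given; integrating that answer out produces one more factor [gram]. The later factors come
    out of the integral since they do not depend on the past. *)
Lemma rphase1_sqr_ge k i (z w : i.-tuple T) (c : V -> R) : (i + k)%N = n1 ->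
  2 * \sum_v c v * rphase1 QX QY (fun x => p0 x + u v x) p0 g (n2 - n1) k z w <=
  rphase1 QX QY p0 p0 g2 (n2 - n1) k z w +
  \sum_v \sum_v' c v * c v' * \prod_(i <= l < i + k) gram l v v'.
Proof.
elim: k i z w c => [|k IHk] i z w c.
  rewrite addn0 => i1; subst i => /=.
  under eq_bigr do rewrite mulrC.
  rewrite -mulr_sumr mulrCA mulrC.
  apply: le_trans (rphase2_sqr_ge _ _ _ _ _) _; [lia|lia|].
  rewrite lerD2l expr2 mulr_suml; apply: ler_sum => v _.
  rewrite mulr_sumr; apply: ler_sum => v' _.
  by rewrite big_geq// mulr1.
move=> ikn /=; have ikn' : (i.+1 + k)%N = n1 by lia.
pose G v := rphase1 QX QY (fun x => p0 x + u v x) p0 g (n2 - n1) k.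
pose G2 := rphase1 QX QY p0 p0 g2 (n2 - n1) k.
have hG v := hbdm_rphase1 mQ (pu v) pp0 (lexx 0) hg len ikn'.
have hG2 := hbdm_rphase1 mQ pp0 pp0 (lexx 0) hbdm_sqr len ikn'.
set qy := fun y => QY (size w) y z w.
have qxE : (fun x => QX (size z) x z w) = Q0 i.
  by apply/funext => x; rewrite size_tuple; exact: NI.1.
rewrite qxE.
pose f v s := step qy p0 (fun t => G v (rcons z s) (rcons w t)).
pose f2 s := step qy p0 (fun t => G2 (rcons z s) (rcons w t)).
have bf v : bdm (f v) by exact: hbdm_bdm1_step (hG v).
have bf2 : bdm f2 by exact: hbdm_bdm1_step hG2.
pose W v v' : R := \prod_(i.+1 <= l < i.+1 + k) gram l v v'.
have [_ _ _ rE] := rP i.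
have bdf v : bdm (fun s => dens v i s * f v s) by apply: bdmM => //; exact: bdm_dens.
have bdd v v' : bdm (fun s => dens v i s * dens v' i s) by apply: bdmM; exact: bdm_dens.
have -> : 2 * \sum_v c v * step (Q0 i) (fun x => p0 x + u v x) (f v) =
    step (Q0 i) p0 (fun s => 2 * \sum_v (c v * dens v i s) * f v s).
  rewrite stepZ; last by apply: bdm_sum => v0; apply: bdmM => //; apply/bdmZ/bdm_dens.
  congr (_ * _); rewrite step_sum; last by move=> v; apply: bdmM => //; apply/bdmZ/bdm_dens.
  apply: eq_bigr => v _; rewrite rE// -stepZ; last exact: bdf.
  by apply: eq_step => s; rewrite mulrA.
have bWW : bdm (fun s => \sum_v \sum_v' (c v * c v' * W v v') * (dens v i s * dens v' i s)).
  by apply: bdm_sum => v0; apply: bdm_sum => v1; exact: bdmZ.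
have -> : \sum_v \sum_v' c v * c v' * \prod_(i <= l < i + k.+1) gram l v v' =
    step (Q0 i) p0 (fun s => \sum_v \sum_v' (c v * c v' * W v v') * (dens v i s * dens v' i s)).
  rewrite step_sum; last by move=> v0; apply: bdm_sum => v1; exact: bdmZ.
  apply: eq_bigr => v _; rewrite step_sum; last by move=> v'; exact: bdmZ.
  apply: eq_bigr => v' _; rewrite stepZ//.
  by rewrite big_ltn ?addnS ?ltnS ?leq_addr// -addSn -/(W v v') -/(gram i v v'); ring.
rewrite -stepD//; apply: le_step => //.
- by apply/bdmZ/bdm_sum => v; apply: bdmM => //; apply/bdmZ/bdm_dens.
- exact: bdmD.
move=> s.
have bG v : bdm (fun t => G v (rcons z s) (rcons w t)) by exact: hbdm_bdm1 (hG v).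
have bG2 : bdm (fun t => G2 (rcons z s) (rcons w t)) by exact: hbdm_bdm1 hG2.
have -> : 2 * \sum_v (c v * dens v i s) * f v s =
    step qy p0 (fun t => 2 * \sum_v (c v * dens v i s) * G v (rcons z s) (rcons w t)).
  rewrite stepZ; last by apply: bdm_sum => v; exact: bdmZ.
  congr (_ * _); rewrite step_sum; last by move=> v; exact: bdmZ.
  by apply: eq_bigr => v _; rewrite stepZ.
set E := \sum_v \sum_v' _.
rewrite -[E](step_cst qy _ pp0) -stepD//; last exact: bdm_cst.
apply: le_step => //.
- by apply/bdmZ/bdm_sum => v; exact: bdmZ.
- by apply: bdmD => //; exact: bdm_cst.
move=> t.
apply: le_trans (IHk i.+1 [tuple of rcons z s] [tuple of rcons w t] (fun v => c v * dens v i s) ikn') _.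
rewrite lerD2l le_eqVlt; apply/orP; left; apply/eqP.
apply: eq_bigr => v _; apply: eq_bigr => v' _.
rewrite -/(W v v'); ring.
Qed.

End NI_induction.

Lemma pmf_uniform (R : realType) (d : nat) : (0 < d)%N ->
  pmf (fun _ : 'I_d => d%:R^-1 : R).
Proof.
move=> d0; split => [x|]; first by rewrite invr_ge0.
by rewrite sumr_const card_ord -[_ *+ _]mulr_natl divff// pnatr_eq0 -lt0n.
Qed.

Section NI_test.
Context (R : realType) (d : nat) (dT : measure_display) (T : measurableType dT).
Context (n1 n2 : nat) (QX QY : chan R d T) (eps : R).
Hypothesis (e01 : 0 < eps <= 1) (n10 : (0 < n1)%N) (len : (n1 <= n2)%N).
Hypothesis mech : LDP_mech n1 n2 eps QX QY.
Hypothesis NI : non_interactive QX QY.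
Context (phi : seq T -> seq T -> R).
Hypothesis test : rand_test n1 n2 phi.
Hypothesis d2 : (2 <= d)%N.
Context (alpha beta delta : R).
Hypothesis (ab : alpha + beta <= 1 / 2) (a0 : 0 < alpha) (b0 : 0 < beta).
Let p0 (_ : 'I_d) : R := d%:R^-1.
Let kap : R := 40 ^+ 2 * (n1%:R * (32 * eps) ^+ 2).
Hypothesis delta0 : 0 <= delta.
Hypothesis delta_small : 4 * (delta ^+ 2) ^+ 2 * kap ^+ 2 * d%:R <= 20^-1.
Hypothesis delta_range : delta * Num.sqrt (160 * ln d%:R) <= d%:R^-1.

Hypothesis lev : rrej n1 n2 QX QY phi p0 p0 <= alpha.
Hypothesis pow : forall v : 'I_d -> R, pmf (fun x => p0 x + delta * v x) ->
  d%:R / 4 <= \sum_x `|v x| ->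
  1 - rrej n1 n2 QX QY phi (fun x => p0 x + delta * v x) p0 <= beta + 100^-1.

(** Equal weights and g = 1 + phi give 2 (2 - beta - 2/100) <= 1 + 3 alpha + X with X <= 11/10 +
    2/100, that is 46/25 <= 3 alpha + 2 beta, impossible as alpha + beta <= 1/2. With g = phi the
    same computation gives no contradiction for beta near 1/2. *)
Lemma NI_test_contradiction : False.
Proof.
have pp0 : pmf p0 := pmf_uniform R (ltnW d2).
have [_ _ ldpX _] := mech.
have /choice[r rP] := fun l => exists_LDP_density (Q := fun x => QX l x [::] [::]) e01 pp0
  (fun x x' S mS => ldpX l x x' [::] [::] S mS).
pose K x y : R := \sum_(l < n1) cov QX p0 r l x y.
have KE a b : dotf a (mulf K b) = \sum_(l < n1) dotf a (mulf (cov QX p0 r l) b).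
  rewrite /dotf exchange_big/=; apply: eq_bigr => x _.
  rewrite -mulr_sumr; congr (_ * _); rewrite /mulf exchange_big/=.
  by apply: eq_bigr => y _; rewrite mulr_suml.
have Ksym x y : K x y = K y x by apply: eq_bigr => l _; exact: cov_sym.
have e0 : 0 < eps by case/andP: e01.
have kap0 : 0 < kap by rewrite !mulr_gt0 ?exprn_gt0 ?mulr_gt0 ?ltr0n.
have Kpsd a : 0 <= dotf a (mulf K a).
  by rewrite KE; apply: sumr_ge0 => l _; exact: (cov_psd pp0 rP).
have Kbound x y : `|K x y| <= n1%:R * (32 * eps) ^+ 2.
  apply: le_trans (ler_norm_sum _ _ _) _.
  rewrite mulr_natl -[in leRHS](card_ord n1) -sumr_const.
  by apply: ler_sum => l _; exact: (cov_bound pp0 rP).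
have dR0 : 0 < d%:R :> R by rewrite ltr0n; lia.
have Ksum0 y : \sum_x K x y = 0.
  rewrite exchange_big/= big1// => l _.
  have := cov_sum0 pp0 rP l y; rewrite -mulr_sumr => /eqP.
  by rewrite mulf_eq0 invr_eq0 gt_eqF//= => /eqP.
have [z [good [z0 zbad zgood zexp]]] := exists_prior Ksym kap0 Kpsd Ksum0 Kbound (lexx kap) d2.
(* A bad sign vector contributes the null law itself, so that every alternative is a probability
   vector; the cost is 1/100 in [hB] and 2/100 in [hX]. *)
pose v h x := if good h then z h x else 0.
pose u h x := delta * v h x.
have pu h : pmf (fun x => p0 x + u h x).
  split => [x|].
    rewrite /u /v; case: ifPn => [/zgood[_ /(_ x)]|_]; last by rewrite mulr0 addr0 invr_ge0.
    move=> zx; have : delta * `|z h x| <= d%:R^-1.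
      by apply: le_trans delta_range; rewrite ler_wpM2l.
    have : - (delta * `|z h x|) <= delta * z h x.
      by rewrite -mulrN ler_wpM2l// lerNl -normrN ler_norm.
    by rewrite /p0; lra.
  rewrite big_split/= pp0.2 -mulr_sumr /v; case: (good h); first by rewrite z0 mulr0 addr0.
  by rewrite big1 ?mulr0 ?addr0.
pose g z w := 1 + phi z w.
have hphi := rand_test_hbdm test.
have hg : hbdm n1 n2 0 2 g.
  split => [|zz w]; last by have /andP[h1 h2] := hphi.2 zz w; rewrite /g; apply/andP; split; lra.
  by apply: measurable_funD => //; exact: hphi.1.
have mQ := LDP_mech_measurable mech.
pose N : R := #|{: signs d}|%:R.
have N0 : 0 < N by rewrite ltr0n card_signs.
have := rphase1_sqr_ge len mech NI pp0 pu rP hg (i := 0) [tuple] [tuple] (fun=> N^-1) (add0n _).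
rewrite -mulr_sumr -/(avg _).
set B := avg _; set A2 := rphase1 _ _ _ _ _ _ _ _ _; set X := \sum_h _ => main.
have hA2 : A2 <= 1 + 3 * alpha.
  have h (z' : n1.-tuple T) (w' : n2.-tuple T) : 1 * g z' w' ^+ 2 + - 3 * phi z' w' <= 1.
    by have /andP[h1 h2] := hphi.2 z' w'; rewrite /g; nra.
  have := rphase1_lin_le mQ len pp0 pp0 (lexx 0) (lexx 0) (hbdm_sqr hg) hphi h (i := 0) [tuple] [tuple] (add0n _).
  by move: lev; rewrite /rrej -/A2 /=; lra.
have hB : 1 + (1 - beta - 2 / 100) <= B.
  have hBv h : 1 + (1 - beta - 100^-1) - (~~ good h)%:R <=
      rphase1 QX QY (fun x => p0 x + u h x) p0 g (n2 - n1) n1 [::] [::].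
    have h1 (z' : n1.-tuple T) (w' : n2.-tuple T) : - 1 * g z' w' + 1 * phi z' w' <= - 1.
      by rewrite /g; lra.
    have := rphase1_lin_le mQ len (pu h) pp0 (lexx 0) (lexx 0) hg hphi h1 (i := 0) [tuple] [tuple] (add0n _).
    have h2 : 0 <= rphase1 QX QY (fun x => p0 x + u h x) p0 phi (n2 - n1) n1 [::] [::].
      have := hbdm_rphase1 mQ (pu h) pp0 (lexx 0) hphi len (i := 0) (add0n _).
      by case=> _ /(_ [tuple] [tuple]) /andP[].
    case: (boolP (good h)) => /= gh; last by move: b0; lra.
    have : 1 - rrej n1 n2 QX QY phi (fun x => p0 x + delta * z h x) p0 <= beta + 100^-1.
      apply: pow; last by have [] := zgood h gh.
      by have := pu h; rewrite /u /v gh.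
    by rewrite /rrej /u /v gh; lra.
  have := le_avg hBv; rewrite -/B.
  rewrite avgD avg_cst ?card_signs//.
  rewrite (eq_avg (G := fun h => -1 * (~~ good h)%:R)) => [|h]; last by rewrite mulN1r.
  by rewrite avgZ; lra.
have hX : X <= 11 / 10 + 2 / 100.
  pose H h h' := delta ^+ 2 * dotf (v h) (mulf K (v h')).
  have prod_le h h' : \prod_(0 <= l < 0 + n1) gram QX p0 u r l h h' <= expR (H h h').
    rewrite /H KE mulr_sumr expR_sum add0n big_mkord.
    apply: ler_prod => l _; rewrite (gram_ge0 pp0 pu rP)/= (gramE pp0 pu rP).
    apply: le_trans (expR_ge1Dx _) _; rewrite ler_expR le_eqVlt; apply/orP; left; apply/eqP.
    rewrite /dotf mulr_sumr; apply: eq_bigr => x _.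
    rewrite /mulf !mulr_sumr; apply: eq_bigr => y _; rewrite /u; ring.
  have H_le h h' : expR (H h h') <=
      expR (delta ^+ 2 * dotf (z h) (mulf K (z h'))) + ((~~ good h)%:R + (~~ good h')%:R).
    have e0' := expR_ge0 (delta ^+ 2 * dotf (z h) (mulf K (z h'))).
    rewrite /H; case: (boolP (good h)) => gh; last first.
      have -> : dotf (v h) (mulf K (v h')) = 0.
        by rewrite /dotf big1// => x _; rewrite /v (negbTE gh) mul0r.
      by rewrite mulr0 expR0/=; case: (good h') => /=; lra.
    case: (boolP (good h')) => gh' /=; last first.
      have -> : dotf (v h) (mulf K (v h')) = 0.
        rewrite /dotf big1// => x _; rewrite /mulf big1 ?mulr0// => y _.
        by rewrite /v (negbTE gh') mulr0.
      by rewrite mulr0 expR0; lra.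
    by rewrite !addr0 /v gh gh'.
  have XE : X = avg (fun h' => avg (fun h => \prod_(0 <= l < 0 + n1) gram QX p0 u r l h h')).
    rewrite /X /avg exchange_big/= mulr_sumr; apply: eq_bigr => h' _.
    rewrite !mulr_sumr; apply: eq_bigr => h _; by rewrite mulrA.
  rewrite XE.
  apply: (@le_trans _ _ (avg (fun h' => 11 / 10 + (100^-1 + (~~ good h')%:R)))).
    apply: le_avg => h'.
    apply: le_trans (le_avg (fun h => le_trans (prod_le h h') (H_le h h'))) _.
    rewrite avgD avgD avg_cst ?card_signs// lerD ?lerD2r//.
    apply: le_trans (zexp h' _) _.
    set y := 4 * _ * _ * _.
    have y0 : y <= 20^-1 by exact: delta_small.
    (* For y <= 1/20 this gives exp y <= 20/19 <= 11/10. *)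
    have h1 : 1 - y <= expR (- y) by apply: le_trans (expR_ge1Dx _); lra.
    have := expRxMexpNx_1 y; have := expR_gt0 y; nra.
  rewrite avgD avgD !avg_cst ?card_signs//; lra.
move: main hA2 hB hX ab a0 b0; lra.
Qed.

End NI_test.

(** * Lower bounds on the radius *)

Section power_mean.
Context (R : realType) (d : nat).
Implicit Types (f : 'I_d -> R) (a b : 'I_d -> R).

(** Young's inequality for the product x * 1; at r = 1 the conjugate exponent would be infinite. *)
Lemma bernoulli_powR (x r : R) : 0 <= x -> 1 <= r -> x <= x `^ r / r + (1 - r^-1).
Proof.
move=> x0; rewrite le_eqVlt => /predU1P[<-|r1].
  by rewrite powRr1// divr1 invr1 subrr addr0.
have r0 : 0 < r by lra.
pose q := r / (r - 1).
have q0 : 0 < q by rewrite divr_gt0//; lra.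
have rq : r^-1 + q^-1 = 1 by rewrite /q invf_div; field; rewrite gt_eqF.
have := conjugate_powR x0 ler01 r0 q0 rq.
by rewrite mulr1 powR1 div1r; lra.
Qed.

Lemma powRV (x r : R) : 0 <= x -> x^-1 `^ r = (x `^ r)^-1.
Proof. by move=> x0; rewrite -[x^-1]powR_inv1// powRAC powR_inv1// powR_ge0. Qed.

(** Normalise by the r-th power mean [m]; then [bernoulli_powR], applied to each f x / m, sums to
    exactly d on the right. *)
Lemma power_mean f (r : R) : (0 < d)%N -> (forall x, 0 <= f x) -> 1 <= r ->
  \sum_x f x <= d%:R `^ (1 - r^-1) * (\sum_x f x `^ r) `^ r^-1.
Proof.
move=> d0 f0 r1; set S := \sum_x f x `^ r.
have r0 : 0 < r by lra.
have dR0 : 0 < d%:R :> R by rewrite ltr0n.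
have S0 : 0 <= S by apply: sumr_ge0 => x _; exact: powR_ge0.
have [SE|Sn0] := eqVneq S 0.
  rewrite big1 ?mulr_ge0 ?powR_ge0// => x _.
  have fx : f x `^ r = 0 by apply: (psumr_eq0P (fun x _ => powR_ge0 (f x) r) SE).
  exact: powR_eq0_eq0 fx.
have {Sn0}Sp : 0 < S by rewrite lt0r Sn0.
pose m := (S / d%:R) `^ r^-1.
have m0 : 0 < m by rewrite powR_gt0// divr_gt0.
have mr : m `^ r = S / d%:R by rewrite /m -powRrM mulVf ?gt_eqF// powRr1// divr_ge0// ltW.
have h : \sum_x f x / m <= d%:R.
  apply: (@le_trans _ _ (\sum_x ((f x / m) `^ r / r + (1 - r^-1)))).
    by apply: ler_sum => x _; apply: bernoulli_powR => //; rewrite divr_ge0// ltW.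
  rewrite big_split/= sumr_const card_ord -mulr_suml.
  have -> : \sum_x (f x / m) `^ r = d%:R.
    under eq_bigr do rewrite powRM// ?invr_ge0 ?(ltW m0)//.
    by rewrite -mulr_suml -/S powRV ?(ltW m0)// mr invf_div mulrCA divff ?mulr1// gt_eqF.
  have -> : (1 - r^-1) *+ d = d%:R * (1 - r^-1) by rewrite mulr_natl.
  lra.
have -> : d%:R `^ (1 - r^-1) * S `^ r^-1 = d%:R * m.
  rewrite /m powRM ?invr_ge0// ?(ltW dR0)// powRV ?(ltW dR0)//.
  have -> : d%:R `^ (1 - r^-1) = d%:R / d%:R `^ r^-1 :> R.
    by rewrite powRB ?powRr1 ?(ltW dR0)//; apply/implyP => _; rewrite gt_eqF.
  by rewrite mulrAC mulrA.
by rewrite -ler_pdivrMr// mulr_suml.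
Qed.

Lemma Lp_dist_ge_L1 (p : R) a b : (0 < d)%N -> 1 <= p ->
  d%:R `^ (p^-1 - 1) * \sum_x `|a x - b x| <= Lp_dist p a b.
Proof.
move=> d0 p1; have dR0 : 0 < d%:R :> R by rewrite ltr0n.
have h := power_mean d0 (fun x => normr_ge0 (a x - b x)) p1.
have -> : p^-1 - 1 = - (1 - p^-1) by ring.
by rewrite powRN mulrC ler_pdivrMr ?powR_gt0// mulrC.
Qed.

(** The power mean inequality for |a - b|^p with exponent 2 / p. *)
Lemma Lp_dist_le_L2 (p : R) a b : (0 < d)%N -> 1 <= p <= 2 ->
  Lp_dist p a b <= d%:R `^ (p^-1 - 2^-1) * Num.sqrt (\sum_x (a x - b x) ^+ 2).
Proof.
move=> d0 /andP[p1 p2]; have dR0 : 0 < d%:R :> R by rewrite ltr0n.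
have p0 : 0 < p by lra.
have r1 : 1 <= 2 / p by rewrite ler_pdivlMr// mul1r.
have h := power_mean d0 (fun x => powR_ge0 `|a x - b x| p) r1.
have S0 : 0 <= \sum_x (a x - b x) ^+ 2 by apply: sumr_ge0 => x _; exact: sqr_ge0.
have e : \sum_x (`|a x - b x| `^ p) `^ (2 / p) = \sum_x (a x - b x) ^+ 2.
  apply: eq_bigr => x _; rewrite -powRrM mulrC divfK ?gt_eqF//.
  by rewrite powR_mulrn// real_normK// num_real.
rewrite e invf_div in h.
rewrite /Lp_dist.
apply: (@le_trans _ _ ((d%:R `^ (1 - p / 2) * (\sum_x (a x - b x) ^+ 2) `^ (p / 2)) `^ p^-1)).
  rewrite ge0_ler_powR ?nnegrE ?invr_ge0 ?(ltW p0)//.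
  - by apply: sumr_ge0 => x _; exact: powR_ge0.
  - by rewrite mulr_ge0// powR_ge0.
rewrite powRM ?powR_ge0// -!powRrM.
have -> : (1 - p / 2) / p = p^-1 - 2^-1 by field; rewrite gt_eqF.
have -> : p / 2 / p = 2^-1 by field; rewrite gt_eqF.
by rewrite powR12_sqrt.
Qed.

Lemma Lp_dist_ge_coord (p : R) a b x : 1 <= p -> `|a x - b x| <= Lp_dist p a b.
Proof.
move=> p1; have p0 : 0 < p by lra.
rewrite -[leLHS](@powRr1 _ `|a x - b x|)// -(divff (x := p)) ?gt_eqF// powRrM.
rewrite ge0_ler_powR ?nnegrE ?invr_ge0 ?(ltW p0) ?powR_ge0//.
  by apply: sumr_ge0 => y _; exact: powR_ge0.
by rewrite (bigD1 x)//= lerDl sumr_ge0// => y _; exact: powR_ge0.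
Qed.

End power_mean.

Section rho_star_lower.
Context (R : realType) (ni : bool) (d n1 n2 : nat) (eps p alpha beta : R).
Hypothesis (e01 : 0 < eps <= 1) (len : (n1 <= n2)%N).

(** The infimum over mechanisms in the risk need not be attained, so only a type II error of at most
    beta + 1/100 is available; the contradictions leave room for this slack. *)
Lemma rho_star_ge (rho0 : R) :
  (forall (rho : R) (dT : measure_display) (T : measurableType dT)
     (QX QY : chan R d T) (phi : seq T -> seq T -> R),
    0 < rho < rho0 -> LDP_mech n1 n2 eps QX QY ->
    (ni -> non_interactive QX QY) -> rand_test n1 n2 phi ->
    (forall P, pmf P -> rrej n1 n2 QX QY phi P P <= alpha) ->
    (forall pX pY, pmf pX -> pmf pY -> rho <= Lp_dist p pX pY ->
       1 - rrej n1 n2 QX QY phi pX pY <= beta + 100^-1) -> False) ->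
  (rho0%:E <= rho_star ni d n1 n2 eps p alpha beta)%E.
Proof.
move=> imp; apply: le_ereal_inf_tmp => _ [rho [rho_gt0 hrisk ->]].
rewrite lee_fin leNgt; apply/negP => rho_lt.
move: hrisk; rewrite /risk EFinD leeD2lE// => hinf.
have : (beta%:E < (beta + 100^-1)%:E)%E by rewrite lte_fin ltrDl.
move=> /(le_lt_trans hinf) /ereal_inf_lt[_ [dT [T [QX [QY [phi [mech hni test lev ->]]]]]] hII].
apply: (imp rho dT T QX QY phi) => //; first by rewrite rho_gt0.
  by move=> P pP; have := lev P pP; rewrite (rej_probE len mech test)// lee_fin.
move=> pX pY ppX ppY hd; rewrite -lee_fin EFinB -(rej_probE len mech test)//.
apply: le_trans (ltW hII); apply: ereal_sup_ubound.
by exists pX, pY.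
Qed.

End rho_star_lower.

Section lower_bounds.
Context (R : realType) (d n1 n2 : nat) (eps p alpha beta : R).
Hypothesis (d2 : (2 <= d)%N) (n10 : (0 < n1)%N) (len : (n1 <= n2)%N).
Hypothesis (e01 : 0 < eps <= 1) (p12 : 1 <= p <= 2).
Hypothesis (a0 : 0 < alpha) (b0 : 0 < beta) (ab : alpha + beta <= 1 / 2).

Context (c : R).
Hypothesis cE : c = (200 * 200)^-1.
Let N : R := Num.sqrt (n1%:R * eps ^+ 2).
Let D : R := d%:R `^ p^-1.

Let c0 : 0 < c. Proof. by rewrite cE; lra. Qed.
Let e0 : 0 < eps. Proof. by case/andP: e01. Qed.
Let nR0 : 0 < n1%:R :> R. Proof. by rewrite ltr0n. Qed.
Let d0 : (0 < d)%N := ltnW d2.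
Let dR0 : 0 < d%:R :> R. Proof. by rewrite ltr0n. Qed.

Let N2 : N ^+ 2 = n1%:R * eps ^+ 2.
Proof. by rewrite sqr_sqrtr// mulr_ge0// ?sqr_ge0// ltW. Qed.
Let N0 : 0 < N. Proof. by rewrite sqrtr_gt0 mulr_gt0// exprn_gt0. Qed.
Let D0 : 0 < D. Proof. exact: powR_gt0. Qed.
Let p1 : 1 <= p. Proof. by case/andP: p12. Qed.

Lemma powRB_pinv (s : R) : d%:R `^ (p^-1 - s) = D / d%:R `^ s.
Proof. by rewrite powRB//; apply/implyP => _; rewrite gt_eqF. Qed.

Lemma Lp_dist_shift_ge (q v : 'I_d -> R) (delta S : R) : 0 <= delta ->
  S <= \sum_x `|v x| ->
  D * delta * S / d%:R <= Lp_dist p (fun x => q x + delta * v x) q.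
Proof.
move=> delta0 hS; apply: le_trans (Lp_dist_ge_L1 _ _ d0 p1).
rewrite powRB_pinv powRr1 ?(ltW dR0)//.
have -> : \sum_x `|q x + delta * v x - q x| = delta * \sum_x `|v x|.
  rewrite mulr_sumr; apply: eq_bigr => x _.
  by rewrite addrC addKr normrM ger0_norm.
have -> : D * delta * S / d%:R = D / d%:R * (delta * S) by ring.
by apply: ler_wpM2l; [rewrite divr_ge0 ?ltW|apply: ler_wpM2l].
Qed.

Lemma rho_NI_ge :
  ((c * Num.min (d%:R `^ (p^-1 - 4^-1) / N)
     (1 / (d%:R `^ (1 - p^-1) * Num.sqrt (ln d%:R))))%:E
   <= rho_NI d n1 n2 eps p alpha beta)%E.
Proof.
set rho0 := c * _.
have lnd0 : 0 < ln (d%:R : R) by rewrite ln_gt0// ltr1n.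
pose L := Num.sqrt (ln d%:R : R).
have L0 : 0 < L by rewrite sqrtr_gt0.
pose r4 := d%:R `^ 4^-1 : R.
have r40 : 0 < r4 by exact: powR_gt0.
have r44 : d%:R = r4 ^+ 4.
  by rewrite -powR_mulrn ?(ltW r40)// /r4 -powRrM mulVf// powRr1// ltW.
have rho0_gt0 : 0 < rho0.
  rewrite mulr_gt0// lt_min !divr_gt0 ?powR_gt0//.
  by rewrite mulr_gt0 ?powR_gt0.
have rho0A : rho0 <= c * (D / r4 / N).
  by rewrite ler_pM2l// ge_min powRB_pinv lexx.
have rho0B : rho0 <= c * (D / (d%:R * L)).
  rewrite ler_pM2l// ge_min; apply/orP; right.
  have -> : 1 - p^-1 = - (p^-1 - 1) by ring.
  rewrite powRN powRB_pinv powRr1 ?(ltW dR0)// div1r invfM invrK.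
  by rewrite invfM mulrA.
(* A good perturbation has L1 norm at least delta d / 4, hence Lp norm at least D delta / 4 =
   [rho0]. *)
clearbody rho0; pose delta := 4 * rho0 / D.
have delta_gt0 : 0 < delta by rewrite divr_gt0// mulr_gt0.
have hA : delta * r4 * N <= 4 * c.
  have : rho0 * (r4 * N) <= c * D.
    by rewrite -ler_pdivlMr ?mulr_gt0// (le_trans rho0A)// invfM !mulrA.
  have -> : delta * r4 * N = 4 * (rho0 * (r4 * N)) / D by rewrite /delta; ring.
  by rewrite ler_pdivrMr//; lra.
have hB : delta * d%:R * L <= 4 * c.
  have : rho0 * (d%:R * L) <= c * D.
    by rewrite -ler_pdivlMr ?mulr_gt0// (le_trans rho0B)// mulrA.
  have -> : delta * d%:R * L = 4 * (rho0 * (d%:R * L)) / D by rewrite /delta; ring.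
  by rewrite ler_pdivrMr//; lra.
apply: rho_star_ge => // rho dT T QX QY phi /andP[rho_gt0 rho_lt] mech ni test lev pow.
apply: (NI_test_contradiction e01 n10 len mech (ni isT) test d2 ab a0 b0 (ltW delta_gt0)).
(* The kernel scale is 40^2 2^10 N^2 = (1280 N)^2 with 1280 = 5 * 2^8, so the exponent is 4 (1280
   delta r4 N)^4, and [hA] bounds its base by 1280 * 4 c = 16/125 < 1/4. *)
- have -> : n1%:R * (32 * eps) ^+ 2 = 2 ^+ 10 * N ^+ 2 by rewrite N2; ring.
  rewrite r44 (_ : _ * _ = 4 * ((5 * 2 ^+ 8) * (delta * r4 * N)) ^+ 4); last by ring.
  have h4 : ((5 * 2 ^+ 8) * (delta * r4 * N)) ^+ 4 <= 4^-1 ^+ 4.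
    have x0 : 0 <= delta * r4 * N := ltW (mulr_gt0 (mulr_gt0 delta_gt0 r40) N0).
    apply: lerXn2r; rewrite ?nnegrE; [by rewrite mulr_ge0|by rewrite invr_ge0|].
    by move: hA; rewrite cE; lra.
  have e4 : 4 * 4^-1 ^+ 4 <= 20^-1 :> R by rewrite exprVn; lra.
  exact: (le_trans (ler_wpM2l (ler0n R 4) h4) e4).
- rewrite sqrtrM//.
  have h160 : Num.sqrt 160 <= 13 :> R.
    by rewrite -[leRHS]ger0_norm// -sqrtr_sqr ler_wsqrtr//; lra.
  rewrite -[leRHS]mul1r ler_pdivlMr//.
  have -> : delta * (Num.sqrt 160 * Num.sqrt (ln d%:R)) * d%:R = Num.sqrt 160 * (delta * d%:R * L).
    by rewrite /L; ring.
  have : Num.sqrt 160 * (delta * d%:R * L) <= 13 * (4 * c).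
    by apply: ler_pM => //; exact: (ltW (mulr_gt0 (mulr_gt0 delta_gt0 dR0) L0)).
  by rewrite cE; lra.
- by apply: lev; exact: pmf_uniform.
- move=> v pv hv; apply: pow => //; first exact: pmf_uniform.
  apply: le_trans (Lp_dist_shift_ge _ (ltW delta_gt0) hv).
  have -> : D * delta * (d%:R / 4) / d%:R = rho0.
    by rewrite /delta; field; rewrite !gt_eqF.
  exact: ltW.
Qed.

Lemma rho_I_ge_uniform :
  ((c * Num.min (d%:R `^ (p^-1 - 2^-1) / N) (d%:R `^ (p^-1 - 1)))%:E
   <= rho_I d n1 n2 eps p alpha beta)%E.
Proof.
set rho0 := c * _.
pose r2 := d%:R `^ 2^-1 : R.
have r20 : 0 < r2 by exact: powR_gt0.
have r22 : d%:R = r2 ^+ 2.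
  by rewrite -powR_mulrn ?(ltW r20)// /r2 -powRrM mulVf// powRr1// ltW.
have rho0_gt0 : 0 < rho0.
  by rewrite mulr_gt0// lt_min ?divr_gt0 ?powR_gt0.
have rho0A : rho0 <= c * (D / r2 / N).
  by rewrite ler_pM2l// ge_min powRB_pinv lexx.
have rho0B : rho0 <= c * (D / d%:R).
  by rewrite ler_pM2l// ge_min (powRB_pinv 1) powRr1 ?lexx ?orbT// ltW.
(* The paired signs have L1 norm at least d / 2, which makes the Lp distance at least [rho0]; the
   cap d^(1/p - 1) keeps delta below 1 / d. *)
clearbody rho0; pose delta := 2 * rho0 / D.
have delta_gt0 : 0 < delta by rewrite divr_gt0// mulr_gt0.
have hA : delta * r2 * N <= 2 * c.
  have : rho0 * (r2 * N) <= c * D.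
    by rewrite -ler_pdivlMr ?mulr_gt0// (le_trans rho0A)// invfM !mulrA.
  have -> : delta * r2 * N = 2 * (rho0 * (r2 * N)) / D by rewrite /delta; ring.
  by rewrite ler_pdivrMr//; lra.
have hB : delta * d%:R <= 2 * c.
  have : rho0 * d%:R <= c * D.
    by rewrite -ler_pdivlMr// (le_trans rho0B)// mulrA.
  have -> : delta * d%:R = 2 * (rho0 * d%:R) / D by rewrite /delta; ring.
  by rewrite ler_pdivrMr//; lra.
apply: rho_star_ge => // rho dT T QX QY phi /andP[rho_gt0 rho_lt] mech _ test lev pow.
pose p0 (_ : 'I_d) : R := d%:R^-1.
have pp0 : pmf p0 := pmf_uniform R d0.
pose u (h : signs d) x : R := delta * psign R h x.
have delta_d : delta <= d%:R^-1.
  by rewrite -[leRHS]mul1r ler_pdivlMr// (le_trans hB)// cE; lra.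
have pu h : pmf (fun x => p0 x + u h x).
  split => [x|]; last by rewrite big_split/= pp0.2 -mulr_sumr psign_sum0 mulr0 addr0.
  have := norm_psign_le1 R h x; rewrite ler_norml => /andP[h1 _].
  have : delta * -1 <= u h x by rewrite ler_pM2l.
  by rewrite /p0; move: delta_d; lra.
have sumu h a : \sum_x u h x * a x =
    delta * rad (enum 'I_d) (fun j => \sum_x pairing R j x * a x) h.
  by rewrite -psign_dot mulr_sumr; apply: eq_bigr => x _; rewrite mulrA.
have sqa a : (forall x, `|a x| <= 32 * eps) -> \sum_(x < d) a x ^+ 2 <= d%:R * (32 * eps) ^+ 2.
  move=> ha; rewrite mulr_natl -[in leRHS](card_ord d) -sumr_const.
  apply: ler_sum => x _; rewrite -[leLHS]real_normK ?num_real// lerXn2r ?nnegrE//.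
  by rewrite mulr_ge0// ltW.
have := @interactive_information_ge R d dT T n1 n2 QX QY eps e01 len mech phi test
  (signs d : finType) p0 u (delta ^+ 2 * (2 * (d%:R * (32 * eps) ^+ 2))) (card_signs d) pp0 pu.
move=> /(_ _ _ alpha beta ab a0 b0 (lev _ pp0)) key.
suff : 1 / 30 <= delta ^+ 2 * (2 * (d%:R * (32 * eps) ^+ 2)) * n1%:R.
  have -> : delta ^+ 2 * (2 * (d%:R * (32 * eps) ^+ 2)) * n1%:R = 2 ^+ 11 * (delta * r2 * N) ^+ 2.
    have -> : (delta * r2 * N) ^+ 2 = delta ^+ 2 * r2 ^+ 2 * N ^+ 2 by ring.
    by rewrite N2 -r22; ring.
  have h2 : (delta * r2 * N) ^+ 2 <= (2 * c) ^+ 2.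
    have x0 : 0 <= delta * r2 * N := ltW (mulr_gt0 (mulr_gt0 delta_gt0 r20) N0).
    by apply: lerXn2r; rewrite ?nnegrE// (le_trans x0).
  by move: h2; rewrite cE; lra.
apply: key.
- move=> h a ha; apply: le_trans (ler_norm_sum _ _ _) _.
  apply: (@le_trans _ _ (\sum_(x < d) delta * 32)).
    apply: ler_sum => x _; rewrite 2!normrM (ger0_norm (ltW delta_gt0)) -mulrA.
    rewrite ler_pM2l//; apply: (@le_trans _ _ (1 * (32 * eps))).
      by apply: ler_pM => //; exact: norm_psign_le1.
    by case/andP: e01; lra.
  rewrite sumr_const card_ord -[_ *+ _]mulr_natr mulrAC.
  by have := ler_wpM2r (ler0n R 32) hB; rewrite cE; lra.
- move=> a ha; rewrite (eq_avg (G := fun h => delta ^+ 2 *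
      (rad (enum 'I_d) (fun j => \sum_x pairing R j x * a x) h *
       rad (enum 'I_d) (fun j => \sum_x pairing R j x * a x) h))); last first.
    by move=> h; rewrite sumu exprMn expr2.
  rewrite avgZ avg_rad2 ?enum_uniq// big_enum/= ler_pM2l ?exprn_gt0//.
  under eq_bigr do rewrite -expr2.
  apply: le_trans (pairing_sqr_le a) _.
  by rewrite ler_pM2l//; exact: sqa.
- move=> h; apply: pow => //.
  have hv : d%:R / 2 <= \sum_x `|psign R h x|.
    apply: le_trans (psign_sqr_ge R h d2) _; apply: ler_sum => x _.
    rewrite -real_normK ?num_real// expr2 -[leRHS]mul1r ler_wpM2r//.
    exact: norm_psign_le1.
  apply: le_trans (Lp_dist_shift_ge p0 (ltW delta_gt0) hv).
  have -> : D * delta * (d%:R / 2) / d%:R = rho0.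
    by rewrite /delta; field; rewrite !gt_eqF.
  exact: ltW.
Qed.

(** With mass 1/2 on each of two symbols, delta may be a constant whatever d is. One alternative
    suffices, hence the prior on [unit]; the factor d^(1/p - 1/2) is lost. *)
Lemma rho_I_ge_two_point :
  ((c * Num.min (1 / N) 1)%:E <= rho_I d n1 n2 eps p alpha beta)%E.
Proof.
set delta := c * _.
have delta_gt0 : 0 < delta by rewrite mulr_gt0// lt_min divr_gt0/=.
have hA : delta * N <= c.
  by rewrite -ler_pdivlMr// ler_pM2l// ge_min div1r lexx.
have hB : delta <= c by rewrite -[leRHS]mulr1 ler_pM2l// ge_min lexx orbT.
apply: rho_star_ge => // rho dT T QX QY phi /andP[rho_gt0 rho_lt] mech _ test lev pow.
pose x0 := Ordinal d0; pose x1 := Ordinal d2.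
have x01 : x1 != x0 by rewrite -val_eqE.
have sum2 (F : 'I_d -> R) : (forall x, x != x0 -> x != x1 -> F x = 0) ->
    \sum_x F x = F x0 + F x1.
  move=> F0; rewrite (bigD1 x0)//= (bigD1 x1)//= big1 ?addr0// => x /andP[? ?].
  exact: F0.
pose p0 x : R := if (x == x0) || (x == x1) then 2^-1 else 0.
pose u (_ : unit) x : R := if x == x0 then delta else if x == x1 then - delta else 0.
have pp0 : pmf p0.
  split => [x|]; first by rewrite /p0; case: ifP => _ //; rewrite invr_ge0.
  rewrite sum2 => [|x /negbTE h1 /negbTE h2]; last by rewrite /p0 h1 h2.
  by rewrite /p0 !eqxx orbT/=; lra.
have ux (a : 'I_d -> R) v : \sum_x u v x * a x = delta * (a x0 - a x1).
  rewrite sum2 => [|x /negbTE h1 /negbTE h2]; last by rewrite /u h1 h2 mul0r.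
  by rewrite /u eqxx (negbTE x01) eqxx; ring.
have pu v : pmf (fun x => p0 x + u v x).
  split => [x|].
    rewrite /p0 /u; case: (x == x0) => /=; first by move: delta_gt0; lra.
    by case: (x == x1); [move: hB; rewrite cE; lra|rewrite addr0].
  rewrite big_split/= pp0.2 -[RHS]addr0; congr (_ + _).
  transitivity (\sum_x u v x * 1); last by rewrite (ux (fun=> 1)) subrr mulr0.
  by apply: eq_bigr => x _; rewrite mulr1.
have := @interactive_information_ge R d dT T n1 n2 QX QY eps e01 len mech phi test
  unit p0 u (delta ^+ 2 * (64 * eps) ^+ 2) _ pp0 pu.
rewrite card_unit => /(_ isT _ _ alpha beta ab a0 b0 (lev _ pp0)) key.
have ha2 (a : 'I_d -> R) : (forall x, `|a x| <= 32 * eps) -> `|a x0 - a x1| <= 64 * eps.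
  by move=> ha; apply: le_trans (ler_normB _ _) _; have := ha x0; have := ha x1; lra.
suff : 1 / 30 <= delta ^+ 2 * (64 * eps) ^+ 2 * n1%:R.
  have -> : delta ^+ 2 * (64 * eps) ^+ 2 * n1%:R = 2 ^+ 12 * (delta * N) ^+ 2.
    have -> : (delta * N) ^+ 2 = delta ^+ 2 * N ^+ 2 by ring.
    by rewrite N2; ring.
  have h2 : (delta * N) ^+ 2 <= c ^+ 2.
    have dN0 : 0 <= delta * N := ltW (mulr_gt0 delta_gt0 N0).
    by apply: lerXn2r; rewrite ?nnegrE// (le_trans dN0).
  by move: h2; rewrite cE; lra.
apply: key.
- move=> v a ha; rewrite ux normrM (ger0_norm (ltW delta_gt0)).
  apply: (@le_trans _ _ (c * 64)); last by rewrite cE; lra.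
  apply: ler_pM => //; first exact: ltW.
  by apply: le_trans (ha2 a ha) _; case/andP: e01; lra.
- move=> a ha; rewrite (eq_avg (G := fun=> (delta * (a x0 - a x1)) ^+ 2)); last first.
    by move=> v; rewrite ux.
  rewrite avg_cst ?card_unit// exprMn ler_pM2l ?exprn_gt0//.
  rewrite -[leLHS]real_normK ?num_real// lerXn2r ?nnegrE//; last exact: ha2.
  by rewrite mulr_ge0// ltW.
- move=> v; apply: pow => //.
  apply: le_trans (Lp_dist_ge_coord _ _ x0 p1).
  by rewrite addrC addKr /u eqxx ger0_norm ltW.
Qed.

(** At p = 1 the cap d^(1/p - 1) is already 1; at p = 2 the factor d^(1/p - 1/2) is 1, so the
    two-point bound loses nothing. *)
Lemma rho_I_ge :
  ((c * Num.min (d%:R `^ (p^-1 - 2^-1) / N)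
     (if (p == 1) || (p == 2) then 1 else d%:R `^ (p^-1 - 1)))%:E
   <= rho_I d n1 n2 eps p alpha beta)%E.
Proof.
have [pE1|p_neq1] := eqVneq p 1.
  by have := rho_I_ge_uniform; rewrite pE1 invr1 subrr powRr0.
have [pE2|p_neq2] := eqVneq p 2 => /=; last exact: rho_I_ge_uniform.
by have := rho_I_ge_two_point; rewrite pE2 subrr powRr0.
Qed.

End lower_bounds.

(** * Protocols with finitely many outputs *)

(** A mechanism has a single output space, so one finite type serves for seeds, sign vectors and
    single bits; the alias carries the discrete sigma-algebra. *)
Definition msg (d : nat) := signs d.
HB.instance Definition _ d := Finite.on (msg d).
HB.instance Definition _ d := isPointed.Build (msg d) [ffun=> true].
HB.instance Definition _ d := @isMeasurable.Build default_measure_display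
  (msg d) discrete_measurable discrete_measurable0
  discrete_measurableC discrete_measurableU.

Section discrete_probability.
Context (R : realType) (d : nat).
Local Notation T := (msg d).

Record mass := Mass {
  mass_fun :> T -> R;
  mass_ge0 : forall t, 0 <= mass_fun t;
  mass_sum1 : \sum_t mass_fun t = 1 }.

Section mass_measure.
Variable q : mass.

Definition mass_prob (S : set T) : \bar R := (\sum_t (q t)%:E * \d_t S)%E.

Let mass_prob0 : mass_prob set0 = 0%E.
Proof. by rewrite /mass_prob big1// => t _; rewrite measure0 mule0. Qed.

Let mass_prob_ge0 S : (0 <= mass_prob S)%E.
Proof. by apply: sume_ge0 => t _; rewrite mule_ge0// lee_fin mass_ge0. Qed.

Let mass_prob_sigma_additive : semi_sigma_additive mass_prob.
Proof.
move=> F mF tF mUF; rewrite [X in X @ \oo --> _](_ : _ =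
    (fun n => \sum_t (q t)%:E * \sum_(0 <= i < n) \d_t (F i))%E); last first.
  apply/funext => n; rewrite exchange_big/=; apply: eq_bigr => t _.
  by rewrite ge0_sume_distrr.
apply: cvg_nnesum => [t _|t _].
  by apply: nearW => n; rewrite mule_ge0 ?lee_fin ?mass_ge0// sume_ge0.
by apply: cvgeZl => //; exact: measure_semi_sigma_additive.
Qed.

HB.instance Definition _ := isMeasure.Build _ _ _ mass_prob
  mass_prob0 mass_prob_ge0 mass_prob_sigma_additive.

Let mass_probT : mass_prob [set: T] = 1%E.
Proof.
rewrite /mass_prob; under eq_bigr do rewrite diracT mule1.
by rewrite sumEFin mass_sum1.
Qed.

HB.instance Definition _ := Measure_isProbability.Build _ _ _ mass_prob mass_probT.

Definition pm : probability T R := mass_prob.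

End mass_measure.

Lemma pm_le (q q' : mass) (e : R) (S : set T) : 0 <= e ->
  (forall t, q t <= e * q' t) -> (pm q S <= e%:E * pm q' S)%E.
Proof.
move=> e0 hq; rewrite /pm/= /mass_prob ge0_sume_distrr; last first.
  by move=> t _; rewrite mule_ge0// lee_fin mass_ge0.
apply: lee_sum => t _; rewrite muleA; apply: lee_wpmul2r => //.
by rewrite -EFinM lee_fin.
Qed.

Lemma measurable_msg (dY : measure_display) (Y : measurableType dY) (f : T -> Y) :
  measurable_fun [set: T] f.
Proof. by move=> _ A _; rewrite setTI. Qed.

Lemma bdm_msg (f : T -> R) : bdm f.
Proof.
split; first exact: measurable_msg.
exists (\sum_t `|f t|) => t.
by rewrite (bigD1 t)//= lerDl sumr_ge0.
Qed.

Lemma Exp_pm (q : mass) (f : T -> R) : \int[pm q]_t f t = \sum_t q t * f t.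
Proof.
rewrite (_ : f = fun t => \sum_s f s * \1_[set s] t); last first.
  apply/funext => t; rewrite (bigD1 t)//= big1 ?addr0.
    by rewrite indicE mem_set// mulr1.
  by move=> s /eqP st; rewrite indicE memNset ?mulr0//= => ts; exact: st.
rewrite Exp_sum => [|s]; last exact: bdm_msg.
apply: eq_bigr => s _; rewrite ExpZ; last exact: bdm_msg.
rewrite [X in _ = q s * X](bigD1 s)//= big1 ?addr0; last first.
  by move=> t /eqP ts; rewrite indicE memNset ?mulr0//= => st; apply: ts.
rewrite indicE mem_set// mulr1 mulrC; congr (_ * _).
rewrite /Rintegral integral_indic// setIT /pm/= /mass_prob.
rewrite (bigD1 s)//= big1 ?adde0; last first.
  by move=> t /eqP ts; rewrite diracE memNset ?mule0//= => st; apply: ts.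
by rewrite diracE mem_set// mule1.
Qed.

(** The sigma-algebra on tuples is generated by the coordinates, not discrete by definition.
    Singletons are finite intersections of coordinate events, and the space is finite. *)
Lemma measurable_msg_tuples i j (dY : measure_display) (Y : measurableType dY)
    (f : i.-tuple T * j.-tuple T -> Y) : measurable_fun setT f.
Proof.
have m1 n (z : n.-tuple T) : measurable [set z].
  have -> : [set z] = \bigcap_(k in [set: 'I_n]) ((@tnth _ T ^~ k) @^-1` [set tnth z k]).
    apply/seteqP; split => [_ -> //|z' zz']/=.
    by apply/eq_from_tnth => k; exact: zz'.
  apply: fin_bigcap_measurable => // k _.
  rewrite -[X in measurable X]setTI; exact: (measurable_tnth k).
move=> _ A _; rewrite setTI.
have -> : f @^-1` A = \bigcup_(a in f @^-1` A) (([set a.1] : set (i.-tuple T)) `*` ([set a.2] : set (j.-tuple T))).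
  apply/seteqP; split => [a Aa|[z w] [[z' w'] Aa [/= -> ->]]//].
  by exists a.
apply: fin_bigcup_measurable => [|a _]; last exact: measurableX.
exact: finite_finset.
Qed.

End discrete_probability.

(** * Voting over batches *)

Section batch_expectation.
Context (R : realType) (A : finType).
Implicit Types (law : seq A -> A -> R) (f : seq A -> R).

(** Expectation over the next [a] pairs of answers, each with a law that may depend on the batch [g]
    so far. *)
Fixpoint bexp law (a : nat) (g : seq A) f : R :=
  if a is a'.+1 then \sum_p law g p * bexp law a' (rcons g p) f else f g.

Lemma bexpD law a g f f' :
  bexp law a g (fun h => f h + f' h) = bexp law a g f + bexp law a g f'.
Proof.
elim: a g => [//|a IHa] g /=; rewrite -big_split/=.
by apply: eq_bigr => p _; rewrite IHa mulrDr.
Qed.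

Lemma bexpZ law a g (c : R) f : bexp law a g (fun h => c * f h) = c * bexp law a g f.
Proof.
elim: a g => [//|a IHa] g /=; rewrite mulr_sumr.
by apply: eq_bigr => p _; rewrite IHa mulrCA.
Qed.

Lemma bexp_sum law a g (I : Type) (s : seq I) (F : I -> seq A -> R) :
  bexp law a g (fun h => \sum_(i <- s) F i h) = \sum_(i <- s) bexp law a g (F i).
Proof.
elim: s => [|i s IHs].
  rewrite big_nil (_ : (fun h => _) = fun h => 0 * 0); first by rewrite bexpZ mul0r.
  by apply/funext => h; rewrite big_nil mul0r.
rewrite big_cons -IHs -bexpD; congr bexp; apply/funext => h.
by rewrite big_cons.
Qed.

Lemma bexp_cat law a a' g f : bexp law (a + a') g f = bexp law a g (fun h => bexp law a' h f).
Proof. by elim: a g => [//|a IHa] g /=; apply: eq_bigr => p _; rewrite IHa. Qed.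

Lemma eq_bexp law a g f f' : (forall h, size h = (size g + a)%N -> f h = f' h) ->
  bexp law a g f = bexp law a g f'.
Proof.
elim: a g => [|a IHa] g ff' /=; first by apply: ff'; rewrite addn0.
by apply: eq_bigr => p _; rewrite (IHa (rcons g p))// => h; rewrite size_rcons addSnnS; exact: ff'.
Qed.

Definition law_pmf law := forall g, (forall p, 0 <= law g p) /\ \sum_p law g p = 1.

Lemma bexp_cst law a g (c : R) : law_pmf law -> bexp law a g (fun=> c) = c.
Proof.
move=> lp; elim: a g => [//|a IHa] g /=; under eq_bigr do rewrite IHa.
by rewrite -mulr_suml (lp g).2 mul1r.
Qed.

Lemma le_bexp law a g f f' : law_pmf law -> (forall h, f h <= f' h) ->
  bexp law a g f <= bexp law a g f'.
Proof.
move=> lp ff'; elim: a g => [|a IHa] g /=; first exact: ff'.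
by apply: ler_sum => p _; rewrite ler_wpM2l// (lp g).1.
Qed.

Context (b : nat) (rej : seq A -> bool) (acc : nat -> bool).

(* The state is the number of rejecting batches and the current, incomplete batch. *)
Definition upd (st : nat * seq A) (p : A) : nat * seq A :=
  let g := rcons st.2 p in
  if size g == b then ((st.1 + rej g)%N, [::]) else (st.1, g).

Fixpoint value law (k : nat) (st : nat * seq A) : R :=
  if k is k'.+1 then \sum_p law st.2 p * value law k' (upd st p) else (acc st.1)%:R.

(** Probability of the decision [acc] after [k] independent votes of success probability [pi], with
    [c] successes already counted. *)
Fixpoint bvalue (pi : R) (k c : nat) : R :=
  if k is k'.+1 then (1 - pi) * bvalue pi k' c + pi * bvalue pi k' c.+1 else (acc c)%:R.

Lemma value_small law m c g : law_pmf law -> (size g + m < b)%N ->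
  value law m (c, g) = (acc c)%:R.
Proof.
move=> lp; elim: m g => [//|m IHm] g gm /=.
have -> : \sum_p law g p * value law m (upd (c, g) p) = \sum_p law g p * (acc c)%:R.
  apply: eq_bigr => p _; congr (_ * _); rewrite /upd/= size_rcons ltn_eqF; last by lia.
  by rewrite IHm// size_rcons; lia.
by rewrite -mulr_suml (lp g).2 mul1r.
Qed.

Lemma value_batch law a m c g : (size g + a.+1)%N = b ->
  value law (a.+1 + m) (c, g) =
  bexp law a.+1 g (fun h => value law m ((c + rej h)%N, [::])).
Proof.
elim: a g => [|a IHa] g gb /=; apply: eq_bigr => p _; rewrite /upd/= size_rcons.
  by rewrite -gb addn1 eqxx.
rewrite ltn_eqF; last by lia.
by congr (_ * _); apply: IHa; rewrite size_rcons; lia.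
Qed.

(** The law depends on the current batch only, so the batches are independent copies; the [r]
    leftover pairs never complete one. *)
Lemma valueE law k r c : law_pmf law -> (r < b)%N ->
  value law (k * b + r) (c, [::]) =
  bvalue (bexp law b [::] (fun g => (rej g)%:R)) k c.
Proof.
move=> lp rb; elim: k c => [|k IHk] c; first by rewrite value_small.
case: b rb IHk value_batch => [//|b'] rb IHk vb.
rewrite mulSn -addnA vb//; set pi := bexp law b'.+1 [::] (fun g => (rej g)%:R) in IHk *.
rewrite (_ : (fun h => _) = fun h => bvalue pi k c + (bvalue pi k c.+1 - bvalue pi k c) * (rej h)%:R).
  rewrite bexpD bexp_cst// bexpZ -/pi.
  change (bvalue pi k.+1 c) with ((1 - pi) * bvalue pi k c + pi * bvalue pi k c.+1).
  ring.
apply/funext => h; rewrite IHk; case: (rej h); rewrite ?addn0 ?addn1 ?mulr1 ?mulr0 ?addr0//.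
by rewrite addrC subrK.
Qed.

(** Chernoff's method: the geometric majorant of the decision integrates exactly to a k-th power. *)
Lemma bvalue_le (pi u B : R) k c : 0 <= pi <= 1 -> 0 <= u -> 0 <= B ->
  (forall c, (acc c)%:R <= B * u ^+ c) ->
  bvalue pi k c <= B * u ^+ c * (1 - pi + pi * u) ^+ k.
Proof.
move=> /andP[p0 p1] u0 B0 hB; elim: k c => [|k IHk] c /=; first by rewrite expr0 mulr1.
apply: (@le_trans _ _ ((1 - pi) * (B * u ^+ c * (1 - pi + pi * u) ^+ k) +
    pi * (B * u ^+ c.+1 * (1 - pi + pi * u) ^+ k))).
  by apply: lerD; apply: ler_wpM2l => //; lra.
by rewrite !exprS le_eqVlt; apply/orP; left; apply/eqP; ring.
Qed.

Lemma bvalue_ge (pi u B : R) k c : 0 <= pi <= 1 -> 0 <= u -> 0 <= B ->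
  (forall c, 1 - (acc c)%:R <= B * u ^+ c) ->
  1 - bvalue pi k c <= B * u ^+ c * (1 - pi + pi * u) ^+ k.
Proof.
move=> /andP[p0 p1] u0 B0 hB; elim: k c => [|k IHk] c /=; first by rewrite expr0 mulr1.
apply: (@le_trans _ _ ((1 - pi) * (B * u ^+ c * (1 - pi + pi * u) ^+ k) +
    pi * (B * u ^+ c.+1 * (1 - pi + pi * u) ^+ k))).
  have -> : 1 - ((1 - pi) * bvalue pi k c + pi * bvalue pi k c.+1) =
    (1 - pi) * (1 - bvalue pi k c) + pi * (1 - bvalue pi k c.+1) by ring.
  by apply: lerD; apply: ler_wpM2l => //; lra.
by rewrite !exprS le_eqVlt; apply/orP; left; apply/eqP; ring.
Qed.

End batch_expectation.

Section vote.
Context (R : realType) (k : nat).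

(** The threshold 1/16 lies between the rejection rates 2^-17 and 3/20 of one batch under the two
    hypotheses. *)
Definition vote (c : nat) : bool := (k <= 16 * c)%N.

(** Here u = 2^16: the majorant is 2^(16 c - k), and (1 - pi + 2^16 pi) / 2 <= 3/4 because 2^16 pi
    <= 1/2. *)
Lemma bvalue_vote_null (pi : R) : 0 <= pi -> pi <= 2^-1 ^+ 17 ->
  bvalue vote pi k 0 <= (49 / 50) ^+ k.
Proof.
move=> p0 p1.
have h17 : (2^-1 : R) ^+ 17 <= 1 by apply: exprn_ile1 => //; lra.
have hacc c : (vote c)%:R <= (2^-1 : R) ^+ k * (2 ^+ 16) ^+ c.
  rewrite -exprM /vote; case: leqP => /= kc; last first.
    by rewrite mulr_ge0// exprn_ge0// invr_ge0.
  rewrite exprVn mulrC ler_pdivlMr ?exprn_gt0// mul1r.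
  by rewrite ler_weXn2l// ler1n.
have pi01 : 0 <= pi <= 1 by rewrite p0 (le_trans p1).
have u0 : (0 : R) <= 2 ^+ 16 by rewrite exprn_ge0.
have B0 : 0 <= (2^-1 : R) ^+ k by rewrite exprn_ge0// invr_ge0.
apply: le_trans (bvalue_le k 0 pi01 u0 B0 hacc) _.
rewrite expr0 mulr1 -exprMn.
have h1 : pi * 2 ^+ 16 <= 2^-1.
  apply: (le_trans (ler_wpM2r u0 p1)).
  by rewrite exprSr mulrAC -exprMn mulVf// expr1n mul1r.
have h0 : 0 <= pi * 2 ^+ 16 by rewrite mulr_ge0.
apply: lerXn2r; rewrite ?nnegrE.
- by rewrite mulr_ge0//; lra.
- by lra.
- by lra.
Qed.

(** Here u = w^16 with w = 31/32: the majorant is w^(16 c - k), and w^16 <= 31/50 gives (1 - 3/20 *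
    19/50) / w < 49/50. *)
Lemma bvalue_vote_alt (pi : R) : 3 / 20 <= pi <= 1 ->
  1 - bvalue vote pi k 0 <= (49 / 50) ^+ k.
Proof.
move=> /andP[p0 p1].
pose w : R := 31 / 32.
have w0 : 0 < w by rewrite /w; lra.
have w16 : w ^+ 16 <= 31 / 50 by rewrite /w; lra.
have hacc c : 1 - (vote c)%:R <= w^-1 ^+ k * (w ^+ 16) ^+ c.
  rewrite -exprM /vote; case: leqP => /= kc.
    by rewrite subrr mulr_ge0// exprn_ge0// ?invr_ge0 ltW.
  rewrite subr0 exprVn mulrC ler_pdivlMr ?exprn_gt0// mul1r.
  by rewrite ler_wiXn2l ?(ltW w0)// ?(ltnW kc)// /w; lra.
have pi01 : 0 <= pi <= 1 by apply/andP; split; lra.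
have u0 : 0 <= w ^+ 16 by rewrite exprn_ge0// ltW.
have B0 : 0 <= w^-1 ^+ k by rewrite exprn_ge0// invr_ge0 ltW.
apply: le_trans (bvalue_ge k 0 pi01 u0 B0 hacc) _.
rewrite expr0 mulr1 -exprMn.
have h1 : 0 <= pi * w ^+ 16 by rewrite mulr_ge0//; lra.
apply: lerXn2r; rewrite ?nnegrE.
- by rewrite mulr_ge0// ?invr_ge0 ?(ltW w0)//; lra.
- by lra.
rewrite mulrC ler_pdivrMr//.
have h2 : pi * w ^+ 16 <= pi * (31 / 50) by apply: ler_wpM2l => //; lra.
have wE : w = 31 / 32 by []. clearbody w; lra.
Qed.

End vote.

Section batch_protocol.
Context (R : realType) (d : nat).
Local Notation T := (msg d).
Context (qX qY : seq (T * T) -> 'I_d -> mass R d) (b k : nat) (rej : seq (T * T) -> bool).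

(** [zip] drops the W outputs beyond round n1. A channel sees the past only through the current
    incomplete batch, a test only through the tally. *)
Definition run (z w : seq T) := foldl (upd b rej) (0%N, [::]) (zip z w).
Definition batch_chan (q : seq (T * T) -> 'I_d -> mass R d) : chan R d T :=
  fun _ x z w => pm (q (run z w).2 x).
Definition batch_test (z w : seq T) : R := (vote k (run z w).1)%:R.
Definition batch_law (pX pY : 'I_d -> R) (g : seq (T * T)) (p : T * T) : R :=
  (\sum_x pX x * qX g x p.1) * (\sum_y pY y * qY g y p.2).

Lemma step_pm (q : 'I_d -> mass R d) (P : 'I_d -> R) (f : T -> R) :
  step (fun x => pm (q x)) P f = \sum_t (\sum_x P x * q x t) * f t.
Proof.
rewrite /step; under eq_bigr do rewrite Exp_pm mulr_sumr.
rewrite exchange_big/=; apply: eq_bigr => t _; rewrite mulr_suml.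
by apply: eq_bigr => x _; rewrite mulrA.
Qed.

Lemma mass_mix (q : 'I_d -> mass R d) P : pmf P ->
  (forall t, 0 <= \sum_x P x * q x t) /\ \sum_t \sum_x P x * q x t = 1.
Proof.
move=> [P0 P1]; split => [t|].
  by apply: sumr_ge0 => x _; rewrite mulr_ge0// mass_ge0.
by rewrite exchange_big/= -P1; apply: eq_bigr => x _; rewrite -mulr_sumr mass_sum1 mulr1.
Qed.

Lemma sum_pair (F G : T -> R) : \sum_(p : T * T) F p.1 * G p.2 = (\sum_s F s) * \sum_t G t.
Proof. by rewrite -(pair_bigA _ (fun s t => F s * G t))/= big_distrlr. Qed.

Lemma batch_law_pmf pX pY : pmf pX -> pmf pY -> law_pmf (batch_law pX pY).
Proof.
move=> ppX ppY g; split => [p|].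
  by rewrite mulr_ge0//; apply: (mass_mix _ _).1.
have := sum_pair (fun s => \sum_x pX x * qX g x s) (fun t => \sum_y pY y * qY g y t).
by rewrite !(mass_mix _ _).2// mulr1.
Qed.

Lemma zip_rcons_long (z w : seq T) t : (size z <= size w)%N -> zip z (rcons w t) = zip z w.
Proof. by elim: z w => [|s z IHz] [|u w]//= zw; rewrite IHz. Qed.

Lemma rphase2_batch pY m (z w : seq T) : pmf pY -> (size z <= size w)%N ->
  rphase2 (batch_chan qY) pY batch_test m z w = batch_test z w.
Proof.
move=> ppY; elim: m w => [//|m IHm] w zw /=.
have -> : (fun t => rphase2 (batch_chan qY) pY batch_test m z (rcons w t)) =
    fun=> batch_test z w.
  apply/funext => t; rewrite IHm; last by rewrite size_rcons leqW.
  by rewrite /batch_test /run zip_rcons_long.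
by rewrite step_cst.
Qed.

Lemma rphase1_batch pX pY m l (z w : seq T) : pmf pX -> pmf pY -> size z = size w ->
  rphase1 (batch_chan qX) (batch_chan qY) pX pY batch_test m l z w =
  value b rej (vote k) (batch_law pX pY) l (run z w).
Proof.
move=> ppX ppY; elim: l z w => [|l IHl] z w zw /=.
  by rewrite rphase2_batch// zw.
pose G s t := batch_law pX pY (run z w).2 (s, t) *
  value b rej (vote k) (batch_law pX pY) l (upd b rej (run z w) (s, t)).
rewrite step_pm; transitivity (\sum_s \sum_t G s t); last first.
  by rewrite pair_bigA/=; apply: eq_bigr => -[s t] _.
apply: eq_bigr => s _; rewrite step_pm mulr_sumr; apply: eq_bigr => t _.
rewrite IHl ?size_rcons ?zw// mulrA; congr (_ * _).
by rewrite /run zip_rcons// foldl_rcons.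
Qed.

Lemma batch_LDP n1 n2 (eps : R) : 0 <= eps ->
  (forall g x x' t, qX g x t <= expR eps * qX g x' t) ->
  (forall g y y' t, qY g y t <= expR eps * qY g y' t) ->
  LDP_mech n1 n2 eps (batch_chan qX) (batch_chan qY).
Proof.
move=> e0 hX hY; split.
- by move=> i x _ S _; exact: measurable_msg_tuples.
- by move=> j y _ S _; exact: measurable_msg_tuples.
- by move=> i x x' z w S _; apply: pm_le => //; exact: expR_ge0.
- by move=> j y y' z w S _; apply: pm_le => //; exact: expR_ge0.
Qed.

Lemma batch_rand_test n1 n2 : rand_test n1 n2 batch_test.
Proof.
split => [|z w]; first exact: measurable_msg_tuples.
by rewrite /batch_test ler0n lern1 leq_b1.
Qed.

Definition batch_rej_prob pX pY : R := bexp (batch_law pX pY) b [::] (fun g => (rej g)%:R).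

Lemma batch_rej_prob01 pX pY : pmf pX -> pmf pY -> 0 <= batch_rej_prob pX pY <= 1.
Proof.
move=> ppX ppY; have lp := batch_law_pmf ppX ppY; apply/andP; split.
  by rewrite -(bexp_cst b [::] 0 lp); apply: le_bexp => // g; rewrite ler0n.
by rewrite -(bexp_cst b [::] 1 lp); apply: le_bexp => // g; rewrite lern1 leq_b1.
Qed.

Lemma rrej_batch n1 n2 pX pY : (0 < b)%N -> k = (n1 %/ b)%N -> pmf pX -> pmf pY ->
  rrej n1 n2 (batch_chan qX) (batch_chan qY) batch_test pX pY =
  bvalue (vote k) (batch_rej_prob pX pY) k 0.
Proof.
move=> b0 kE ppX ppY; rewrite /rrej rphase1_batch//.
rewrite [X in value _ _ _ _ X](divn_eq n1 b) -kE.
by rewrite /run/= valueE ?ltn_mod//; exact: batch_law_pmf.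
Qed.

End batch_protocol.

Section amplification.
Context (R : realType) (d : nat).
Local Notation T := (msg d).
Context (qX qY : seq (T * T) -> 'I_d -> mass R d) (b : nat) (rej : seq (T * T) -> bool).
Context (ni : bool) (n1 n2 : nat) (eps p alpha beta rho : R).
Let k := (n1 %/ b)%N.

(** Reduces an upper bound on the radius to the design of one batch with constant error rates; the
    vote turns these into (49/50)^k. *)
Lemma rho_star_le :
  0 <= eps -> (0 < b)%N -> (n1 <= n2)%N -> 0 < rho ->
  (ni -> forall g g', qX g = qX g' /\ qY g = qY g') ->
  (forall g x x' t, qX g x t <= expR eps * qX g x' t) ->
  (forall g y y' t, qY g y t <= expR eps * qY g y' t) ->
  (49 / 50) ^+ k <= alpha -> (49 / 50) ^+ k <= beta ->
  (forall P, pmf P -> batch_rej_prob qX qY b rej P P <= 2^-1 ^+ 17) ->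
  (forall pX pY, pmf pX -> pmf pY -> rho <= Lp_dist p pX pY ->
     3 / 20 <= batch_rej_prob qX qY b rej pX pY) ->
  (rho_star ni d n1 n2 eps p alpha beta <= rho%:E)%E.
Proof.
move=> e0 b0 len rho0 hni hX hY ka kb null alt.
have mech := batch_LDP b rej n1 n2 e0 hX hY.
have test := batch_rand_test R b k rej n1 n2.
apply: ge_ereal_inf; exists rho%:E => //; exists rho; split => //.
rewrite /risk EFinD leeD2l//; apply: ge_ereal_inf.
exists (typeII n1 n2 p rho (batch_chan b rej qX) (batch_chan b rej qY) (batch_test R b k rej)).
  exists _, (msg d), (batch_chan b rej qX), (batch_chan b rej qY), (batch_test R b k rej).
  split => //.
    move=> /hni h; split => i x z w z' w'; rewrite /batch_chan.
      by rewrite (h (run b rej z w).2 (run b rej z' w').2).1.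
    by rewrite (h (run b rej z w).2 (run b rej z' w').2).2.
  move=> P pP; rewrite (rej_probE len mech test)// lee_fin rrej_batch//.
  apply: le_trans ka; apply: bvalue_vote_null; last exact: null.
  by have /andP[] := batch_rej_prob01 qX qY b rej pP pP.
apply: ge_ereal_sup => _ [pX [pY [ppX ppY hrho ->]]].
rewrite (rej_probE len mech test)// -EFinB lee_fin rrej_batch//.
apply: le_trans kb; apply: bvalue_vote_alt.
have /andP[_ ->] := batch_rej_prob01 qX qY b rej ppX ppY.
by rewrite alt.
Qed.

End amplification.

(** * Sign responses *)

Section iid_moments.
Context (R : realType) (A : finType).

Lemma bexp_shift (law : seq A -> A -> R) a g0 f :
  bexp law a g0 f = bexp (fun g => law (g0 ++ g)) a [::] (fun g => f (g0 ++ g)).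
Proof.
suff h g : bexp law a (g0 ++ g) f = bexp (fun g => law (g0 ++ g)) a g (fun g => f (g0 ++ g)).
  by rewrite -h cats0.
elim: a g => [//|a IHa] g /=; apply: eq_bigr => p _.
by rewrite -IHa rcons_cat.
Qed.

Lemma eq_bexp_law (law law' : seq A -> A -> R) a g f : (forall h p, law h p = law' h p) ->
  bexp law a g f = bexp law' a g f.
Proof. by move=> e; elim: a g => [//|a IHa] g /=; apply: eq_bigr => p _; rewrite e IHa. Qed.

Context (lam : A -> R) (lam_ge0 : forall p, 0 <= lam p) (lam_sum : \sum_p lam p = 1).
Implicit Types D : A -> R.

Definition mean D : R := \sum_p lam p * D p.
Definition ssum D (g : seq A) : R := \sum_(p <- g) D p.

Let lp : law_pmf (fun _ : seq A => lam). Proof. by []. Qed.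

Lemma ssum_rcons D g p : ssum D (rcons g p) = ssum D g + D p.
Proof. by rewrite /ssum -cats1 big_cat big_seq1. Qed.

Lemma meanD D D' : mean (fun p => D p + D' p) = mean D + mean D'.
Proof. by rewrite /mean -big_split; apply: eq_bigr => p _; rewrite mulrDr. Qed.

Lemma meanZ c D : mean (fun p => c * D p) = c * mean D.
Proof. by rewrite /mean mulr_sumr; apply: eq_bigr => p _; rewrite mulrCA. Qed.

Lemma mean_cst c : mean (fun=> c) = c.
Proof. by rewrite /mean -mulr_suml lam_sum mul1r. Qed.

Lemma bexp_ssum D m g : bexp (fun=> lam) m g (ssum D) = ssum D g + m%:R * mean D.
Proof.
elim: m g => [|m IHm] g /=; first by rewrite mul0r addr0.
under eq_bigr do rewrite IHm ssum_rcons.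
rewrite -/(mean (fun p => ssum D g + D p + m%:R * mean D)).
by rewrite !meanD !mean_cst -[m.+1]addn1 natrD; ring.
Qed.

Lemma bexp_ssum2 D D' m g :
  bexp (fun=> lam) m g (fun h => ssum D h * ssum D' h) =
  ssum D g * ssum D' g + m%:R * (ssum D g * mean D' + mean D * ssum D' g) +
  m%:R * mean (fun p => D p * D' p) + m%:R * (m%:R - 1) * (mean D * mean D').
Proof.
elim: m g => [|m IHm] g /=; first by rewrite !mul0r !addr0.
under eq_bigr do rewrite IHm !ssum_rcons.
set x := ssum D g; set y := ssum D' g; set M := mean (fun p => D p * D' p); set u := mean D; set v := mean D'.
transitivity (mean (fun p => ((x * y + m%:R * (x * v + u * y) + m%:R * M + m%:R * (m%:R - 1) * (u * v)) +
    (y + m%:R * v) * D p) + ((x + m%:R * u) * D' p + D p * D' p))).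
  by apply: eq_bigr => p _; congr (_ * _); ring.
rewrite meanD [mean (fun p => _ + (_ + _) * D p)]meanD mean_cst meanZ.
rewrite [mean (fun p => _ * D' p + _)]meanD meanZ -/M -/u -/v.
by rewrite -[m.+1]addn1 natrD; ring.
Qed.

Lemma bexp_ssum2_nil D D' m :
  bexp (fun=> lam) m [::] (fun h => ssum D h * ssum D' h) =
  m%:R * mean (fun p => D p * D' p) + m%:R * (m%:R - 1) * (mean D * mean D').
Proof. by rewrite bexp_ssum2 /ssum !big_nil; ring. Qed.

End iid_moments.

Section tilt.
Context (R : realType) (d : nat) (a : R).
Local Notation T := (msg d).
Hypothesis a01 : 0 <= a <= 1.
Implicit Types f : T -> R.

(** The law of density 1 + a f with respect to uniform signs. It is affine in f, so mixing over the
    raw datum stays in this family. *)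
Definition tilt f (t : T) : R := #|{: signs d}|%:R^-1 * (1 + a * f t).

Lemma tilt_ge0 f : (forall t, `|f t| <= 1) -> forall t, 0 <= tilt f t.
Proof.
move=> f1 t; have := f1 t; rewrite ler_norml => /andP[h1 h2].
rewrite mulr_ge0 ?invr_ge0 ?ler0n//; case/andP: a01 => *; nra.
Qed.

Lemma tilt_avg f (F : T -> R) : \sum_t tilt f t * F t = avg (fun t : signs d => (1 + a * f t) * F t).
Proof. by rewrite /avg mulr_sumr; apply: eq_bigr => t _; rewrite mulrA. Qed.

Lemma tilt_sum1 f : avg (fun t : signs d => f t) = 0 -> \sum_t tilt f t = 1.
Proof.
move=> f0; have := tilt_avg f (fun=> 1).
under eq_bigr do rewrite mulr1; move=> ->.
rewrite (eq_avg (G := fun t : signs d => 1 + a * f t)); last by move=> t; rewrite mulr1.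
by rewrite avgD avgZ f0 avg_cst ?card_signs// mulr0 addr0.
Qed.

Definition tilt_mass f (f1 : forall t, `|f t| <= 1) (f0 : avg (fun t : signs d => f t) = 0) :=
  Mass (tilt_ge0 f1) (tilt_sum1 f0).

Lemma tilt_mix (q : 'I_d -> R) (F : 'I_d -> T -> R) t : \sum_x q x = 1 ->
  \sum_x q x * tilt (F x) t = tilt (fun t => \sum_x q x * F x t) t.
Proof.
move=> q1; rewrite /tilt.
have -> : 1 + a * (\sum_x q x * F x t) = \sum_x (q x + a * (q x * F x t)).
  by rewrite big_split/= q1 mulr_sumr.
by rewrite mulr_sumr; apply: eq_bigr => x _; ring.
Qed.

(** The choice a = eps / 3 works because (1 + eps)(1 - eps / 3) >= 1 + eps / 3 for eps <= 1. *)
Lemma tilt_LDP f f' t (eps : R) : 0 < eps <= 1 -> a = eps / 3 ->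
  (forall t, `|f t| <= 1) -> (forall t, `|f' t| <= 1) ->
  tilt f t <= expR eps * tilt f' t.
Proof.
move=> /andP[e0 e1] aE f1 f1'; rewrite /tilt mulrCA ler_wpM2l ?invr_ge0 ?ler0n//.
have := f1 t; have := f1' t; rewrite !ler_norml => /andP[h1 h2] /andP[h3 h4].
have h5 : 1 + eps <= expR eps by exact: expR_ge1Dx.
have h6 : 1 + a * f t <= 1 + a by case/andP: a01 => *; nra.
have h7 : 1 - a <= 1 + a * f' t by case/andP: a01 => *; nra.
apply: (le_trans h6).
apply: (@le_trans _ _ ((1 + eps) * (1 - a))); first by rewrite aE; nra.
by apply: ler_pM => //; rewrite ?aE; lra.
Qed.

End tilt.

Section sign_response.
Context (R : realType) (d : nat) (a : R).
Local Notation T := (msg d).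
Local Notation sgn := (sg R).
Hypothesis a01 : 0 <= a <= 1.
Hypothesis d2 : (2 <= d)%N.

Lemma avg_sg (x : 'I_d) : avg (fun t : signs d => sgn (t x)) = 0.
Proof.
rewrite (eq_avg (G := fun t : signs d => sgn (t x) * 1)); last by move=> t; rewrite mulr1.
exact: (avg_sg_mul (G := fun=> 1)).
Qed.

Lemma avg_sg2 (x y : 'I_d) : avg (fun t : signs d => sgn (t x) * sgn (t y)) = (x == y)%:R.
Proof.
have [->|xy] := eqVneq x y.
  by rewrite (eq_avg (G := fun=> 1)) ?avg_cst ?card_signs// => t; rewrite sgsq.
apply: (avg_sg_mul (G := fun t : signs d => sgn (t y))) => t.
by rewrite ffunE eq_sym (negbTE xy).
Qed.

Lemma avg_sg3 (x y z : 'I_d) : y != z ->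
  avg (fun t : signs d => sgn (t x) * (sgn (t y) * sgn (t z))) = 0.
Proof.
move=> yz; have [->|xy] := eqVneq x y.
  rewrite (eq_avg (G := fun t : signs d => sgn (t z))) ?avg_sg// => t.
  by rewrite mulrA sgsq mul1r.
rewrite (eq_avg (G := fun t : signs d => sgn (t y) * (sgn (t x) * sgn (t z)))); last first.
  by move=> t; ring.
apply: (avg_sg_mul (G := fun t : signs d => sgn (t x) * sgn (t z))) => t.
by rewrite !ffunE (negbTE xy) eq_sym (negbTE yz).
Qed.

Definition sign_field (p : 'I_d -> R) (t : T) : R := \sum_x p x * sgn (t x).

Lemma tilt_mean (p : 'I_d -> R) y :
  \sum_t tilt a (sign_field p) t * sgn (t y) = a * p y.
Proof.
rewrite tilt_avg (eq_avg (G := fun t : signs d => sgn (t y) +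
  a * \sum_x p x * (sgn (t x) * sgn (t y)))); last first.
  move=> t; rewrite mulrDl mul1r -mulrA /sign_field mulr_suml; congr (_ + _ * _).
  by apply: eq_bigr => x _; rewrite mulrA.
rewrite avgD avg_sg add0r avgZ avg_sum; congr (_ * _).
rewrite (bigD1 y)//= avgZ avg_sg2 eqxx mulr1 big1 ?addr0// => x xy.
by rewrite avgZ avg_sg2 (negbTE xy) mulr0.
Qed.

Lemma avg_sign_field (p : 'I_d -> R) : avg (fun t : signs d => sign_field p t) = 0.
Proof. by rewrite avg_sum big1// => x _; rewrite avgZ avg_sg mulr0. Qed.

(** The tilt only adds averages of triple products of signs, which vanish: the answers have the
    second moments of uniform signs whatever the data. *)
Lemma tilt_mean2 (p : 'I_d -> R) y z :
  \sum_t tilt a (sign_field p) t * (sgn (t y) * sgn (t z)) = (y == z)%:R.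
Proof.
rewrite tilt_avg; have [->|yz] := eqVneq y z.
  rewrite (eq_avg (G := fun t : signs d => 1 + a * sign_field p t)); last first.
    by move=> t; rewrite sgsq mulr1 .
  by rewrite avgD avgZ avg_sign_field avg_cst ?card_signs// mulr0 addr0.
rewrite (eq_avg (G := fun t : signs d => sgn (t y) * sgn (t z) +
  a * \sum_x p x * (sgn (t x) * (sgn (t y) * sgn (t z))))); last first.
  move=> t; rewrite mulrDl mul1r -[a * _ * _]mulrA /sign_field mulr_suml; congr (_ + _ * _).
  by apply: eq_bigr => x _; rewrite -mulrA.
rewrite avgD avg_sg2 (negbTE yz) add0r avgZ avg_sum big1 ?mulr0// => x _.
by rewrite avgZ avg_sg3 ?mulr0.
Qed.

Lemma norm_sg_le1 (b : bool) : `|sgn b| <= 1. Proof. by rewrite norm_sg. Qed.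

Definition sign_mass (x : 'I_d) : mass R d :=
  tilt_mass a01 (f := fun t : T => sgn (t x)) (fun t => norm_sg_le1 (t x)) (avg_sg x).

Context (pX pY : 'I_d -> R).
Hypothesis (ppX : pmf pX) (ppY : pmf pY).

Definition pair_law (p : T * T) : R := tilt a (sign_field pX) p.1 * tilt a (sign_field pY) p.2.
Definition sdiff (y : 'I_d) (p : T * T) : R := sgn (p.1 y) - sgn (p.2 y).
Let mu y : R := a * (pX y - pY y).

Lemma batch_law_sign g p : batch_law (fun=> sign_mass) (fun=> sign_mass) pX pY g p = pair_law p.
Proof.
rewrite /batch_law /= !(tilt_mix _ (fun x (t : T) => sgn (t x))) ?ppX.2 ?ppY.2//.
Qed.

Lemma pair_law_pmf : (forall p, 0 <= pair_law p) /\ \sum_p pair_law p = 1.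
Proof.
have h := batch_law_pmf (fun=> sign_mass) (fun=> sign_mass) ppX ppY [::].
split => [p|]; first by rewrite -(batch_law_sign [::]); exact: h.1.
by rewrite -[RHS]h.2; apply: eq_bigr => p _; rewrite batch_law_sign.
Qed.

Lemma mean_prod (F G : T -> R) : mean pair_law (fun p => F p.1 * G p.2) =
  (\sum_s tilt a (sign_field pX) s * F s) * (\sum_t tilt a (sign_field pY) t * G t).
Proof.
rewrite -(sum_pair (fun s => tilt a (sign_field pX) s * F s)
  (fun t => tilt a (sign_field pY) t * G t)).
by apply: eq_bigr => p _; rewrite /pair_law; ring.
Qed.

Lemma tilt_field_sum1 (p : 'I_d -> R) : \sum_t tilt a (sign_field p) t * 1 = 1.
Proof. by under eq_bigr do rewrite mulr1; rewrite tilt_sum1// avg_sign_field. Qed.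

Lemma mean_fst (F : T -> R) : mean pair_law (fun p => F p.1) = \sum_s tilt a (sign_field pX) s * F s.
Proof.
have := mean_prod F (fun=> 1); rewrite tilt_field_sum1 mulr1 => <-.
by apply: eq_bigr => p _; rewrite mulr1.
Qed.

Lemma mean_snd (F : T -> R) : mean pair_law (fun p => F p.2) = \sum_s tilt a (sign_field pY) s * F s.
Proof.
have := mean_prod (fun=> 1) F; rewrite tilt_field_sum1 mul1r => <-.
by apply: eq_bigr => p _; rewrite mul1r.
Qed.

Lemma mean_sdiff y : mean pair_law (sdiff y) = mu y.
Proof.
transitivity (mean pair_law (fun p => sgn (p.1 y) + -1 * sgn (p.2 y))).
  by apply: eq_bigr => p _; rewrite mulN1r.
rewrite meanD meanZ (mean_fst (fun t => sgn (t y))) (mean_snd (fun t => sgn (t y))).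
by rewrite !tilt_mean /mu; ring.
Qed.

Lemma mean_sdiff2 y z : mean pair_law (fun p => sdiff y p * sdiff z p) =
  2 * (y == z)%:R - a ^+ 2 * (pX y * pY z + pY y * pX z).
Proof.
transitivity (mean pair_law (fun p => (sgn (p.1 y) * sgn (p.1 z) + sgn (p.2 y) * sgn (p.2 z)) +
   -1 * (sgn (p.1 y) * sgn (p.2 z) + sgn (p.1 z) * sgn (p.2 y)))).
  by apply: eq_bigr => p _; rewrite /sdiff; ring.
rewrite meanD meanZ !meanD.
rewrite (mean_fst (fun t => sgn (t y) * sgn (t z))) (mean_snd (fun t => sgn (t y) * sgn (t z))).
rewrite (mean_prod (fun t => sgn (t y)) (fun t => sgn (t z))).
rewrite (mean_prod (fun t => sgn (t z)) (fun t => sgn (t y))).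
by rewrite !tilt_mean2 !tilt_mean; ring.
Qed.

(** Four laws, because the null produces cross products of pX and pY and the alternative products of
    each with itself. The entrywise bound sums to 8 d + 8 <= 12 d. *)
Lemma sqr_sum_le (p q r s : 'I_d -> R) : pmf p -> pmf q -> pmf r -> pmf s ->
  \sum_y \sum_z (2 * (y == z)%:R - a ^+ 2 * (p y * q z + r y * s z)) ^+ 2 <= 12 * d%:R.
Proof.
move=> pp pq pr ps.
have le1 (u : 'I_d -> R) x : pmf u -> 0 <= u x <= 1.
  move=> pu; rewrite pu.1/= -pu.2 (bigD1 x)//= lerDl sumr_ge0// => y _; exact: pu.1.
have h y z : (2 * (y == z)%:R - a ^+ 2 * (p y * q z + r y * s z)) ^+ 2 <=
    8 * (y == z)%:R + 4 * (p y * q z) + 4 * (r y * s z).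
  have /andP[p0 p1] := le1 p y pp; have /andP[q0 q1] := le1 q z pq.
  have /andP[r0 r1] := le1 r y pr; have /andP[s0 s1] := le1 s z ps.
  have [u0 u1] : 0 <= p y * q z /\ p y * q z <= 1 by split; [exact: mulr_ge0|nra].
  have [v0 v1] : 0 <= r y * s z /\ r y * s z <= 1 by split; [exact: mulr_ge0|nra].
  have [a0 a1] : 0 <= a ^+ 2 /\ a ^+ 2 <= 1 by case/andP: a01 => *; split; nra.
  move: (p y * q z) (r y * s z) (a ^+ 2) u0 u1 v0 v1 a0 a1 => u v c *.
  have w0 : 0 <= c * (u + v) by rewrite mulr_ge0// addr_ge0.
  have w1 : c * (u + v) <= u + v by rewrite -[leRHS]mul1r ler_wpM2r// addr_ge0.
  have w2 : (c * (u + v)) ^+ 2 <= (u + v) ^+ 2 by rewrite lerXn2r ?nnegrE// addr_ge0.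
  have w3 : (u + v) ^+ 2 <= 2 * u + 2 * v by have := sqr_ge0 (u - v); nra.
  move: (c * (u + v)) w0 w1 w2 => w *.
  case: (y == z); last by rewrite !mulr0 sub0r sqrrN; lra.
  by have := sqr_ge0 (2 + w); rewrite !mulr1; lra.
apply: (le_trans (ler_sum _ (fun y _ => ler_sum _ (fun z _ => h y z)))).
have s1 (u v : 'I_d -> R) : pmf u -> pmf v -> \sum_y \sum_z 4 * (u y * v z) = 4.
  move=> pu pv; under eq_bigr do rewrite -mulr_sumr -mulr_sumr pv.2 mulr1.
  by rewrite -mulr_sumr pu.2 mulr1.
have s2 : \sum_(y < d) \sum_(z < d) 8 * (y == z)%:R = 8 * d%:R :> R.
  rewrite mulr_natr -[in RHS](card_ord d) -sumr_const; apply: eq_bigr => y _.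
  rewrite (bigD1 y)//= eqxx mulr1 big1 ?addr0// => z zy.
  by rewrite eq_sym (negbTE zy) mulr0.
under eq_bigr do rewrite !big_split/=.
rewrite !big_split/= s2 !s1//.
have : 2 <= d%:R :> R by rewrite ler_nat.
lra.
Qed.

Lemma bexp_split (lam : T * T -> R) m (F F' : seq (T * T) -> R) :
  bexp (fun=> lam) (m + m) [::] (fun g => F (take m g) * F' (drop m g)) =
  bexp (fun=> lam) m [::] F * bexp (fun=> lam) m [::] F'.
Proof.
rewrite bexp_cat mulrC -bexpZ; apply: eq_bexp => h; rewrite add0n => hm.
rewrite bexp_shift mulrC -bexpZ; congr bexp; apply/funext => g.
by rewrite -hm take_size_cat ?drop_size_cat.
Qed.

Context (m : nat).
Hypothesis m0 : (0 < m)%N.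

(** Splitting the batch plays the role of removing the diagonal of a U-statistic: independent halves
    leave no bias. *)
Definition half_product (g : seq (T * T)) : R :=
  \sum_y ssum (sdiff y) (take m g) * ssum (sdiff y) (drop m g).

Local Notation E := (bexp (fun _ : seq (T * T) => pair_law) (m + m) [::]).
Let lam_sum : \sum_p pair_law p = 1 := pair_law_pmf.2.
Let M1 : R := m%:R ^+ 2 * \sum_y mu y ^+ 2.

Lemma mean_half_product : E half_product = M1.
Proof.
rewrite bexp_sum /M1 mulr_sumr; apply: eq_bigr => y _.
rewrite (bexp_split _ _ (ssum (sdiff y)) (ssum (sdiff y))) bexp_ssum//.
by rewrite mean_sdiff /ssum big_nil; ring.
Qed.

(** The square expands over pairs y, z and the halves factor; having the same law, they give the
    squared entries of the second moment matrix of one half. *)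
Lemma mean_half_product2 : E (fun g => half_product g ^+ 2) =
  \sum_y \sum_z (m%:R * (2 * (y == z)%:R - a ^+ 2 * (pX y * pY z + pY y * pX z)) +
    m%:R * (m%:R - 1) * (mu y * mu z)) ^+ 2.
Proof.
transitivity (E (fun g => \sum_y \sum_z
   (ssum (sdiff y) (take m g) * ssum (sdiff z) (take m g)) *
   (ssum (sdiff y) (drop m g) * ssum (sdiff z) (drop m g)))).
  congr bexp; apply/funext => g; rewrite expr2 {1}/half_product mulr_suml.
  apply: eq_bigr => y _; rewrite mulr_sumr; apply: eq_bigr => z _; ring.
rewrite bexp_sum; apply: eq_bigr => y _; rewrite bexp_sum; apply: eq_bigr => z _.
rewrite (bexp_split _ _ (fun h => ssum (sdiff y) h * ssum (sdiff z) h)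
  (fun h => ssum (sdiff y) h * ssum (sdiff z) h)) bexp_ssum2_nil//.
by rewrite mean_sdiff2 !mean_sdiff expr2.
Qed.

(** The squared threshold is 2^22 m^2 d against a null variance of at most 12 m^2 d, so Chebyshev
    gives 2^-17. *)
Definition half_product_test (g : seq (T * T)) : bool :=
  2 ^+ 11 * m%:R * Num.sqrt d%:R <= half_product g.

Let mR : 0 < m%:R :> R. Proof. by rewrite ltr0n. Qed.
Let dR : 0 < d%:R :> R. Proof. by rewrite ltr0n; lia. Qed.
Let tau : R := 2 ^+ 11 * m%:R * Num.sqrt d%:R.
Let tau_gt0 : 0 < tau. Proof. by rewrite !mulr_gt0 ?exprn_gt0 ?sqrtr_gt0. Qed.
Let tau2 : tau ^+ 2 = 2 ^+ 22 * m%:R ^+ 2 * d%:R.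
Proof. by rewrite /tau 2!exprMn sqr_sqrtr ?ltW// -[(2 ^+ 11) ^+ 2]exprM. Qed.

Lemma batch_rej_probE : batch_rej_prob (fun=> sign_mass) (fun=> sign_mass) (m + m) half_product_test pX pY =
  E (fun g => (half_product_test g)%:R).
Proof. by apply: eq_bexp_law => h p; rewrite batch_law_sign. Qed.

Lemma half_product_null : pX = pY ->
  batch_rej_prob (fun=> sign_mass) (fun=> sign_mass) (m + m) half_product_test pX pY <= 2^-1 ^+ 17.
Proof.
move=> XY; rewrite batch_rej_probE.
have mu0 y : mu y = 0 by rewrite /mu XY subrr mulr0.
apply: (@le_trans _ _ (E (fun g => (tau ^+ 2)^-1 * half_product g ^+ 2))).
  apply: le_bexp => [|g]; first by move=> ?; exact: pair_law_pmf.
  rewrite /half_product_test -/tau; case: (leP tau (half_product g)) => /= [h|_]; last first.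
    by rewrite mulr_ge0 ?invr_ge0 ?sqr_ge0.
  rewrite mulrC ler_pdivlMr ?exprn_gt0// mul1r.
  by rewrite lerXn2r ?nnegrE ?(ltW tau_gt0)// (le_trans (ltW tau_gt0)).
rewrite bexpZ mean_half_product2.
have -> : \sum_y \sum_z (m%:R * (2 * (y == z)%:R - a ^+ 2 * (pX y * pY z + pY y * pX z)) +
    m%:R * (m%:R - 1) * (mu y * mu z)) ^+ 2 = m%:R ^+ 2 *
   \sum_y \sum_z (2 * (y == z)%:R - a ^+ 2 * (pX y * pY z + pY y * pX z)) ^+ 2.
  rewrite mulr_sumr; apply: eq_bigr => y _; rewrite mulr_sumr; apply: eq_bigr => z _.
  by rewrite !mu0; ring.
rewrite mulrC ler_pdivrMr ?exprn_gt0// tau2.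
apply: (@le_trans _ _ (m%:R ^+ 2 * (12 * d%:R))).
  by rewrite ler_pM2l ?exprn_gt0//; exact: sqr_sum_le.
have -> : 2^-1 ^+ 17 * (2 ^+ 22 * m%:R ^+ 2 * d%:R) = m%:R ^+ 2 * (32 * d%:R) :> R.
  by field.
by rewrite ler_pM2l ?exprn_gt0// ler_wpM2r ?ltW//; lra.
Qed.

(** The hypothesis puts the mean [M1] at 2 [tau] or more, so a miss is a deviation of at least M1 /
    2, and Chebyshev already gives power 1/2. *)
Lemma half_product_alt : 2 ^+ 12 * Num.sqrt d%:R <= m%:R * \sum_y mu y ^+ 2 ->
  3 / 20 <= batch_rej_prob (fun=> sign_mass) (fun=> sign_mass) (m + m) half_product_test pX pY.
Proof.
move=> hN; rewrite batch_rej_probE; set N := \sum_y mu y ^+ 2 in hN.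
have M1E : M1 = m%:R ^+ 2 * N by [].
have sd0 : 0 < Num.sqrt d%:R :> R by rewrite sqrtr_gt0.
have sd2 : Num.sqrt d%:R ^+ 2 = d%:R :> R by rewrite sqr_sqrtr// ltW.
have sd1 : 1 <= Num.sqrt d%:R :> R.
  by rewrite -[leLHS]sqrtr1 ler_wsqrtr// ler1n; lia.
have mN : 0 < m%:R * N by apply: lt_le_trans hN; rewrite mulr_gt0.
have N0 : 0 < N by rewrite -(pmulr_rgt0 _ mR).
have M1_gt0 : 0 < M1 by rewrite M1E mulr_gt0 ?exprn_gt0.
have tauM : 2 * tau <= M1.
  have -> : 2 * tau = m%:R * (2 ^+ 12 * Num.sqrt d%:R) by rewrite /tau; ring.
  by rewrite M1E expr2 -mulrA ler_pM2l.
have lp : law_pmf (fun _ : seq (T * T) => pair_law) by move=> ?; exact: pair_law_pmf.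
have miss : E (fun g => 1 - (half_product_test g)%:R) <=
    E (fun g => (4 / M1 ^+ 2) * ((half_product g ^+ 2 + (- 2 * M1) * half_product g) + M1 ^+ 2)).
  apply: le_bexp => // g; rewrite /half_product_test -/tau.
  have -> : half_product g ^+ 2 + (- 2 * M1) * half_product g + M1 ^+ 2 =
    (M1 - half_product g) ^+ 2 by ring.
  case: (leP tau (half_product g)) => /= [h|h]; first by rewrite subrr mulr_ge0 ?sqr_ge0// divr_ge0 ?sqr_ge0.
  rewrite subr0 mulrAC ler_pdivlMr ?exprn_gt0// mul1r.
  have : M1 / 2 <= M1 - half_product g by lra.
  by move: (half_product g) => U *; nra.
move: miss; rewrite bexpZ !bexpD bexpZ !bexp_cst// mean_half_product mean_half_product2.
rewrite (_ : (fun g => - (half_product_test g)%:R) = fun g => -1 * (half_product_test g)%:R);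
  last by apply/funext => g; rewrite mulN1r.
rewrite bexpZ.
set H := \sum_y \sum_z _.
(* The covariance of one summand: taking mu mu^T out of the second moment turns cross products into
   squares, and the second moment of a half becomes m C + m^2 mu mu^T. *)
pose C y z : R := 2 * (y == z)%:R - a ^+ 2 * (pX y * pX z + pY y * pY z).
have HE : H = m%:R ^+ 2 * (\sum_y \sum_z C y z ^+ 2) +
   2 * m%:R ^+ 3 * (\sum_y \sum_z C y z * (mu y * mu z)) + M1 ^+ 2.
  have -> : M1 ^+ 2 = m%:R ^+ 4 * \sum_y \sum_z (mu y * mu z) ^+ 2.
    rewrite M1E exprMn -exprM; congr (_ * _).
    rewrite expr2 mulr_suml; apply: eq_bigr => y _.
    by rewrite mulr_sumr; apply: eq_bigr => z _; ring.
  rewrite !mulr_sumr -!big_split; apply: eq_bigr => y _ /=.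
  rewrite !mulr_sumr -!big_split; apply: eq_bigr => z _ /=.
  by rewrite /C /mu; ring.
have C2 : \sum_y \sum_z C y z ^+ 2 <= 12 * d%:R by exact: sqr_sum_le.
have Cmu : \sum_y \sum_z C y z * (mu y * mu z) <= 2 * N.
  have sq (p : 'I_d -> R) : \sum_y \sum_z p y * p z * (mu y * mu z) = (\sum_y p y * mu y) ^+ 2.
    rewrite expr2 mulr_suml; apply: eq_bigr => y _.
    by rewrite mulr_sumr; apply: eq_bigr => z _; ring.
  have dg : \sum_y \sum_z (y == z)%:R * (mu y * mu z) = N.
    apply: eq_bigr => y _; rewrite (bigD1 y)//= eqxx mul1r big1 ?addr0 -?expr2// => z zy.
    by rewrite eq_sym (negbTE zy) mul0r.
  have -> : \sum_y \sum_z C y z * (mu y * mu z) = 2 * N -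
      a ^+ 2 * ((\sum_y pX y * mu y) ^+ 2 + (\sum_y pY y * mu y) ^+ 2).
    rewrite -!sq -dg -big_split/= !mulr_sumr -sumrB; apply: eq_bigr => y _.
    rewrite -big_split/= !mulr_sumr -sumrB; apply: eq_bigr => z _.
    by rewrite /C; ring.
  by rewrite gerBl mulr_ge0 ?addr_ge0 ?sqr_ge0.
set pi := bexp _ _ _ _ => hpi.
suff : 4 / M1 ^+ 2 * (H + - 2 * M1 * M1 + M1 ^+ 2) <= 1 / 2 by move: hpi; lra.
have -> : H + - 2 * M1 * M1 + M1 ^+ 2 = m%:R ^+ 2 * (\sum_y \sum_z C y z ^+ 2) +
   2 * m%:R ^+ 3 * (\sum_y \sum_z C y z * (mu y * mu z)) by rewrite HE; ring.
rewrite mulrAC ler_pdivrMr ?exprn_gt0//.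
apply: (@le_trans _ _ (4 * (m%:R ^+ 2 * (12 * d%:R) + 2 * m%:R ^+ 3 * (2 * N)))).
  rewrite ler_pM2l// lerD// ler_pM2l// ?exprn_gt0//.
  by rewrite mulr_gt0// exprn_gt0.
have -> : 4 * (m%:R ^+ 2 * (12 * d%:R) + 2 * m%:R ^+ 3 * (2 * N)) =
  m%:R ^+ 2 * (48 * d%:R + 16 * (m%:R * N)) by ring.
have -> : 1 / 2 * M1 ^+ 2 = m%:R ^+ 2 * (1 / 2 * (m%:R * N) ^+ 2) by rewrite M1E; ring.
rewrite ler_pM2l ?exprn_gt0// -sd2.
move: (m%:R * N) (Num.sqrt d%:R) hN sd1 => x s hx s1.
have h1 : 48 * s ^+ 2 + 16 * x <= 64 * (x * x) by nra.
nra.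
Qed.

End sign_response.

(** * One-bit answers to a public random sign vector *)

Section seeded_response.
Context (R : realType) (d : nat) (a : R) (j0 : 'I_d) (m : nat).
Local Notation T := (msg d).
Local Notation sgn := (sg R).
Hypothesis a01 : 0 <= a <= 1.
Hypothesis m0 : (0 < m)%N.

Lemma norm_sg_mul_le1 (b b' : bool) : `|sgn b * sgn b'| <= 1.
Proof. by rewrite normrM !norm_sg mulr1. Qed.

Lemma avg_sg_mul0 (b : bool) : avg (fun t : signs d => sgn b * sgn (t j0)) = 0.
Proof. by rewrite avgZ avg_sg mulr0. Qed.

Lemma norm0_le1 (t : T) : `|0 : R| <= 1. Proof. by rewrite normr0. Qed.

Lemma avg_zero : avg (fun _ : signs d => 0 : R) = 0.
Proof. by rewrite avg_cst// card_signs. Qed.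

(* The answer to the empty past ignores the datum: its first component is the public seed. *)
Definition seeded_mass (g : seq (T * T)) (x : 'I_d) : mass R d :=
  if g is p :: _ then
    tilt_mass a01 (f := fun t : T => sgn (p.1 x) * sgn (t j0))
      (fun t => norm_sg_mul_le1 (p.1 x) (t j0)) (avg_sg_mul0 (p.1 x))
  else tilt_mass a01 (f := fun=> 0) norm0_le1 avg_zero.

Lemma seeded_LDP (eps : R) g x x' t : 0 < eps <= 1 -> a = eps / 3 ->
  seeded_mass g x t <= expR eps * seeded_mass g x' t.
Proof.
move=> e01 aE; case: g => [|p g]; apply: (tilt_LDP a01 t e01 aE) => t'.
- by rewrite normr0.
- by rewrite normr0.
- exact: norm_sg_mul_le1.
- exact: norm_sg_mul_le1.
Qed.

(** Writes the one-bit answers as sign answers for a weight vector supported on [j0]. It is no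
    longer a probability vector, but the moment formulas for [pair_law] hold for any weights. *)
Definition concentrate (q : 'I_d -> R) (h : T) (x : 'I_d) : R := sign_field q h * (x == j0)%:R.

Lemma sign_field_concentrate q h t : sign_field (concentrate q h) t = sign_field q h * sgn (t j0).
Proof.
rewrite {1}/sign_field (bigD1 j0)//= /concentrate eqxx mulr1 big1 ?addr0// => x /negbTE ->.
by rewrite mulr0 mul0r.
Qed.

Context (pX pY : 'I_d -> R).
Hypothesis (ppX : pmf pX) (ppY : pmf pY).
Local Notation lam h := (pair_law a (concentrate pX h) (concentrate pY h)).
Local Notation law := (batch_law seeded_mass seeded_mass pX pY).

Lemma batch_law_seeded p0 g p : law (p0 :: g) p = lam p0.1 p.
Proof.
rewrite /batch_law/= /pair_law.
rewrite (tilt_mix a (fun x (t : T) => sgn (p0.1 x) * sgn (t j0)) _ ppX.2).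
rewrite (tilt_mix a (fun x (t : T) => sgn (p0.1 x) * sgn (t j0)) _ ppY.2).
have e (q : 'I_d -> R) : (fun t : T => \sum_x q x * (sgn (p0.1 x) * sgn (t j0))) =
    sign_field (concentrate q p0.1).
  apply/funext => t; rewrite sign_field_concentrate /sign_field mulr_suml.
  by apply: eq_bigr => x _; rewrite mulrA.
by rewrite !e.
Qed.

Lemma batch_law_seed p : law [::] p = #|{: signs d}|%:R^-1 * #|{: signs d}|%:R^-1.
Proof.
by rewrite /batch_law/= /tilt mulr0 addr0 mulr1 -!mulr_suml ppX.2 ppY.2 !mul1r.
Qed.

Lemma lam_pmf h : (forall p, 0 <= lam h p) /\ \sum_p lam h p = 1.
Proof.
have hb := batch_law_pmf seeded_mass seeded_mass ppX ppY [:: (h, h)].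
split => [p|]; first by rewrite -(batch_law_seeded (h, h) [::] p); exact: hb.1.
by rewrite -[RHS]hb.2; apply: eq_bigr => p _; rewrite batch_law_seeded.
Qed.

Let nu h : R := a * (sign_field pX h - sign_field pY h).

Lemma mean_lam h : mean (lam h) (sdiff R j0) = nu h.
Proof. by rewrite mean_sdiff// /concentrate eqxx !mulr1. Qed.

Lemma mean_lam2 h : mean (lam h) (fun p => sdiff R j0 p * sdiff R j0 p) =
  2 - 2 * a ^+ 2 * (sign_field pX h * sign_field pY h).
Proof. by rewrite mean_sdiff2// /concentrate eqxx !mulr1; ring. Qed.

Lemma norm_sign_field_le1 (q : 'I_d -> R) (h : T) : pmf q -> `|sign_field q h| <= 1.
Proof.
move=> [q0 q1]; apply: le_trans (ler_norm_sum _ _ _) _; rewrite -q1; apply: ler_sum => x _.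
by rewrite normrM norm_sg mulr1 ger0_norm.
Qed.

Lemma mean_lam2_le h : mean (lam h) (fun p => sdiff R j0 p * sdiff R j0 p) <= 4.
Proof.
rewrite mean_lam2.
have := norm_sign_field_le1 h ppX; have := norm_sign_field_le1 h ppY.
rewrite !ler_norml => /andP[y1 y2] /andP[x1 x2].
have xy : - 1 <= sign_field pX h * sign_field pY h by nra.
have a2 : 0 <= a ^+ 2 /\ a ^+ 2 <= 1 by case/andP: a01 => *; split; nra.
by case: a2 => *; nra.
Qed.

(** The squared sum has mean at most 4 m under the null, so Markov gives 4 / 2^19 = 2^-17. *)
Definition large_sum (g : seq (T * T)) : bool := 2 ^+ 19 * m%:R <= ssum (sdiff R j0) g ^+ 2.
Definition seeded_test (g : seq (T * T)) : bool := large_sum (behead g).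
Definition large_sum_prob h : R := bexp (fun=> lam h) m [::] (fun g => (large_sum g)%:R).

Lemma batch_rej_prob_seeded :
  batch_rej_prob seeded_mass seeded_mass m.+1 seeded_test pX pY =
  avg (fun h : signs d => large_sum_prob h).
Proof.
rewrite /batch_rej_prob /=.
have e p : bexp law m [:: p] (fun g => (seeded_test g)%:R) = large_sum_prob p.1.
  rewrite bexp_shift /large_sum_prob; apply: eq_bexp_law => g q.
  exact: batch_law_seeded.
under eq_bigr do rewrite e batch_law_seed.
transitivity (\sum_(h : T) \sum_(h' : T) (#|{: signs d}|%:R^-1 * #|{: signs d}|%:R^-1) * large_sum_prob h).
  by rewrite pair_bigA.
rewrite /avg mulr_sumr; apply: eq_bigr => h _; rewrite sumr_const -[_ *+ _]mulr_natl.
have n0 : #|{: signs d}|%:R != 0 :> R by rewrite pnatr_eq0 -lt0n card_signs.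
by rewrite mulrA; congr (_ * _); rewrite mulrA divff// mul1r.
Qed.

Let mR : 0 < m%:R :> R. Proof. by rewrite ltr0n. Qed.
Let lp h : law_pmf (fun _ : seq (T * T) => lam h). Proof. by move=> ?; exact: lam_pmf. Qed.

Lemma seeded_null : pX = pY ->
  batch_rej_prob seeded_mass seeded_mass m.+1 seeded_test pX pY <= 2^-1 ^+ 17.
Proof.
move=> XY; rewrite batch_rej_prob_seeded -(avg_cst (2^-1 ^+ 17) (card_signs d)).
apply: le_avg => h.
have t0 : 0 < 2 ^+ 19 * m%:R :> R by rewrite mulr_gt0 ?exprn_gt0.
apply: (@le_trans _ _ (bexp (fun=> lam h) m [::] (fun g => (2 ^+ 19 * m%:R)^-1 *
    (ssum (sdiff R j0) g * ssum (sdiff R j0) g)))).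
  apply: le_bexp => // g; rewrite /large_sum -expr2.
  case: (leP (2 ^+ 19 * m%:R) _) => /= [hg|_].
    by rewrite mulrC ler_pdivlMr// mul1r.
  by rewrite mulr_ge0 ?sqr_ge0// invr_ge0 ltW.
rewrite bexpZ bexp_ssum2_nil; last exact: (lam_pmf h).2.
have nu0 : nu h = 0 by rewrite /nu XY subrr mulr0.
rewrite mean_lam nu0 mulr0 mulr0 addr0 mulrC ler_pdivrMr//.
apply: (@le_trans _ _ (m%:R * 4)); first by rewrite ler_pM2l// mean_lam2_le.
have -> : 2^-1 ^+ 17 * (2 ^+ 19 * m%:R) = m%:R * 4 :> R by field.
by [].
Qed.

(** The squared mean of the sum is then at least four times the threshold, so a miss deviates from
    the mean by at least half of it. *)
Lemma large_sum_prob_ge h : 2 ^+ 21 <= m%:R * nu h ^+ 2 -> 99 / 100 <= large_sum_prob h.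
Proof.
move=> hnu.
have nu2 : 0 < nu h ^+ 2 by rewrite -(pmulr_rgt0 _ mR); apply: lt_le_trans hnu; rewrite exprn_gt0.
pose M := m%:R * nu h.
have M2 : 0 < M ^+ 2 by rewrite exprMn mulr_gt0// exprn_gt0.
have tM : 4 * (2 ^+ 19 * m%:R) <= M ^+ 2.
  have -> : M ^+ 2 = m%:R * (m%:R * nu h ^+ 2) by rewrite /M; ring.
  have -> : 4 * (2 ^+ 19 * m%:R) = m%:R * 2 ^+ 21 :> R by ring.
  by rewrite ler_pM2l.
have : bexp (fun=> lam h) m [::] (fun g => 1 + -1 * (large_sum g)%:R) <=
    bexp (fun=> lam h) m [::] (fun g => (4 / M ^+ 2) *
      ((ssum (sdiff R j0) g * ssum (sdiff R j0) g + (- 2 * M) * ssum (sdiff R j0) g) + M ^+ 2)).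
  apply: le_bexp => // g; rewrite /large_sum; move: (ssum _ g) => S.
  have -> : S * S + - 2 * M * S + M ^+ 2 = (S - M) ^+ 2 by ring.
  case: (leP (2 ^+ 19 * m%:R) _) => /= [hg|hg].
    by rewrite mulr1 subrr mulr_ge0 ?sqr_ge0// divr_ge0 ?sqr_ge0.
  rewrite mulr0 addr0 mulrAC ler_pdivlMr// mul1r.
  have hS : 4 * S ^+ 2 <= M ^+ 2 by lra.
  have := sqr_ge0 (4 * S - M); nra.
rewrite bexpD bexp_cst// bexpZ -/(large_sum_prob h).
rewrite bexpZ !bexpD bexpZ bexp_cst// bexp_ssum2_nil ?bexp_ssum; try exact: (lam_pmf h).2.
rewrite mean_lam /ssum big_nil add0r -/M.
set G := mean _ _ => hp.
have G4 : G <= 4 by exact: mean_lam2_le.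
have e : m%:R * G + m%:R * (m%:R - 1) * (nu h * nu h) + - 2 * M * M + M ^+ 2 =
  m%:R * (G - nu h ^+ 2) by rewrite /M; ring.
rewrite e in hp.
suff : 4 / M ^+ 2 * (m%:R * (G - nu h ^+ 2)) <= 1 / 100 by move: hp; lra.
rewrite mulrAC ler_pdivrMr//.
have -> : M ^+ 2 = m%:R * (m%:R * nu h ^+ 2) by rewrite /M; ring.
rewrite mulrCA [1 / 100 * _]mulrCA ler_pM2l//.
have : 2 ^+ 11 <= 2 ^+ 21 :> R by rewrite ler_weXn2l// ler1n.
by lra.
Qed.

(** A Paley-Zygmund argument for y = X^2 / v, of mean 1 and second moment at most 3. The quadratic
    (y - 1/4)(7 - y) / 12 is at most 0 for 0 <= y <= 1/4 and at most 99/100 everywhere, and its mean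
    is at least (29/4 - 7/4 - 3) / 12 = 5/24. For y > 1/4 the seed h carries the signal 2^23 / 4 =
    2^21 required by [large_sum_prob_ge]. *)
Lemma seeded_alt : 2 ^+ 23 <= m%:R * a ^+ 2 * \sum_x (pX x - pY x) ^+ 2 ->
  3 / 20 <= batch_rej_prob seeded_mass seeded_mass m.+1 seeded_test pX pY.
Proof.
rewrite batch_rej_prob_seeded; set v := \sum_x _ => hv.
pose X (h : signs d) : R := rad (enum 'I_d) (fun x => pX x - pY x) h.
have XE h : sign_field pX h - sign_field pY h = X h.
  by rewrite /X /rad big_enum/= -sumrB; apply: eq_bigr => x _; rewrite mulrBl.
have v_ge0 : 0 <= v by apply: sumr_ge0 => x _; exact: sqr_ge0.
have v0 : 0 < v.
  rewrite lt_neqAle v_ge0 andbT; apply/negP => /eqP v0.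
  by move: hv; rewrite -v0 mulr0 leNgt exprn_gt0.
have EX2 : avg (fun h => X h * X h) = v.
  by rewrite avg_rad2 ?enum_uniq// big_enum/=; apply: eq_bigr => x _; rewrite expr2.
have EX4 : avg (fun h => X h ^+ 4) <= 3 * v ^+ 2.
  by have := avg_rad4 (fun x => pX x - pY x) (enum_uniq 'I_d); rewrite big_enum.
have P0 h : 0 <= large_sum_prob h.
  by rewrite -(bexp_cst m [::] 0 (lp h)); apply: le_bexp => // g; rewrite ler0n.
have main h : 12^-1 * (29 / 4 * (v^-1 * (X h * X h)) + (- (7 / 4) + -1 * (v^-1 ^+ 2 * X h ^+ 4)))
    <= large_sum_prob h.
  pose y := v^-1 * X h ^+ 2.
  have yE : y * v = X h ^+ 2 by rewrite /y mulrAC mulVf ?gt_eqF// mul1r.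
  have -> : 12^-1 * (29 / 4 * (v^-1 * (X h * X h)) + (- (7 / 4) + -1 * (v^-1 ^+ 2 * X h ^+ 4))) =
    12^-1 * ((y - 1 / 4) * (7 - y)) by rewrite /y; field; rewrite gt_eqF.
  have y0 : 0 <= y by rewrite mulr_ge0 ?sqr_ge0// invr_ge0.
  have [y4|y4] := leP y (1 / 4); first by apply: le_trans (P0 h); nra.
  apply: (@le_trans _ _ (99 / 100)); first by have := sqr_ge0 (y - 29 / 8); nra.
  apply: large_sum_prob_ge; rewrite /nu XE exprMn -yE.
  have ma0 : 0 <= m%:R * a ^+ 2 * v by rewrite mulr_ge0// mulr_ge0 ?sqr_ge0// ltW.
  have -> : m%:R * (a ^+ 2 * (y * v)) = (m%:R * a ^+ 2 * v) * y by ring.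
  have : (m%:R * a ^+ 2 * v) * (1 / 4) <= (m%:R * a ^+ 2 * v) * y by rewrite ler_wpM2l// ltW.
  have e23 : 2 ^+ 23 = 4 * 2 ^+ 21 :> R by ring.
  by move: hv; rewrite e23; lra.
apply: le_trans (le_avg main).
rewrite avgZ avgD avgZ avgZ avgD avgZ avgZ avg_cst ?card_signs// EX2 mulVf ?gt_eqF// mulr1.
have : v^-1 ^+ 2 * avg (fun h => X h ^+ 4) <= 3.
  by rewrite exprVn mulrC ler_pdivrMr ?exprn_gt0.
lra.
Qed.

End seeded_response.

(** * Batch size and upper bounds on the radius *)

Section upper_bounds.
Context (R : realType) (d n1 n2 : nat) (eps p alpha beta : R).
Hypothesis (d2 : (2 <= d)%N) (len : (n1 <= n2)%N).
Hypothesis (e01 : 0 < eps <= 1) (p12 : 1 <= p <= 2).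
Hypothesis (a01 : 0 < alpha < 1) (b01 : 0 < beta < 1) (ab : alpha + beta <= 1 / 2).

Let L : R := ln (1 / (alpha * beta)).
Let N : R := Num.sqrt (n1%:R * eps ^+ 2).
Let a : R := eps / 3.
Let r4 : R := d%:R `^ 4^-1.
Hypothesis n1L : 200 * L <= n1%:R.

Let ab0 : 0 < alpha * beta.
Proof. by case/andP: a01 => ? _; case/andP: b01 => ? _; rewrite mulr_gt0. Qed.

(** From alpha beta <= 1/16 and exp 2 <= 16. *)
Let L2 : 2 <= L.
Proof.
rewrite -[2]expRK ler_ln ?posrE ?expR_gt0 ?divr_gt0//.
apply: (le_trans (expR2_le16 R)); rewrite ler_pdivlMr//.
case/andP: a01 => al0 _; case/andP: b01 => be0 _.
have h : (alpha + beta) ^+ 2 <= (1 / 2) ^+ 2.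
  by apply: lerXn2r; rewrite ?nnegrE//; lra.
by have := sqr_ge0 (alpha - beta); lra.
Qed.

Let L1 : 1 <= L. Proof. by apply: le_trans L2; rewrite ler1n. Qed.
Let L0 : 0 < L. Proof. exact: lt_le_trans L2. Qed.
Let e0 : 0 < eps. Proof. by case/andP: e01. Qed.
Let n0 : 0 < n1%:R :> R.
Proof. by apply: lt_le_trans n1L; rewrite mulr_gt0. Qed.
Let N2 : N ^+ 2 = n1%:R * eps ^+ 2.
Proof. by rewrite sqr_sqrtr// mulr_ge0// ?sqr_ge0// ltW. Qed.
Let N0 : 0 < N. Proof. by rewrite sqrtr_gt0 mulr_gt0// exprn_gt0. Qed.
Let d0 : (0 < d)%N := ltnW d2.
Let dR0 : 0 < d%:R :> R. Proof. by rewrite ltr0n. Qed.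
Let r40 : 0 < r4. Proof. exact: powR_gt0. Qed.
Let a01' : 0 <= a <= 1. Proof. by case/andP: e01 => *; rewrite /a; apply/andP; split; lra. Qed.

Let m := Num.truncn (n1%:R / (200 * L)).

Let m_le : m%:R * (200 * L) <= n1%:R.
Proof.
rewrite -ler_pdivlMr ?mulr_gt0//.
by have /andP[] := truncn_itv (ltW (divr_gt0 n0 (mulr_gt0 (ltr0n R 200) L0))).
Qed.

Let m_gt0 : (0 < m)%N.
Proof. by rewrite truncn_gt0 ler_pdivlMr ?mulr_gt0// mul1r. Qed.

(** The argument of the floor is at least 1, so the floor is at least half of it. *)
Let m_ge : n1%:R <= m%:R * (400 * L).
Proof.
have /andP[_] := truncn_itv (ltW (divr_gt0 n0 (mulr_gt0 (ltr0n R 200) L0))).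
rewrite ltr_pdivrMr ?mulr_gt0// -/m -addn1 natrD => h.
have : 1 <= m%:R :> R by rewrite ler1n.
by move: L0 h; nra.
Qed.

(** At least 100 L - 1 >= 50 L batches fit, and 49/50 <= exp (-1/50), so the power is at most exp (-
    L) = alpha beta. *)
Lemma batch_count_le b : (0 < b <= m + m)%N ->
  (49 / 50) ^+ (n1 %/ b) <= alpha /\ (49 / 50) ^+ (n1 %/ b) <= beta.
Proof.
move=> /andP[b0 bm]; set k := (n1 %/ b)%N.
have hk : 50 * L <= k%:R.
  have h1 : n1%:R < k.+1%:R * b%:R :> R by rewrite -natrM ltr_nat ltn_ceil.
  have h2 : k.+1%:R * b%:R <= k.+1%:R * (2 * m%:R) :> R.
    by rewrite ler_wpM2l// -natrM ler_nat mul2n -addnn.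
  have m1 : 0 < m%:R :> R by rewrite ltr0n.
  have h3 : m%:R * (200 * L) < m%:R * (2 * k.+1%:R).
    have e : k.+1%:R * (2 * m%:R) = m%:R * (2 * k.+1%:R) :> R by ring.
    by rewrite e in h2; exact: le_lt_trans m_le (lt_le_trans h1 h2).
  move: h3; rewrite ltr_pM2l// -addn1 natrD => h3.
  by move: L2 h3; lra.
have hab : (49 / 50) ^+ k <= alpha * beta.
  have -> : alpha * beta = expR (- L).
    by rewrite /L div1r lnV ?posrE// opprK lnK ?posrE.
  have h1 : 49 / 50 <= expR (- 50^-1) :> R by apply: le_trans (expR_ge1Dx _); lra.
  apply: (@le_trans _ _ (expR (- 50^-1) ^+ k)).
    by apply: lerXn2r; rewrite ?nnegrE ?expR_ge0//; lra.
  by rewrite -expRM_natl ler_expR; lra.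
by case/andP: a01 => *; case/andP: b01 => *; split; apply: le_trans hab _; nra.
Qed.

Lemma sum_sqr_ge (pX pY : 'I_d -> R) (rho : R) :
  0 <= rho -> rho <= Lp_dist p pX pY ->
  (rho / d%:R `^ (p^-1 - 2^-1)) ^+ 2 <= \sum_x (pX x - pY x) ^+ 2.
Proof.
move=> rho0 h; have S0 : 0 <= \sum_x (pX x - pY x) ^+ 2 by apply: sumr_ge0 => x _; exact: sqr_ge0.
rewrite -[leRHS]sqr_sqrtr// lerXn2r ?nnegrE ?sqrtr_ge0//.
  by rewrite divr_ge0// powR_ge0.
rewrite ler_pdivrMr ?powR_gt0// mulrC.
exact: le_trans h (Lp_dist_le_L2 _ _ d0 p12).
Qed.

(* [t] is the squared signal-to-noise ratio that one batch needs. *)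
Lemma signal_ge (pX pY : 'I_d -> R) (s t : R) : 0 < s ->
  s * (d%:R `^ (p^-1 - 2^-1) / N) <= Lp_dist p pX pY ->
  t * (60 ^+ 2 * L) <= s ^+ 2 ->
  t <= m%:R * (a ^+ 2 * \sum_x (pX x - pY x) ^+ 2).
Proof.
move=> s0 h ht; set D := d%:R `^ _ in h.
have D0 : 0 < D by exact: powR_gt0.
have := sum_sqr_ge (ltW (mulr_gt0 s0 (divr_gt0 D0 N0))) h; rewrite -/D.
have -> : (s * (D / N) / D) ^+ 2 = s ^+ 2 / N ^+ 2 by field; rewrite !gt_eqF.
set S := \sum_x _; rewrite ler_pdivrMr ?exprn_gt0// N2 => hS.
have S0 : 0 <= S by apply: sumr_ge0 => x _; exact: sqr_ge0.
have h1 : S * (n1%:R * eps ^+ 2) <= S * ((m%:R * (400 * L)) * eps ^+ 2).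
  by rewrite ler_wpM2l// ler_wpM2r// sqr_ge0.
(* 60^2 = 400 * 9: the 400 of [m_ge] and the square of eps / a = 3. *)
have : t * (60 ^+ 2 * L) <= m%:R * (a ^+ 2 * S) * (60 ^+ 2 * L).
  apply: le_trans ht (le_trans hS (le_trans h1 _)).
  by rewrite le_eqVlt; apply/orP; left; apply/eqP; rewrite /a; field.
by rewrite ler_pM2r// mulr_gt0.
Qed.

Lemma rho_NI_le (C : R) : C = 2 ^+ 6 * 60 ->
  (rho_NI d n1 n2 eps p alpha beta <= (C * (d%:R `^ (p^-1 - 4^-1) / N) * L ^+ 2)%:E)%E.
Proof.
move=> CE.
have r42 : d%:R `^ 2^-1 = r4 ^+ 2.
  by rewrite -powR_mulrn ?(ltW r40)// /r4 -powRrM; congr (_ `^ _); field.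
have DE : d%:R `^ (p^-1 - 4^-1) = d%:R `^ (p^-1 - 2^-1) * r4.
  rewrite /r4 -powRD; first by congr (_ `^ _); lra.
  by apply/implyP => _; rewrite gt_eqF.
have C0 : 0 < C by rewrite CE mulr_gt0// exprn_gt0.
have b2m : (0 < m + m <= m + m)%N by rewrite leqnn addn_gt0 m_gt0.
have [ka kb] := batch_count_le b2m.
have s0 : 0 < C * r4 * L ^+ 2 := mulr_gt0 (mulr_gt0 C0 r40) (exprn_gt0 2 L0).
have rhoE : C * (d%:R `^ (p^-1 - 4^-1) / N) * L ^+ 2 =
    (C * r4 * L ^+ 2) * (d%:R `^ (p^-1 - 2^-1) / N) by rewrite DE; ring.
rewrite rhoE.
apply: (@rho_star_le R d (fun=> sign_mass a01') (fun=> sign_mass a01') (m + m)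
  (half_product_test R m) true n1 n2 eps p alpha beta) => //.
- exact: ltW.
- by case/andP: b2m.
- by rewrite mulr_gt0// divr_gt0// powR_gt0.
- by move=> g x x' t; apply: (tilt_LDP a01' t e01) => // t'; rewrite norm_sg.
- by move=> g x x' t; apply: (tilt_LDP a01' t e01) => // t'; rewrite norm_sg.
- by move=> P pP; exact: half_product_null.
- move=> pX pY ppX ppY hrho; apply: half_product_alt => //.
  have -> : \sum_y (a * (pX y - pY y)) ^+ 2 = a ^+ 2 * \sum_y (pX y - pY y) ^+ 2.
    by rewrite mulr_sumr; apply: eq_bigr => y _; rewrite exprMn.
  apply: (signal_ge s0 hrho).
  rewrite -powR12_sqrt ?(ltW dR0)// r42.
  have -> : (C * r4 * L ^+ 2) ^+ 2 = C ^+ 2 * r4 ^+ 2 * (L * L ^+ 3) by ring.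
  (* The batch test needs only a factor sqrt L; the squared radius offers L^4, and L >= 1. *)
  have L3 : 1 <= L ^+ 3 := exprn_ege1 3 L1.
  have rL : 0 < r4 ^+ 2 * L by rewrite mulr_gt0// exprn_gt0.
  have -> : 2 ^+ 12 * r4 ^+ 2 * (60 ^+ 2 * L) = (2 ^+ 12 * 60 ^+ 2) * (r4 ^+ 2 * L) by ring.
  have -> : C ^+ 2 * r4 ^+ 2 * (L * L ^+ 3) = C ^+ 2 * L ^+ 3 * (r4 ^+ 2 * L) by ring.
  rewrite ler_pM2r//.
  have -> : 2 ^+ 12 * 60 ^+ 2 = C ^+ 2 * 1 by rewrite CE mulr1 exprMn -exprM.
  by rewrite ler_pM2l// exprn_gt0.
Qed.

Lemma rho_I_le (C : R) : C = 2 ^+ 12 * 60 ->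
  (rho_I d n1 n2 eps p alpha beta <=
   (C * (d%:R `^ (p^-1 - 2^-1) / N) * (ln (1 / beta) ^+ 2 + Num.sqrt L))%:E)%E.
Proof.
move=> CE; have C0 : 0 < C by rewrite CE mulr_gt0// exprn_gt0.
have b2m : (0 < m.+1 <= m + m)%N.
  by rewrite ltn0Sn/= -addn1 leq_add2l.
have [ka kb] := batch_count_le b2m.
set lb := ln (1 / beta) ^+ 2 + Num.sqrt L.
have sL0 : 0 < Num.sqrt L by rewrite sqrtr_gt0.
have lbL : Num.sqrt L <= lb by rewrite lerDr sqr_ge0.
have s0 : 0 < C * lb by rewrite mulr_gt0// (lt_le_trans sL0).
rewrite mulrAC.
have j0 : 'I_d := Ordinal d0.
apply: (@rho_star_le R d (seeded_mass j0 a01') (seeded_mass j0 a01') m.+1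
  (seeded_test R j0 m) false n1 n2 eps p alpha beta) => //.
- exact: ltW.
- by rewrite mulr_gt0// divr_gt0// powR_gt0.
- by move=> g x x' t; exact: seeded_LDP.
- by move=> g x x' t; exact: seeded_LDP.
- by move=> P pP; exact: seeded_null.
- move=> pX pY ppX ppY hrho; apply: seeded_alt => //; rewrite -mulrA.
  apply: (signal_ge s0 hrho).
  rewrite exprMn.
  have h1 : L <= lb ^+ 2.
    by rewrite -[leLHS]sqr_sqrtr ?(ltW L0)// lerXn2r ?nnegrE ?(ltW sL0)// (le_trans (ltW sL0)).
  apply: (@le_trans _ _ (C ^+ 2 * L)); last by rewrite ler_pM2l ?exprn_gt0.
  (* C^2 = 2^24 * 60^2 covers the signal 2^23 asked for by [seeded_alt]. *)
  rewrite mulrA ler_pM2r// CE exprMn -exprM ler_pM2r ?exprn_gt0//.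
  by rewrite ler_weXn2l// ler1n.
Qed.

End upper_bounds.

Theorem theorem5 :
  exists c C C0 C0' : Rdefinitions.R, [/\ 0 < c, 0 < C, 0 < C0, 0 < C0' &
  forall (d n1 n2 : nat) (eps p alpha beta : Rdefinitions.R),
    (2 <= d)%N -> (1 <= n1)%N -> (n1 <= n2)%N ->
    0 < eps <= 1 -> 1 <= p <= 2 -> 0 < alpha < 1 -> 0 < beta < 1 ->
    alpha + beta <= 1 / 2 ->
    (C0 * ln (1 / (alpha * beta)) <= n1%:R ->
      ((c * Num.min (d%:R `^ (p^-1 - 4^-1) / Num.sqrt (n1%:R * eps ^+ 2))
                    (1 / (d%:R `^ (1 - p^-1) * Num.sqrt (ln d%:R))))%:E
         <= rho_NI d n1 n2 eps p alpha beta)%E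
      /\ (rho_NI d n1 n2 eps p alpha beta
         <= (C * (d%:R `^ (p^-1 - 4^-1) / Num.sqrt (n1%:R * eps ^+ 2))
               * ln (1 / (alpha * beta)) ^+ 2)%:E)%E)
    /\
    (C0' * ln (1 / (alpha * beta)) <= n1%:R * eps ^+ 2 ->
      ((c * Num.min (d%:R `^ (p^-1 - 2^-1) / Num.sqrt (n1%:R * eps ^+ 2))
                    (if (p == 1) || (p == 2) then 1 else d%:R `^ (p^-1 - 1)))%:E
         <= rho_I d n1 n2 eps p alpha beta)%E
      /\ (rho_I d n1 n2 eps p alpha beta
         <= (C * (d%:R `^ (p^-1 - 2^-1) / Num.sqrt (n1%:R * eps ^+ 2))
               * (ln (1 / beta) ^+ 2 + Num.sqrt (ln (1 / (alpha * beta)))))%:E)%E)].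
Proof.
exists (200 * 200)^-1, (2 ^+ 12 * 60), 200, 200; split.
- by rewrite invr_gt0 mulr_gt0.
- by rewrite mulr_gt0// exprn_gt0.
- by [].
- by [].
move=> d n1 n2 eps p alpha beta d2 n10 len e01 p12 a01 b01 ab.
have /andP[a0 _] := a01; have /andP[b0 _] := b01; have /andP[e0 e1] := e01.
split=> hn; split.
- exact: (rho_NI_ge d2 n10 len e01 p12 a0 b0 ab erefl).
- apply: le_trans (rho_NI_le d2 len e01 p12 a01 b01 ab hn erefl) _.
  rewrite lee_fin; apply: ler_wpM2r; first exact: sqr_ge0.
  apply: ler_wpM2r; first by rewrite divr_ge0 ?powR_ge0 ?sqrtr_ge0.
  by rewrite ler_pM2r// ler_weXn2l// ler1n.
- exact: (rho_I_ge d2 n10 len e01 p12 a0 b0 ab erefl).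
- apply: (rho_I_le d2 len e01 p12 a01 b01 ab _ erefl).
  (* As eps <= 1, the condition on n1 eps^2 implies the one on n1. *)
  apply: le_trans hn _; rewrite -[leRHS]mulr1 ler_wpM2l//.
  by rewrite exprn_ile1// ltW.
Qed.
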